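(* Let $M,N$ be $\lambda$-terms with $M\to_\beta N$ (one-step $\beta$-reduction), and let $\vec x$ be a list of distinct variables with $FV(M)\cup FV(N)\subseteq\vec x$. There is a natural isomorphism $\llbracket M\rrbracket_{\vec x}\cong\llbracket N\rrbracket_{\vec x}$.
   Context: $[n]=\{1,\dots,n\}$. Fix a class $\mathcal C$ of functions between finite ordinals equal to one of: all bijections, all injections, all surjections, all functions. For a small category $X$, $SX$ has finite lists of objects of $X$ as objects and morphisms $\langle x_1,\dots,x_n\rangle\to\langle y_1,\dots,y_m\rangle$ the tuples $\langle\alpha,f_1,\dots,f_m\rangle$ with $\alpha:[m]\to[n]$ in $\mathcal C$, $f_i:x_{\alpha(i)}\to y_i$; composite of $\langle\alpha,\vec f\rangle$ then $\langle\beta,\vec g\rangle$ is $\langle\alpha\circ\beta,(g_i\circ f_{\beta(i)})_i\rangle$; tensor $\oplus$ = concatenation, unit $\langle\rangle$. Fix a small category $A$. $D=D_A$ is the colimit of $D_0=A$, $D_{k+1}=(SD_k)^{o}\times D_k\sqcup A$ along canonical inclusions: objects $a::=o\mid\vec a\Rightarrow a$ ($o\in\mathrm{Ob}(A)$); morphisms are those of $A$ and $\langle\alpha,\vec f\rangle\Rightarrow f:(\vec a\Rightarrow a)\to(\vec a'\Rightarrow a')$ for $\langle\alpha,\vec f\rangle:\vec a'\to\vec a$ in $SD$, $f:a\to a'$. $SD=S(D_A)$. Contexts are objects of $(SD)^n$; $\otimes$ is componentwise concatenation; $\Delta\oplus\langle\vec a\rangle$ appends a component. Denotation $\llbracket M\rrbracket_{\vec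 x}:((SD)^n)^{o}\times D\to\mathrm{Set}$ for $\vec x=\langle x_1..x_n\rangle\supseteq FV(M)$ (functorial action from hom-functors and coends; in the abstraction case $\langle\alpha,\vec f\rangle\Rightarrow f$ acts as $\llbracket M\rrbracket(1\oplus\langle\alpha,\vec f\rangle,f)$): $\llbracket x_i\rrbracket_{\vec x}(\Delta,a)=(SD)^n(\Delta,\langle\langle\rangle,\dots,\langle a\rangle,\dots,\langle\rangle\rangle)$ ($\langle a\rangle$ at position $i$); $\llbracket\lambda y.P\rrbracket_{\vec x}(\Delta,a)=\llbracket P\rrbracket_{\vec x\oplus\langle y\rangle}(\Delta\oplus\langle\vec a'\rangle,a')$ if $a=\vec a'\Rightarrow a'$, $\emptyset$ if $a$ atomic; $\llbracket PQ\rrbracket_{\vec x}(\Delta,a)=\int^{\vec a=\langle a_1..a_k\rangle\in SD}\int^{\Gamma_0..\Gamma_k\in(SD)^n}\llbracket P\rrbracket_{\vec x}(\Gamma_0,\vec a\Rightarrow a)\times\prod_{i=1}^k\llbracket Q\rrbracket_{\vec x}(\Gamma_i,a_i)\times(SD)^n(\Delta,\bigotimes_{i=0}^k\Gamma_i)$. *)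

(* Defs.v *)
(* Categorical (profunctorial) semantics of the untyped lambda-calculus:
   the category D_A, the free construction SD (lists with C-reindexings),
   contexts (SD)^n, and the denotation [[M]]_x : ((SD)^n)^op x D -> Set,
   with coends in Set realised as quotients by the generated equivalence. *)
From mathcomp Require Import all_boot.
From Stdlib Require Import ClassicalEpsilon Relation_Operators.
Set Implicit Arguments. Unset Strict Implicit. Unset Printing Implicit Defensive.

Record category := Category {
  Ob : Type;
  Hom : Ob -> Ob -> Type;
  idm : forall a, Hom a a;
  hcomp : forall a b c, Hom a b -> Hom b c -> Hom a c;
  comp_idl : forall a b (f : Hom a b), hcomp (idm a) f = f;
  comp_idr : forall a b (f : Hom a b), hcomp f (idm b) = f;
  comp_assoc : forall a b c d (f : Hom a b) (g : Hom b c) (h : Hom c d),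
      hcomp (hcomp f g) h = hcomp f (hcomp g h) }.
Arguments idm {_} a.
Arguments hcomp {_ a b c} _ _.

Inductive fclass := CBij | CInj | CSurj | CAll.

Definition inC (c : fclass) {m n : nat} (al : 'I_m -> 'I_n) : Prop :=
  match c with
  | CBij => injective al /\ (forall j, exists i, al i = j)
  | CInj => injective al
  | CSurj => forall j, exists i, al i = j
  | CAll => True
  end.

Lemma inC_id c m : inC c (fun i : 'I_m => i).
Proof.
case: c => //=; [split=> [x y //|j]; by exists j| by move=> j; exists j].
Qed.

Lemma inC_comp c m n p (b : 'I_m -> 'I_n) (a : 'I_p -> 'I_m) :
  inC c b -> inC c a -> inC c (fun i => b (a i)).
Proof.
case: c => //=.
- move=> [ib sb] [ia sa]; split; first by move=> x y e; apply: ia; apply: ib.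
  move=> j; have [k <-] := sb j; have [i <-] := sa k; by exists i.
- by move=> ib ia x y e; apply: ia; apply: ib.
- move=> sb sa j; have [k <-] := sb j; have [i <-] := sa k; by exists i.
Qed.

Lemma inC_by c m n (f : 'I_m -> 'I_n) :
  (c = CBij \/ c = CInj -> injective f) ->
  (c = CBij \/ c = CSurj -> forall j, exists i, f i = j) -> inC c f.
Proof. by case: c => /= Hi Hs; do ?split; [apply: Hi; left|apply: Hs; left|apply: Hi; right|apply: Hs; right]. Qed.

Lemma inC_inj c m n (f : 'I_m -> 'I_n) : c = CBij \/ c = CInj -> inC c f -> injective f.
Proof. by case=> ->; [case|]. Qed.

Lemma inC_surj c m n (f : 'I_m -> 'I_n) :
  c = CBij \/ c = CSurj -> inC c f -> forall j, exists i, f i = j.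
Proof. by case=> ->; [case|]. Qed.

Lemma ord0_absurd (i : 'I_0) : False. Proof. by case: i. Qed.

Fixpoint lnth {T} (l : seq T) : 'I_(size l) -> T :=
  match l return 'I_(size l) -> T with
  | [::] => fun i => False_rect T (ord0_absurd i)
  | x :: l' => fun i => match i with
                        | Ordinal 0 _ => x
                        | Ordinal k.+1 Hk => @lnth T l' (@Ordinal (size l') k Hk)
                        end
  end.
Arguments lnth {T} l i.

Lemma lnth_nth T (l : seq T) (i : 'I_(size l)) d : lnth l i = nth d l i.
Proof.
elim: l i => [|x l IH] [[|k] Hk] //=; exact: IH.
Qed.
Section D.
Context (A : category) (c : fclass).

Inductive dobj := Atom of Ob A | Arr of seq dobj & dobj.

Inductive dhom : dobj -> dobj -> Type :=
| HAtom (o o' : Ob A) of Hom o o' : dhom (Atom o) (Atom o')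
| HArr (l : seq dobj) (a : dobj) (l' : seq dobj) (a' : dobj)
    (al : 'I_(size l) -> 'I_(size l')) of inC c al
    & (forall i, dhom (lnth l' (al i)) (lnth l i)) & dhom a a'
    : dhom (Arr l a) (Arr l' a').

Fixpoint did (a : dobj) {struct a} : dhom a a :=
  match a with
  | Atom o => HAtom (idm o)
  | Arr l b => HArr (inC_id c (size l))
      ((fix ids (l : seq dobj) : forall i : 'I_(size l), dhom (lnth l i) (lnth l i) :=
          match l return forall i : 'I_(size l), dhom (lnth l i) (lnth l i) with
          | [::] => fun i => False_rect _ (ord0_absurd i)
          | x :: l' => fun i =>
              match i as i0 return dhom (lnth (x :: l') i0) (lnth (x :: l') i0) with
              | Ordinal 0 _ => did x
              | Ordinal k.+1 Hk => ids l' (@Ordinal (size l') k Hk)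
              end
          end) l)
      (did b)
  end.

Fixpoint dcompL (a b d : dobj) (f : dhom a b) {struct f} : dhom b d -> dhom a d :=
  match f in dhom a b return dhom b d -> dhom a d with
  | HAtom o o' f1 => fun g =>
      match g in dhom b0 d0 return
        (match b0 with Atom o1 => Hom o o1 -> dhom (Atom o) d0 | Arr _ _ => unit end) with
      | HAtom o1 o2 g1 => fun f1 => HAtom (hcomp f1 g1)
      | HArr _ _ _ _ _ _ _ _ => tt
      end f1
  | HArr l a0 l' a0' al Hal fs f0 => fun g =>
      let REC := fun d1 (g0 : dhom a0' d1) => dcompL f0 g0 in
      let FS := fun i (x0 : dobj) (y : dhom x0 (lnth l' (al i))) => dcompR y (fs i) in
      match g in dhom b0 d0 return
        (match b0 with
         | Atom _ => unit
         | Arr m b1 => forall (al' : 'I_(size l) -> 'I_(size m)), inC c al' ->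
              (forall i x0, dhom x0 (lnth m (al' i)) -> dhom x0 (lnth l i)) ->
              (forall d1, dhom b1 d1 -> dhom a0 d1) -> dhom (Arr l a0) d0
         end) with
      | HAtom _ _ _ => tt
      | HArr m b1 m' b1' be Hbe gs g0 => fun al' Hal' FS' REC' =>
          HArr (inC_comp Hbe Hal') (fun i => FS' i _ (gs (al' i))) (REC' _ g0)
      end al Hal FS REC
  end
with dcompR (a b d : dobj) (f : dhom a b) (g : dhom b d) {struct g} : dhom a d :=
  match g in dhom b d return dhom a b -> dhom a d with
  | HAtom o1 o2 g1 => fun f =>
      match f in dhom a0 b0 return
        (match b0 with Atom o => Hom o o2 -> dhom a0 (Atom o2) | Arr _ _ => unit end) with
      | HAtom o o' f1 => fun g1 => HAtom (hcomp f1 g1)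
      | HArr _ _ _ _ _ _ _ _ => tt
      end g1
  | HArr m b1 m' b1' be Hbe gs g0 => fun f =>
      let REC := fun a1 (f0 : dhom a1 b1) => dcompR f0 g0 in
      let GS := fun j (z : dobj) (y : dhom (lnth m j) z) => dcompL (gs j) y in
      match f in dhom a0 b0 return
        (match b0 with
         | Atom _ => unit
         | Arr l' a0' => forall (be' : 'I_(size l') -> 'I_(size m')), inC c be' ->
              (forall j z, dhom (lnth l' j) z -> dhom (lnth m' (be' j)) z) ->
              (forall a1, dhom a1 a0' -> dhom a1 b1') -> dhom a0 (Arr m' b1')
         end) with
      | HAtom _ _ _ => tt
      | HArr l x0 l' x0' al Hal fs f0 => fun be' Hbe' GS' REC' =>
          HArr (inC_comp Hbe' Hal) (fun i => GS' (al i) _ (fs i)) (REC' _ f0)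
      end be Hbe GS REC
  end f.

Definition dcomp (a b d : dobj) (f : dhom a b) (g : dhom b d) : dhom a d := dcompL f g.

End D.
Section S.
Context (A : category) (c : fclass).
Local Notation dobj := (dobj A).
Local Notation dhom := (@dhom A c).

Record shom (x y : seq dobj) := SHom {
  sfun : 'I_(size y) -> 'I_(size x);
  sinC : inC c sfun;
  scmp : forall i, dhom (lnth x (sfun i)) (lnth y i) }.

Definition sid (x : seq dobj) : shom x x :=
  @SHom x x (fun i => i) (inC_id c _) (fun i => @did A c (lnth x i)).

Definition scomp (x y z : seq dobj) (s : shom x y) (t : shom y z) : shom x z :=
  @SHom x z (fun i => sfun s (sfun t i)) (inC_comp (sinC s) (sinC t))
    (fun i => dcomp (scmp s (sfun t i)) (scmp t i)).

Definition tr (x x' y y' : dobj) (e1 : x = x') (e2 : y = y') (f : dhom x y) : dhom x' y' :=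
  match e2 in _ = z return dhom x' z with
  | erefl => match e1 in _ = w return dhom w y with erefl => f end
  end.

Section Block.
Context (I J : Type) (rX : seq I) (rY : seq J) (X : I -> seq dobj) (Y : J -> seq dobj)
  (be : 'I_(size rY) -> 'I_(size rX)) (Hbe : inC c be)
  (bs : forall i : 'I_(size rY), shom (X (lnth rX (be i))) (Y (lnth rY i))).

Let FX := flatten (map X rX).
Let FY := flatten (map Y rY).
Let shX := shape (map X rX).
Let shY := shape (map Y rY).

Lemma bh_r_lt (p : 'I_(size FY)) : reshape_index shY p < size rY.
Proof.
rewrite -(size_map Y) -(size_map size (map Y rY)); apply: reshape_indexP.
by rewrite -size_flatten.
Qed.
Definition bh_r (p : 'I_(size FY)) : 'I_(size rY) := Ordinal (bh_r_lt p).

Lemma bh_c_lt (p : 'I_(size FY)) : reshape_offset shY p < size (Y (lnth rY (bh_r p))).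
Proof.
rewrite (lnth_nth _ (lnth rY (bh_r p))) /=.
have := @reshape_offsetP shY p; rewrite -size_flatten => /(_ (ltn_ord p)).
rewrite /shY /shape (nth_map [::]) ?size_map ?(bh_r_lt p) //.
by rewrite (nth_map (lnth rY (bh_r p))) ?(bh_r_lt p).
Qed.
Definition bh_c (p : 'I_(size FY)) : 'I_(size (Y (lnth rY (bh_r p)))) := Ordinal (bh_c_lt p).

Lemma bh_rho_lt (p : 'I_(size FY)) :
  flatten_index shX (be (bh_r p)) (sfun (bs (bh_r p)) (bh_c p)) < size FX.
Proof.
rewrite /FX size_flatten; apply: flatten_indexP.
rewrite /shX /shape (nth_map [::]) ?size_map ?ltn_ord //.
by rewrite (nth_map (lnth rX (be (bh_r p)))) ?ltn_ord // -lnth_nth.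
Qed.
Definition bh_rho (p : 'I_(size FY)) : 'I_(size FX) := Ordinal (bh_rho_lt p).

Lemma bh_eqY (p : 'I_(size FY)) : lnth (Y (lnth rY (bh_r p))) (bh_c p) = lnth FY p.
Proof.
have [d _] : {d : dobj | True} by exists (lnth FY p).
rewrite !(lnth_nth _ d) /FY nth_flatten /=.
have [d' _] : {d' : J | True} by exists (lnth rY (bh_r p)).
by rewrite (nth_map d') ?(bh_r_lt p) // (lnth_nth _ d').
Qed.

Lemma bh_eqX (p : 'I_(size FY)) :
  lnth (X (lnth rX (be (bh_r p)))) (sfun (bs (bh_r p)) (bh_c p)) = lnth FX (bh_rho p).
Proof.
have [d _] : {d : dobj | True} by exists (lnth FY p).
rewrite !(lnth_nth _ d) /FX nth_flatten /=.
have Hc : sfun (bs (bh_r p)) (bh_c p) < nth 0 shX (be (bh_r p)).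
  rewrite /shX /shape (nth_map [::]) ?size_map ?ltn_ord //.
  by rewrite (nth_map (lnth rX (be (bh_r p)))) ?ltn_ord // -lnth_nth.
rewrite -/shX flatten_indexKl // flatten_indexKr //.
have [d' _] : {d' : I | True} by exists (lnth rX (be (bh_r p))).
set k := nat_of_ord (sfun _ _); clearbody k.
by rewrite (nth_map d') ?ltn_ord // (lnth_nth _ d').
Qed.


Lemma bh_shX_nth (r : 'I_(size rX)) : nth 0 shX r = size (X (lnth rX r)).
Proof.
rewrite /shX /shape (nth_map [::]) ?size_map ?ltn_ord //.
have [d' _] : {d' : I | True} by exists (lnth rX r).
by rewrite (nth_map d') ?ltn_ord // (lnth_nth _ d').
Qed.

Lemma bh_shY_nth (r : 'I_(size rY)) : nth 0 shY r = size (Y (lnth rY r)).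
Proof.
rewrite /shY /shape (nth_map [::]) ?size_map ?ltn_ord //.
have [d' _] : {d' : J | True} by exists (lnth rY r).
by rewrite (nth_map d') ?ltn_ord // (lnth_nth _ d').
Qed.

Lemma bh_pK (p : 'I_(size FY)) : flatten_index shY (bh_r p) (bh_c p) = p.
Proof. exact: reshape_indexK. Qed.

Lemma bh_rho_val (p : 'I_(size FY)) r (cc : 'I_(size (Y (lnth rY r)))) :
  bh_r p = r -> val (bh_c p) = val cc ->
  val (bh_rho p) = flatten_index shX (be r) (sfun (bs r) cc).
Proof.
move=> e ec.
have -> : val (bh_rho p) = flatten_index shX (be (bh_r p)) (sfun (bs (bh_r p)) (bh_c p)) by [].
move: (bh_c p) ec; rewrite e => c0 ec.
by have -> : c0 = cc by apply: val_inj.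
Qed.

Lemma bh_rho_inC : inC c bh_rho.
Proof.
have key : forall r1 r2 (c1 : 'I_(size (Y (lnth rY r1)))) (c2 : 'I_(size (Y (lnth rY r2)))),
      injective be -> (forall r, injective (sfun (bs r))) ->
      flatten_index shX (be r1) (sfun (bs r1) c1) = flatten_index shX (be r2) (sfun (bs r2) c2) ->
      r1 = r2 /\ val c1 = val c2.
  move=> r1 r2 c1 c2 ibe ibs e.
  have h1 : sfun (bs r1) c1 < nth 0 shX (be r1) by rewrite bh_shX_nth.
  have h2 : sfun (bs r2) c2 < nth 0 shX (be r2) by rewrite bh_shX_nth.
  have er : be r1 = be r2.
    by apply: ord_inj; rewrite -(flatten_indexKl h1) -(flatten_indexKl h2) e.
  have := ibe _ _ er => er'; subst r2; split => //.
  have ec : sfun (bs r1) c1 = sfun (bs r1) c2.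
    by apply: ord_inj; rewrite -(flatten_indexKr h1) -(flatten_indexKr h2) e.
  by rewrite (ibs _ _ _ ec).
have inj : injective be -> (forall r, injective (sfun (bs r))) -> injective bh_rho.
  move=> ibe ibs p1 p2 /(congr1 val) e.
  rewrite (bh_rho_val (erefl _) (erefl _)) (bh_rho_val (erefl _) (erefl _)) in e.
  have [er ec] := key _ _ _ _ ibe ibs e.
  apply: val_inj; rewrite /= -(bh_pK p1) -(bh_pK p2) ec er //.
have surj : (forall j, exists i, be i = j) -> (forall r j, exists i, sfun (bs r) i = j) ->
    forall q, exists p, bh_rho p = q.
  move=> sbe sbs q.
  have hr : reshape_index shX q < size rX.
    rewrite -(size_map X) -(size_map size (map X rX)); apply: reshape_indexP.
    by rewrite -size_flatten.
  pose r' : 'I_(size rX) := Ordinal hr.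
  have hc : reshape_offset shX q < size (X (lnth rX r')).
    rewrite -bh_shX_nth; apply: reshape_offsetP; by rewrite -size_flatten.
  have [ri eri] := sbe r'.
  have hc' : reshape_offset shX q < size (X (lnth rX (be ri))) by rewrite eri.
  have [ci eci] := sbs ri (Ordinal hc').
  have hp : flatten_index shY ri ci < size FY.
    by rewrite /FY size_flatten; apply: flatten_indexP; rewrite bh_shY_nth.
  exists (Ordinal hp); apply: ord_inj.
  have hci : ci < nth 0 shY ri by rewrite bh_shY_nth.
  rewrite (@bh_rho_val _ ri ci).
  - rewrite eci /= eri /=; exact: reshape_indexK.
  - by apply: ord_inj; rewrite /= flatten_indexKl.
  - by rewrite /= flatten_indexKr.
apply: inC_by => Hc.
- apply: inj; first exact: (inC_inj Hc Hbe).
  by move=> r; apply: (inC_inj Hc (sinC (bs r))).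
- apply: surj; first exact: (inC_surj Hc Hbe).
  by move=> r; apply: (inC_surj Hc (sinC (bs r))).
Qed.

Definition bhom : shom FX FY :=
  @SHom FX FY bh_rho bh_rho_inC
    (fun p => tr (bh_eqX p) (bh_eqY p) (scmp (bs (bh_r p)) (bh_c p))).

End Block.
End S.
Section Ctx.
Context (A : category) (c : fclass).
Local Notation dobj := (dobj A).
Local Notation dhom := (@dhom A c).
Local Notation shom := (@shom A c).
Local Notation sid := (@sid A c).

Definition ctx (n : nat) := 'I_n -> seq dobj.
Definition chom n (D G : ctx n) := forall i, shom (D i) (G i).
Definition cidc n (D : ctx n) : chom D D := fun i => sid (D i).
Definition ccompc n (D G H : ctx n) (f : chom D G) (g : chom G H) : chom D H :=
  fun i => scomp (f i) (g i).

Definition ext n (D : ctx n) (l : seq dobj) : ctx n.+1 :=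
  fun i => match unlift ord_max i with Some j => D j | None => l end.
Definition cext n (D D' : ctx n) (l l' : seq dobj) (d : chom D D') (s : shom l l') :
  chom (ext D l) (ext D' l') :=
  fun i => match unlift ord_max i as o return
             shom (match o with Some j => D j | None => l end)
                  (match o with Some j => D' j | None => l' end) with
           | Some j => d j
           | None => s
           end.

Definition single n (i : 'I_n) (a : dobj) : ctx n :=
  fun j => if j == i then [:: a] else [::].

Lemma ord1_absurd k : k.+1 < 1 -> False. Proof. by []. Qed.
Lemma inC_ord1 : inC c (fun _ : 'I_1 => (ord0 : 'I_1)).
Proof. by apply: inC_by => _ => [x y|j]; [rewrite !ord1|exists j; rewrite ord1]. Qed.

Definition sing_hom (a a' : dobj) (g : dhom a a') : shom [:: a] [:: a'] :=
  @SHom _ _ [:: a] [:: a'] (fun _ => ord0) inC_ord1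
    (fun i => match i as i0 return dhom a (lnth [:: a'] i0) with
              | Ordinal 0 _ => g
              | Ordinal k.+1 Hk => False_rect _ (ord1_absurd Hk)
              end).

Definition single_hom n (i : 'I_n) (a a' : dobj) (g : dhom a a') :
  chom (single i a) (single i a') :=
  fun j => match j == i as b return
             shom (if b then [:: a] else [::]) (if b then [:: a'] else [::]) with
           | true => sing_hom g
           | false => sid [::]
           end.

Definition labs k : seq (option 'I_k) := None :: map Some (enum 'I_k).
Definition fam n k (G0 : ctx n) (Gs : 'I_k -> ctx n) (o : option 'I_k) : ctx n :=
  match o with None => G0 | Some i => Gs i end.
Definition tens n k (G0 : ctx n) (Gs : 'I_k -> ctx n) : ctx n :=
  fun j => flatten (map (fun o => fam G0 Gs o j) (labs k)).

Definition tens_hom n k (G0 G0' : ctx n) (Gs Gs' : 'I_k -> ctx n)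
  (g0 : chom G0 G0') (gs : forall i, chom (Gs i) (Gs' i)) : chom (tens G0 Gs) (tens G0' Gs') :=
  fun j => @bhom A c _ _ (labs k) (labs k) (fun o => fam G0 Gs o j) (fun o => fam G0' Gs' o j)
     (fun p => p) (inC_id c _)
     (fun p => match lnth (labs k) p as o return
                 shom (fam G0 Gs o j) (fam G0' Gs' o j) with
               | None => g0 j
               | Some i => gs i j
               end).

Lemma lab_pos_lt k (i : 'I_k) : i.+1 < size (labs k).
Proof. by rewrite /= size_map size_enum_ord ltnS. Qed.
Definition lab_pos k (o : option 'I_k) : 'I_(size (labs k)) :=
  match o with None => ord0 | Some i => Ordinal (lab_pos_lt i) end.

Lemma lab_posK k (o : option 'I_k) : lnth (labs k) (lab_pos o) = o.
Proof.
rewrite (lnth_nth _ None); case: o => [i|] //=.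
by rewrite (nth_map i) ?size_enum_ord // nth_ord_enum.
Qed.

Lemma lnth_labsK k (p : 'I_(size (labs k))) : lab_pos (lnth (labs k) p) = p.
Proof.
apply: ord_inj; rewrite (lnth_nth _ None); case: p => [[|p] Hp] //=.
have Hp' : p < k by move: Hp; rewrite /= size_map size_enum_ord.
rewrite (nth_map (Ordinal Hp')) ?size_enum_ord //.
by have -> : nth (Ordinal Hp') (enum 'I_k) p = Ordinal Hp' by apply: ord_inj; rewrite nth_enum_ord.
Qed.

Definition omap_pos k m (al : 'I_m -> 'I_k) (p : 'I_(size (labs m))) : 'I_(size (labs k)) :=
  lab_pos (omap al (lnth (labs m) p)).

Lemma inC_omap_pos k m (al : 'I_m -> 'I_k) : inC c al -> inC c (omap_pos al).
Proof.
move=> H; apply: inC_by => Hc.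
- move=> p1 p2 /(congr1 (lnth (labs k))); rewrite !lab_posK => e.
  rewrite -(lnth_labsK p1) -(lnth_labsK p2); congr lab_pos.
  move: e; case: (lnth _ p1) => [i1|]; case: (lnth _ p2) => [i2|] //= [] e.
  by rewrite (inC_inj Hc H e).
- move=> q; case E: (lnth (labs k) q) => [i|].
  + have [j ej] := inC_surj Hc H i; exists (lab_pos (Some j)).
    by rewrite /omap_pos lab_posK [omap _ _]/= ej -E lnth_labsK.
  + exists (lab_pos None); by rewrite /omap_pos lab_posK [omap _ _]/= -E lnth_labsK.
Qed.

Definition shom_eq (x y : seq dobj) (e : x = y) : shom x y :=
  match e in _ = z return shom x z with erefl => sid x end.

Lemma sigma_eq n k m (G0 : ctx n) (Gs : 'I_k -> ctx n) (al : 'I_m -> 'I_k) j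
  (p : 'I_(size (labs m))) :
  fam G0 Gs (lnth (labs k) (omap_pos al p)) j = fam G0 (fun i => Gs (al i)) (lnth (labs m) p) j.
Proof. by rewrite /omap_pos lab_posK; case: (lnth _ p). Qed.

Definition sigma_hom n k m (G0 : ctx n) (Gs : 'I_k -> ctx n) (al : 'I_m -> 'I_k)
  (Hal : inC c al) : chom (tens G0 Gs) (tens G0 (fun i => Gs (al i))) :=
  fun j => @bhom A c _ _ (labs k) (labs m) (fun o => fam G0 Gs o j)
     (fun o => fam G0 (fun i => Gs (al i)) o j)
     (omap_pos al) (inC_omap_pos Hal) (fun p => shom_eq (sigma_eq G0 Gs al j p)).

End Ctx.
Inductive term := Var of nat | Lam of term | App of term & term.

Fixpoint tlift (d k : nat) (t : term) : term :=
  match t with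
  | Var m => if k <= m then Var (m + d) else Var m
  | Lam t1 => Lam (tlift d k.+1 t1)
  | App t1 t2 => App (tlift d k t1) (tlift d k t2)
  end.

Fixpoint tsubst (t : term) (k : nat) (u : term) : term :=
  match t with
  | Var m => if m < k then Var m else if m == k then tlift k 0 u else Var m.-1
  | Lam t1 => Lam (tsubst t1 k.+1 u)
  | App t1 t2 => App (tsubst t1 k u) (tsubst t2 k u)
  end.

Inductive beta : term -> term -> Prop :=
| beta_red t u : beta (App (Lam t) u) (tsubst t 0 u)
| beta_lam t t' : beta t t' -> beta (Lam t) (Lam t')
| beta_appl t t' u : beta t t' -> beta (App t u) (App t' u)
| beta_appr t u u' : beta u u' -> beta (App t u) (App t u').

Fixpoint fv (t : term) (k : nat) : bool :=
  match t with
  | Var m => m == k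
  | Lam t1 => fv t1 k.+1
  | App t1 t2 => fv t1 k || fv t2 k
  end.

Definition env_of (xs : seq nat) : nat -> option 'I_(size xs) := fun k => insub (index k xs).

Definition env_lam n (env : nat -> option 'I_n) : nat -> option 'I_n.+1 :=
  fun k => match k with
           | 0 => Some ord_max
           | k'.+1 => omap (widen_ord (leqnSn n)) (env k')
           end.

Definition quot (X : Type) (R : X -> X -> Prop) : Type :=
  {C : X -> Prop | exists x, C = clos_refl_sym_trans X R x}.
Definition qcls (X : Type) (R : X -> X -> Prop) (x : X) : quot R :=
  exist _ (clos_refl_sym_trans X R x) (ex_intro _ x erefl).
Definition qrep (X : Type) (R : X -> X -> Prop) (q : quot R) : X :=
  proj1_sig (constructive_indefinite_description _ (proj2_sig q)).
Definition qmap (X Y : Type) (R : X -> X -> Prop) (S : Y -> Y -> Prop) (f : X -> Y)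
  (q : quot R) : quot S := qcls S (f (qrep q)).

Section Den.
Context (A : category) (c : fclass).
Local Notation dobj := (dobj A).
Local Notation dhomc := (@dhom A c).
Local Notation shom := (@shom A c).
Local Notation ctx := (@ctx A).
Local Notation chom := (@chom A c).

(* a functor  ((SD)^n)^op x D --> Set  (object and arrow parts) *)
Record psh (n : nat) := Psh {
  F0 : ctx n -> dobj -> Type;
  F1 : forall (D D' : ctx n) (a a' : dobj), chom D' D -> dhomc a a' -> F0 D a -> F0 D' a' }.
Arguments F0 {n} p D a.
Arguments F1 {n} p {D D' a a'} _ _ _.

Definition den_var n (i : option 'I_n) : psh n :=
  @Psh n
    (fun D a => match i with Some i => chom D (single i a) | None => Empty_set end)
    (fun D D' a a' d g =>
       match i as o return
         (match o with Some i => chom D (single i a) | None => Empty_set end) ->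
         (match o with Some i => chom D' (single i a') | None => Empty_set end) with
       | Some i => fun h => ccompc d (ccompc h (single_hom i g))
       | None => fun e => e
       end).

Definition lam0 n (P : psh n.+1) (D : ctx n) (a : dobj) : Type :=
  match a with Arr l b => F0 P (ext D l) b | Atom _ => Empty_set end.

Definition den_lam n (P : psh n.+1) : psh n :=
  @Psh n (lam0 P)
    (fun D D' a a' d g =>
       match g in dhom _ a a' return lam0 P D a -> lam0 P D' a' with
       | HAtom _ _ _ => fun x => x
       | HArr l b l' b' al Hal fs f0 => fun x => F1 P (cext d (@SHom A c l' l al Hal fs)) f0 x
       end).

Section App.
Context (n : nat) (P Q : psh n).

(* elements of the integrand of the coend defining [[P Q]](D, a) *)
Record apre (D : ctx n) (a : dobj) := APre {
  ap_as : seq dobj;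
  ap_G0 : ctx n;
  ap_Gs : 'I_(size ap_as) -> ctx n;
  ap_p : F0 P ap_G0 (Arr ap_as a);
  ap_q : forall i, F0 Q (ap_Gs i) (lnth ap_as i);
  ap_h : chom D (tens ap_G0 ap_Gs) }.
Arguments ap_as {D a} _.
Arguments ap_G0 {D a} _.
Arguments ap_Gs {D a} _ _.
Arguments ap_p {D a} _.
Arguments ap_q {D a} _ _.
Arguments ap_h {D a} _ _.

(* generating relation of the coend: dinaturality in G0,...,Gk and in (a_1..a_k) *)
Inductive arel (D : ctx n) (a : dobj) : apre D a -> apre D a -> Prop :=
| arel_ctx (as_ : seq dobj) (G0 G0' : ctx n) (Gs Gs' : 'I_(size as_) -> ctx n)
    (g0 : chom G0' G0) (gs : forall i, chom (Gs' i) (Gs i))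
    (p : F0 P G0 (Arr as_ a)) (q : forall i, F0 Q (Gs i) (lnth as_ i))
    (h : chom D (tens G0' Gs')) :
    arel (@APre D a as_ G0' Gs' (F1 P g0 (did c (Arr as_ a)) p)
            (fun i => F1 Q (gs i) (did c (lnth as_ i)) (q i)) h)
         (@APre D a as_ G0 Gs p q (ccompc h (tens_hom g0 gs)))
| arel_seq (as_ bs : seq dobj) (s : shom as_ bs) (G0 : ctx n) (Gs : 'I_(size as_) -> ctx n)
    (p : F0 P G0 (Arr bs a)) (q : forall i, F0 Q (Gs i) (lnth as_ i))
    (h : chom D (tens G0 Gs)) :
    arel (@APre D a as_ G0 Gs (F1 P (cidc c G0) (HArr (sinC s) (scmp s) (did c a)) p) q h)
         (@APre D a bs G0 (fun j => Gs (sfun s j)) p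
            (fun j => F1 Q (cidc c (Gs (sfun s j))) (scmp s j) (q (sfun s j)))
            (ccompc h (sigma_hom G0 Gs (sinC s)))).

Definition app_map (D D' : ctx n) (a a' : dobj) (d : chom D' D) (g : dhomc a a')
  (x : apre D a) : apre D' a' :=
  @APre D' a' (ap_as x) (ap_G0 x) (ap_Gs x)
    (F1 P (cidc c (ap_G0 x)) (HArr (inC_id c _) (fun i => did c (lnth (ap_as x) i)) g) (ap_p x))
    (ap_q x) (ccompc d (ap_h x)).

Definition den_app : psh n :=
  @Psh n (fun D a => quot (@arel D a))
    (fun D D' a a' d g => qmap (@arel D' a') (app_map d g)).

End App.

Fixpoint den (t : term) (n : nat) (env : nat -> option 'I_n) {struct t} : psh n :=
  match t with
  | Var k => den_var (env k)
  | Lam t1 => den_lam (den t1 (env_lam env))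
  | App t1 t2 => den_app (den t1 env) (den t2 env)
  end.

Definition nat_iso n (F G : psh n) : Prop :=
  exists (phi : forall D a, F0 F D a -> F0 G D a) (psi : forall D a, F0 G D a -> F0 F D a),
    (forall D a x, psi D a (phi D a x) = x) /\
    (forall D a y, phi D a (psi D a y) = y) /\
    (forall D D' a a' (d : chom D' D) (g : dhomc a a') x,
        phi D' a' (F1 F d g x) = F1 G d g (phi D a x)).

End Den.

(* Main.v *)
(** Replace the lists of the construction SD by finite families, i.e. maps from a finite index
    type to objects; then tensors are dependent sums and all coherence is computation on indices.
    The denotations become generalised species, which compose by a coend: [Comp F Q] substitutes
    a family Q of species for the variables of F. This composition is associative, has the
    variables as units, and contains renaming. Application is composition of the uncurried
    function with the identity extended by the argument, so it commutes with substitution by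
    associativity, and abstraction does because uncurrying commutes with composition. Hence the
    substitution lemma, and beta is the fact that uncurrying cancels abstraction. Finally, the
    inclusion of lists into families is an equivalence carrying one denotation to the other. *)
Require Import Defs.
From mathcomp Require Import all_boot.
From Stdlib Require Import ClassicalEpsilon Relation_Operators.
From Stdlib Require Import FunctionalExtensionality PropExtensionality ProofIrrelevance.
Set Implicit Arguments. Unset Strict Implicit. Unset Printing Implicit Defensive.

(** * The category D *)

(** The four classes are handled uniformly: membership means injectivity if the class asks for it
    and surjectivity if the class asks for it. Surjectivity is the delicate half. It forces every
    index of a context to be used, so in those classes a component can be weakened away only if it
    is empty; this is why renaming carries a side condition.

    Two devices recur in the inverse laws. By the Yoneda lemma, an argument that is a variable may
    be replaced by the identity of its context, and the two sides of an equation are then joined by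
    steps through such a normalised family. And a map out of a composite whose arguments lie
    themselves in a composite must choose a representative for each argument. Independence of the
    choices rests on the finiteness of families, since the zigzags that join the representatives of
    different arguments have unrelated lengths. *)

Section ArrowCategory.
Context (A : category) (c : fclass).
Local Notation dobj := (dobj A).
Local Notation dhm := (@dhom A c).

(** Inversion for an arrow whose source is a constructor term. The return type of the match inspects
    the index, so no equality between dependent types arises. The next three lemmas do the same for
    the other shapes. *)
Lemma dhom_from_arr_ind (l : seq dobj) (a : dobj) (Pr : forall d, dhm (Arr l a) d -> Prop) :
  (forall l' a' al (Hal : inC c al) fs (f : dhm a a'), Pr _ (@HArr A c l a l' a' al Hal fs f)) ->
  forall d g, Pr d g.
Proof.
move=> H d g.
refine (match g as g0 in dhom _ x y return
          (match x as x0 return dhom c x0 y -> Prop with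
           | Arr l0 a0 => fun g1 => forall Pr0 : forall d, dhm (Arr l0 a0) d -> Prop,
               (forall l' a' al (Hal : inC c al) fs (f : dhm a0 a'),
                  Pr0 _ (@HArr A c l0 a0 l' a' al Hal fs f)) -> Pr0 y g1
           | Atom _ => fun _ => True end) g0 with
        | HAtom _ _ _ => I
        | HArr _ _ _ _ _ _ _ _ => fun Pr0 H0 => H0 _ _ _ _ _ _
        end Pr H).
Qed.

Lemma dhom_to_arr_ind (l : seq dobj) (a : dobj) (Pr : forall d, dhm d (Arr l a) -> Prop) :
  (forall l' a' al (Hal : inC c al) fs (f : dhm a' a), Pr _ (@HArr A c l' a' l a al Hal fs f)) ->
  forall d g, Pr d g.
Proof.
move=> H d g.
refine (match g as g0 in dhom _ y x return
          (match x as x0 return dhom c y x0 -> Prop with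
           | Arr l0 a0 => fun g1 => forall Pr0 : forall d, dhm d (Arr l0 a0) -> Prop,
               (forall l' a' al (Hal : inC c al) fs (f : dhm a' a0),
                  Pr0 _ (@HArr A c l' a' l0 a0 al Hal fs f)) -> Pr0 y g1
           | Atom _ => fun _ => True end) g0 with
        | HAtom _ _ _ => I
        | HArr _ _ _ _ _ _ _ _ => fun Pr0 H0 => H0 _ _ _ _ _ _
        end Pr H).
Qed.

Lemma dhom_from_atom_ind (o : Ob A) (Pr : forall d, dhm (Atom o) d -> Prop) :
  (forall o' (f : Hom o o'), Pr _ (HAtom c f)) -> forall d g, Pr d g.
Proof.
move=> H d g.
refine (match g as g0 in dhom _ x y return
          (match x as x0 return dhom c x0 y -> Prop with
           | Atom o0 => fun g1 => forall Pr0 : forall d, dhm (Atom o0) d -> Prop,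
               (forall o' (f : Hom o0 o'), Pr0 _ (HAtom c f)) -> Pr0 y g1
           | Arr _ _ => fun _ => True end) g0 with
        | HAtom _ _ _ => fun Pr0 H0 => H0 _ _
        | HArr _ _ _ _ _ _ _ _ => I
        end Pr H).
Qed.

Lemma dhom_to_atom_ind (o : Ob A) (Pr : forall d, dhm d (Atom o) -> Prop) :
  (forall o' (f : Hom o' o), Pr _ (HAtom c f)) -> forall d g, Pr d g.
Proof.
move=> H d g.
refine (match g as g0 in dhom _ y x return
          (match x as x0 return dhom c y x0 -> Prop with
           | Atom o0 => fun g1 => forall Pr0 : forall d, dhm d (Atom o0) -> Prop,
               (forall o' (f : Hom o' o0), Pr0 _ (HAtom c f)) -> Pr0 y g1
           | Arr _ _ => fun _ => True end) g0 with
        | HAtom _ _ _ => fun Pr0 H0 => H0 _ _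
        | HArr _ _ _ _ _ _ _ _ => I
        end Pr H).
Qed.

Lemma HArr_eq l a l' a' (al : 'I_(size l) -> 'I_(size l')) (H H' : inC c al)
    (fs fs' : forall i, dhm (lnth l' (al i)) (lnth l i)) (f f' : dhm a a') :
  (forall i, fs i = fs' i) -> f = f' -> HArr H fs f = HArr H' fs' f'.
Proof.
move=> e ->; have -> : fs = fs' by apply: functional_extensionality_dep.
by rewrite (proof_irrelevance _ H H').
Qed.

(** Composition is contravariant in the lists, so each of [dcompL] and [dcompR] calls the other on
    the components, with the factors exchanged. Hence the induction carries f on either side. *)
Lemma dcompLR a b (f : dhm a b) :
  (forall d (g : dhm b d), dcompL f g = dcompR f g) /\
  (forall d (g : dhm d a), dcompL g f = dcompR g f).
Proof.
elim: f => {a b} [o o' f|l a l' a' al Hal fs IHfs f [IH1 IH2]].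
  split; [apply: dhom_from_atom_ind|apply: dhom_to_atom_ind] => //.
split.
- apply: dhom_from_arr_ind => m b be Hbe gs g /=; apply: HArr_eq => [i|//].
  by rewrite (proj2 (IHfs i)).
- apply: dhom_to_arr_ind => m b be Hbe gs g /=; apply: HArr_eq => [i|//].
  by rewrite (proj1 (IHfs _)).
Qed.

Lemma dcomp_atom (o1 o2 o3 : Ob A) (f : Hom o1 o2) (g : Hom o2 o3) :
  dcomp (HAtom c f) (HAtom c g) = HAtom c (hcomp f g).
Proof. by []. Qed.

Lemma dcomp_arr l a l' a' m b al (Hal : inC c al) fs (f : dhm a a')
    be (Hbe : inC c be) gs (g : dhm a' b) :
  dcomp (@HArr A c l a l' a' al Hal fs f) (@HArr A c l' a' m b be Hbe gs g) =
  HArr (inC_comp Hbe Hal) (fun i => dcomp (gs (al i)) (fs i)) (dcomp f g).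
Proof. apply: HArr_eq => [i|//]; exact/esym/(proj1 (dcompLR _)). Qed.

(** Contravariance in the lists exchanges the cases where f is the first and the last factor, so the
    induction needs both. *)
Lemma dcompA x y (f : dhm x y) :
  (forall z w (g : dhm y z) (h : dhm z w), dcomp (dcomp f g) h = dcomp f (dcomp g h)) /\
  (forall z w (g : dhm z x) (h : dhm w z), dcomp (dcomp h g) f = dcomp h (dcomp g f)) /\
  (forall z w (g : dhm z x) (h : dhm y w), dcomp (dcomp g f) h = dcomp g (dcomp f h)).
Proof.
elim: f => {x y} [o o' f|l a l' a' al Hal fs IHfs f [IH1 [IH2 IH3]]].
  split; [|split].
  - move=> z w g; move: z g w; apply: dhom_from_atom_ind => o2 g w; move: w.
    apply: dhom_from_atom_ind => o3 h; by rewrite !dcomp_atom comp_assoc.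
  - move=> z w g; move: z g w; apply: dhom_to_atom_ind => o2 g w; move: w.
    apply: dhom_to_atom_ind => o3 h; by rewrite !dcomp_atom comp_assoc.
  - move=> z w g h; move: z g; apply: dhom_to_atom_ind => o2 g.
    move: w h; apply: dhom_from_atom_ind => o3 h; by rewrite !dcomp_atom comp_assoc.
split; [|split].
- move=> z w g; move: z g w; apply: dhom_from_arr_ind => m1 b1 be1 Hbe1 gs1 g1 w; move: w.
  apply: dhom_from_arr_ind => m2 b2 be2 Hbe2 gs2 g2; rewrite !dcomp_arr.
  by apply: HArr_eq => [i|//]; rewrite (proj1 (proj2 (IHfs i))).
- move=> z w g; move: z g w; apply: dhom_to_arr_ind => m1 b1 be1 Hbe1 gs1 g1 w; move: w.
  apply: dhom_to_arr_ind => m2 b2 be2 Hbe2 gs2 g2; rewrite !dcomp_arr.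
  by apply: HArr_eq => [i|//]; rewrite (proj1 (IHfs _)).
- move=> z w g h; move: z g; apply: dhom_to_arr_ind => m1 b1 be1 Hbe1 gs1 g1.
  move: w h; apply: dhom_from_arr_ind => m2 b2 be2 Hbe2 gs2 g2; rewrite !dcomp_arr.
  by apply: HArr_eq => [i|//]; rewrite (proj2 (proj2 (IHfs _))).
Qed.

Lemma dcomp_assoc x y z w (f : dhm x y) (g : dhm y z) (h : dhm z w) :
  dcomp (dcomp f g) h = dcomp f (dcomp g h).
Proof. exact: (proj1 (dcompA f)). Qed.

Lemma did_arr (l : seq dobj) a : did c (Arr l a) =
  HArr (inC_id c (size l)) (fun i => did c (lnth l i)) (did c a).
Proof.
rewrite /=; apply: HArr_eq => [i|//].
elim: l i => [|x l IH] [[|k] Hk] //=; exact: IH.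
Qed.

Lemma dcomp_id x y (f : dhm x y) : dcomp (did c x) f = f /\ dcomp f (did c y) = f.
Proof.
elim: f => {x y} [o o' f|l a l' a' al Hal fs IHfs f [IH1 IH2]].
  by rewrite !dcomp_atom comp_idl comp_idr.
rewrite !did_arr !dcomp_arr; split; apply: HArr_eq => // i.
- by case: (IHfs i).
- by case: (IHfs i).
Qed.

Lemma dcomp_idl x y (f : dhm x y) : dcomp (did c x) f = f.
Proof. by case: (dcomp_id f). Qed.
Lemma dcomp_idr x y (f : dhm x y) : dcomp f (did c y) = f.
Proof. by case: (dcomp_id f). Qed.
End ArrowCategory.

(** * Quotients, finite families and species *)

(** On ordinals this unfolds to the same match as [inC], so proofs of either serve for the other by
    conversion. *)
Definition in_class (c : fclass) (I J : Type) (al : J -> I) : Prop :=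
  match c with
  | CBij => injective al /\ (forall i, exists j, al j = i)
  | CInj => injective al
  | CSurj => forall i, exists j, al j = i
  | CAll => True
  end.

Section InClass.
Context (c : fclass).

Lemma in_class_by (I J : Type) (al : J -> I) :
  (c = CBij \/ c = CInj -> injective al) ->
  (c = CBij \/ c = CSurj -> forall i, exists j, al j = i) -> in_class c al.
Proof.
by case: c => /= Hi Hs; do ?split;
  [apply: Hi; left|apply: Hs; left|apply: Hi; right|apply: Hs; right].
Qed.

Lemma in_class_inj (I J : Type) (al : J -> I) :
  c = CBij \/ c = CInj -> in_class c al -> injective al.
Proof. by case=> ->; [case|]. Qed.

Lemma in_class_surj (I J : Type) (al : J -> I) :
  c = CBij \/ c = CSurj -> in_class c al -> forall i, exists j, al j = i.
Proof. by case=> ->; [case|]. Qed.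

Lemma in_class_can (I J : Type) (al : J -> I) (be : I -> J) :
  cancel al be -> cancel be al -> in_class c al.
Proof.
move=> K K'; apply: in_class_by => _; first exact: can_inj K.
by move=> i; exists (be i).
Qed.

Lemma in_class_id (I : Type) : in_class c (fun i : I => i).
Proof. exact: (@in_class_can _ _ id id). Qed.

Lemma in_class_comp (I J K : Type) (al : J -> I) (be : K -> J) :
  in_class c al -> in_class c be -> in_class c (fun k => al (be k)).
Proof.
move=> Ha Hb; apply: in_class_by => Hc.
- by move=> x y e; apply: (in_class_inj Hc Hb); apply: (in_class_inj Hc Ha).
- move=> i; have [j <-] := in_class_surj Hc Ha i.
  by have [k <-] := in_class_surj Hc Hb j; exists k.
Qed.

(** Closure under dependent sums is what puts the tensor of morphisms of the class back into the
    class. *)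
Lemma in_class_sigma (I J : Type) (B : I -> Type) (B' : J -> Type) (al : J -> I)
    (be : forall j, B' j -> B (al j)) :
  in_class c al -> (forall j, in_class c (be j)) ->
  in_class c (fun p : {j : J & B' j} =>
    existT B (al (projT1 p)) (be (projT1 p) (projT2 p))).
Proof.
move=> Ha Hb; apply: in_class_by => Hc.
- move=> [j b] [j' b'] /= e.
  have ej : j = j'.
    by apply: (in_class_inj Hc Ha); apply: (f_equal (@projT1 _ _) e).
  subst j'; congr existT; apply: (in_class_inj Hc (Hb j)).
  exact: inj_pair2 e.
- move=> [i b]; have [j ej] := in_class_surj Hc Ha i; subst i.
  by have [b' eb'] := in_class_surj Hc (Hb j) b; subst b; exists (existT _ j b').
Qed.
End InClass.

Section Quotient.
Context (X : Type) (R : X -> X -> Prop).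

Lemma qcls_eq x y : clos_refl_sym_trans X R x y -> qcls R x = qcls R y.
Proof.
move=> Hxy; rewrite /qcls.
have e : clos_refl_sym_trans X R x = clos_refl_sym_trans X R y.
  apply: functional_extensionality => z; apply: propositional_extensionality.
  by split=> H; [apply: rst_trans H; apply: rst_sym|apply: rst_trans H].
move: (ex_intro _ x _) (ex_intro _ y _); rewrite e => p q.
by rewrite (proof_irrelevance _ p q).
Qed.

Lemma qcls_inv x y : qcls R x = qcls R y -> clos_refl_sym_trans X R x y.
Proof. by move=> /(congr1 (@proj1_sig _ _)) /= ->; apply: rst_refl. Qed.

Lemma qrepK (q : quot R) : qcls R (qrep q) = q.
Proof.
case: q => C HC; rewrite /qrep /=.
case: (constructive_indefinite_description _ _) => x /= e; subst C.
by rewrite /qcls; congr exist; apply: proof_irrelevance.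
Qed.

Lemma clos_inv (T : Type) (f : X -> T) :
  (forall x y, R x y -> f x = f y) ->
  forall x y, clos_refl_sym_trans X R x y -> f x = f y.
Proof. by move=> H x y; elim=> {x y} [x y /H|x|x y _ ->|x y z _ -> _ ->]. Qed.
End Quotient.

(** A surjection from a finite type suffices. Such types include the propositions and are closed
    under dependent sums, and no decidable equality is required of them. *)
Definition finite_type (I : Type) : Prop :=
  exists (T : finType) (e : T -> I), forall i, exists t, e t = i.

Lemma finite_finType (T : finType) : finite_type T.
Proof. by exists T, id => t; exists t. Qed.

Lemma finite_sigma (I : Type) (B : I -> Type) :
  finite_type I -> (forall i, finite_type (B i)) -> finite_type {i : I & B i}.
Proof.
move=> [T [e He]] HB.
pose S i := proj1_sig (constructive_indefinite_description _ (HB i)).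
have HS i : exists f : S i -> B i, forall b, exists s, f s = b.
  exact: proj2_sig (constructive_indefinite_description _ (HB i)).
pose f i := proj1_sig (constructive_indefinite_description _ (HS i)).
have Hf i : forall b, exists s, f i s = b.
  exact: proj2_sig (constructive_indefinite_description _ (HS i)).
exists {t : T & S (e t)}, (fun p => existT B (e (projT1 p)) (f _ (projT2 p))).
move=> [i b]; have [t et] := He i; subst i.
by have [s es] := Hf _ b; subst b; exists (existT _ t s).
Qed.

(** Eta for these records holds by conversion: a family rebuilt from its projections is that family.
    Base contexts built componentwise are therefore convertible to the contexts they come from. *)
Set Primitive Projections.
Record dfam (A : category) := Family {
  fidx : Type; ffin : finite_type fidx; fob : fidx -> dobj A }.
Unset Primitive Projections.
Arguments Family {A fidx} ffin fob.

Section Families.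
Context (A : category) (c : fclass).
Local Notation dobj := (dobj A).
Local Notation dhm := (@dhom A c).
Local Notation dfam := (dfam A).
Local Notation did := (@did A c).

(** The index and the arrow over it form one dependent pair, so morphisms are compared by equality
    of pairs, with no transport along an equality of indices. *)
Record famhom (X Y : dfam) := FamHom {
  fh :> forall j : fidx Y, {i : fidx X & dhm (fob i) (fob j)};
  fh_in : in_class c (fun j => projT1 (fh j)) }.

Lemma famhom_eq X Y (s t : famhom X Y) : (forall j, s j = t j) -> s = t.
Proof.
case: s t => [s Hs] [t Ht] /= e.
have est : s = t by apply: functional_extensionality_dep.
by subst t; rewrite (proof_irrelevance _ Hs Ht).
Qed.

Definition fid (X : dfam) : famhom X X :=
  @FamHom X X (fun i => existT _ i (did (fob i))) (in_class_id c _).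

Definition fcomp X Y Z (s : famhom X Y) (t : famhom Y Z) : famhom X Z :=
  @FamHom X Z (fun k => let j := projT1 (t k) in
      existT _ (projT1 (s j)) (dcomp (projT2 (s j)) (projT2 (t k))))
    (in_class_comp (fh_in s) (fh_in t)).

Lemma fcomp_idl X Y (s : famhom X Y) : fcomp (fid X) s = s.
Proof. by apply: famhom_eq => j /=; rewrite dcomp_idl; case: (s j). Qed.
Lemma fcomp_idr X Y (s : famhom X Y) : fcomp s (fid Y) = s.
Proof. by apply: famhom_eq => j /=; rewrite dcomp_idr; case: (s j). Qed.
Lemma fcompA X Y Z T (s : famhom X Y) (t : famhom Y Z) (u : famhom Z T) :
  fcomp (fcomp s t) u = fcomp s (fcomp t u).
Proof. by apply: famhom_eq => j /=; rewrite dcomp_assoc. Qed.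

Definition fctx (V : Type) := V -> dfam.
Definition fchom V (D G : fctx V) := forall v, famhom (D v) (G v).
Definition fcid V (D : fctx V) : fchom D D := fun v => fid (D v).
Definition fccomp V (D G H : fctx V) (s : fchom D G) (t : fchom G H) : fchom D H :=
  fun v => fcomp (s v) (t v).

Lemma fchom_eq V (D G : fctx V) (s t : fchom D G) :
  (forall v j, s v j = t v j) -> s = t.
Proof. by move=> e; apply: functional_extensionality_dep => v; apply: famhom_eq. Qed.

Lemma fccomp_idl V (D G : fctx V) (s : fchom D G) : fccomp (fcid D) s = s.
Proof. by apply: functional_extensionality_dep => v; apply: fcomp_idl. Qed.
Lemma fccomp_idr V (D G : fctx V) (s : fchom D G) : fccomp s (fcid G) = s.
Proof. by apply: functional_extensionality_dep => v; apply: fcomp_idr. Qed.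
Lemma fccompA V (D G H K : fctx V) (s : fchom D G) (t : fchom G H) (u : fchom H K) :
  fccomp (fccomp s t) u = fccomp s (fccomp t u).
Proof. by apply: functional_extensionality_dep => v; apply: fcompA. Qed.

Lemma fccomp_cut V (D G H K : fctx V) (h : fchom D G) (s : fchom G H) (t : fchom H K) u :
  fccomp s t = u -> fccomp (fccomp h s) t = fccomp h u.
Proof. by move=> <-; apply: fccompA. Qed.

Lemma fccomp_sq V (D G G' H K : fctx V) (h : fchom D G) (s : fchom G H) (t : fchom H K)
    (s' : fchom G G') (t' : fchom G' K) :
  fccomp s t = fccomp s' t' -> fccomp (fccomp h s) t = fccomp (fccomp h s') t'.
Proof. by move=> e; rewrite !fccompA e. Qed.

(** The functor laws, which [psh] leaves out, are fields here: every computation inside a coend uses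
    them. *)
Record species (V : Type) := Species {
  sp0 : fctx V -> dobj -> Type;
  sp1 : forall (D D' : fctx V) a a', fchom D' D -> dhm a a' -> sp0 D a -> sp0 D' a';
  sp1_id : forall D a (x : sp0 D a), sp1 (fcid D) (did a) x = x;
  sp1_comp : forall D D' D'' a a' a'' (d : fchom D' D) (d' : fchom D'' D')
     (g : dhm a a') (g' : dhm a' a'') (x : sp0 D a),
     sp1 d' g' (sp1 d g x) = sp1 (fccomp d' d) (dcomp g g') x }.

Definition sp_iso V (F G : species V) : Prop :=
  exists (phi : forall D a, sp0 F D a -> sp0 G D a) (psi : forall D a, sp0 G D a -> sp0 F D a),
    [/\ forall D a x, psi D a (phi D a x) = x,
        forall D a y, phi D a (psi D a y) = y &
        forall D D' a a' (d : fchom D' D) (g : dhm a a') x,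
          phi D' a' (sp1 d g x) = sp1 d g (phi D a x)].

Lemma sp_iso_refl V (F : species V) : sp_iso F F.
Proof. by exists (fun _ _ x => x), (fun _ _ x => x). Qed.

Lemma sp_iso_sym V (F G : species V) : sp_iso F G -> sp_iso G F.
Proof.
move=> [phi [psi [K K' N]]]; exists psi, phi; split=> // D D' a a' d g x.
by rewrite -{1}(K' _ _ x) -N K.
Qed.

Lemma sp_iso_trans V (F G H : species V) : sp_iso F G -> sp_iso G H -> sp_iso F H.
Proof.
move=> [p [q [K K' N]]] [p' [q' [L L' M]]].
exists (fun D a x => p' D a (p D a x)), (fun D a x => q D a (q' D a x)).
by split=> [D a x|D a x|D D' a a' d g x]; rewrite ?L ?K ?K' ?L' ?N ?M.
Qed.

Lemma sp1_ctx V (F : species V) D D' a a' (d : fchom D' D) (g : dhm a a') x :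
  sp1 (s := F) d g x = sp1 d (did a') (sp1 (fcid D) g x).
Proof. by rewrite sp1_comp fccomp_idr dcomp_idr. Qed.
End Families.

Arguments fcid {A c V D}.

(** * Composition of species *)

Section Substitution.
Context (A : category) (c : fclass).
Local Notation dobj := (dobj A).
Local Notation dhm := (@dhom A c).

Local Notation did := (@did A c).
Local Notation fctx := (@fctx A).
Local Notation fchom := (@fchom A c).
Local Notation fcid := (@fcid A c _ _).
Local Notation species := (@species A c).

Definition osum W (I : Type) (HI : finite_type I) (H : I -> fctx W) : fctx W := fun w =>
  Family (finite_sigma HI (fun i => ffin (H i w)))
    (fun p : {i : I & fidx (H i w)} => fob (d := H (projT1 p) w) (projT2 p)).

Definition osum_hom W (I J : Type) HI HJ (H : I -> fctx W) (H' : J -> fctx W) (al : J -> I)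
  (Hal : in_class c al) (k : forall j, fchom (H (al j)) (H' j)) :
  fchom (osum HI H) (osum HJ H') :=
  fun w => @FamHom A c (osum HI H w) (osum HJ H' w)
    (fun p => let r := k (projT1 p) w (projT2 p) in
       existT (fun q : fidx (osum HI H w) => dhm (fob q) (fob (d := osum HJ H' w) p))
         (existT (fun i => fidx (H i w)) (al (projT1 p)) (projT1 r)) (projT2 r))
    (@in_class_sigma c _ _ (fun i => fidx (H i w)) (fun j => fidx (H' j w)) al
       (fun j x => projT1 (k j w x)) Hal (fun j => fh_in (k j w))).

(* The coend defining a composite F o Q is taken over finite families of elements of Q, so that
   the list of bases and the contexts of the arguments vary together along [estep]. *)
Set Primitive Projections.
Record efam W (Q : species W) := EFam {
  ei : Type;
  ei_fin : finite_type ei;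
  eb : ei -> dobj;
  eH : ei -> fctx W;
  ew : forall i, sp0 Q (eH i) (eb i) }.
Unset Primitive Projections.

Section Composition.
Context (V W : finType) (F : species V) (Q : V -> species W).

Definition effam := forall v, efam (Q v).

Definition base_ctx (X : effam) : fctx V := fun v => Family (ei_fin (X v)) (@eb _ _ (X v)).
Definition tot_ctx (X : effam) : fctx W :=
  osum (finite_sigma (finite_finType V) (fun v => ei_fin (X v))) 
    (fun p : {v : V & ei (X v)} => @eH _ _ (X (projT1 p)) (projT2 p)).

(** [st_E] says that the element of X pushed along the base arrow is the element of Y pulled back
    along the context arrow. With [st_k] the identity this is dinaturality in the bases, with [st_m]
    the identity dinaturality in the contexts. *)
Record estep (X Y : effam) := EStep {
  st_al : forall v, ei (Y v) -> ei (X v);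
  st_in : forall v, in_class c (@st_al v);
  st_m : forall v j, dhm (@eb _ _ (X v) (st_al j)) (@eb _ _ (Y v) j);
  st_k : forall v j, fchom (@eH _ _ (X v) (st_al j)) (@eH _ _ (Y v) j);
  st_E : forall v j, sp1 fcid (st_m j) (ew (st_al j)) = sp1 (@st_k v j) (did _) (ew j) }.

Lemma st_E_comp X Y (st : estep X Y) v j a (n : dhm (@eb _ _ (Y v) j) a) :
  sp1 fcid (dcomp (st_m st j) n) (ew (st_al st j)) = sp1 (st_k st j) n (ew j).
Proof.
by rewrite -{1}(fccomp_idl fcid) -sp1_comp st_E sp1_comp fccomp_idl dcomp_idl.
Qed.

Definition step_base X Y (st : estep X Y) : fchom (base_ctx X) (base_ctx Y) := fun v =>
  @FamHom A c (base_ctx X v) (base_ctx Y v)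
    (fun j => existT (fun i : fidx (base_ctx X v) => dhm (fob i) (fob (d := base_ctx Y v) j))
                (st_al st j) (st_m st j)) (st_in st v).

Definition step_total X Y (st : estep X Y) : fchom (tot_ctx X) (tot_ctx Y) :=
  osum_hom (al := fun p : {v : V & ei (Y v)} =>
                    existT (fun v => ei (X v)) (projT1 p) (st_al st (projT2 p)))
    _ _ (in_class_sigma (in_class_id c V) (st_in st)) (fun p => st_k st (projT2 p)).

Record subpre (D : fctx W) (a : dobj) := SubPre {
  sX : effam;
  sf : sp0 F (base_ctx sX) a;
  sh : fchom D (tot_ctx sX) }.

Definition sstep D a (x y : subpre D a) : Prop :=
  exists st : estep (sX x) (sX y),
    sf x = sp1 (step_base st) (did a) (sf y) /\ sh y = fccomp (sh x) (step_total st).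

Definition gen D a X (f : sp0 F (base_ctx X) a) (h : fchom D (tot_ctx X)) : quot (@sstep D a) :=
  qcls _ (SubPre f h).

Lemma gen_step D a X Y (st : estep X Y) f f' (h : fchom D (tot_ctx X)) h' :
  f' = sp1 (step_base st) (did a) f -> h' = fccomp h (step_total st) ->
  gen f' h = gen f h'.
Proof. by move=> -> ->; apply: qcls_eq; apply: rst_step; exists st. Qed.

Lemma gen_ind D a (Pr : quot (@sstep D a) -> Prop) :
  (forall X f h, Pr (@gen D a X f h)) -> forall q, Pr q.
Proof. by move=> H q; rewrite -(qrepK q); case: (qrep q). Qed.

(** Evaluation at the chosen representative, so that maps out of the coend are defined without a
    proof of invariance; that proof is asked for in [sub_liftE]. *)
Definition sub_lift D a T (phi : forall X, sp0 F (base_ctx X) a -> fchom D (tot_ctx X) -> T)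
  (q : quot (@sstep D a)) : T := let r := qrep q in phi (sX r) (sf r) (sh r).

Lemma sub_liftE D a T (phi : forall X, sp0 F (base_ctx X) a -> fchom D (tot_ctx X) -> T) :
  (forall X Y (st : estep X Y) f h,
     phi X (sp1 (step_base st) (did a) f) h = phi Y f (fccomp h (step_total st))) ->
  forall X f h, sub_lift phi (@gen D a X f h) = phi X f h.
Proof.
move=> H X f h; rewrite /sub_lift.
have := qcls_inv (qrepK (gen f h)).
move=> /(@clos_inv _ _ _ (fun r : subpre D a => phi (sX r) (sf r) (sh r))) -> //.
by move=> [X1 f1 h1] [X2 f2 h2] [st] /= [-> ->].
Qed.

Definition sub1 D D' a a' (d : fchom D' D) (g : dhm a a') : quot (@sstep D a) -> quot (@sstep D' a') :=
  sub_lift (fun X f h => gen (sp1 fcid g f) (fccomp d h)).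

Lemma sub1_gen D D' a a' (d : fchom D' D) (g : dhm a a') X (f : sp0 F (base_ctx X) a) h :
  sub1 d g (gen f h) = gen (sp1 fcid g f) (fccomp d h).
Proof.
rewrite /sub1 sub_liftE // => X' Y st f' h'; apply: (gen_step (st := st)).
  by rewrite !sp1_comp fccomp_idl fccomp_idr dcomp_idl dcomp_idr.
by rewrite fccompA.
Qed.

Lemma sub1_id D a (x : quot (@sstep D a)) : sub1 fcid (did a) x = x.
Proof. by elim/gen_ind: x => X f h; rewrite sub1_gen sp1_id fccomp_idl. Qed.

Lemma sub1_comp D D' D'' a a' a'' (d : fchom D' D) (d' : fchom D'' D')
     (g : dhm a a') (g' : dhm a' a'') (x : quot (@sstep D a)) :
  sub1 d' g' (sub1 d g x) = sub1 (fccomp d' d) (dcomp g g') x.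
Proof.
by elim/gen_ind: x => X f h; rewrite !sub1_gen sp1_comp fccomp_idl fccompA.
Qed.

Definition Comp : species W := Species sub1_id sub1_comp.

Lemma CompE D D' a a' (d : fchom D' D) (g : dhm a a') X (f : sp0 F (base_ctx X) a) h :
  sp1 (s := Comp) d g (gen f h) = gen (sp1 fcid g f) (fccomp d h).
Proof. exact: sub1_gen. Qed.

Definition estep_id (X : effam) : estep X X :=
  @EStep X X (fun _ j => j) (fun v => in_class_id c _) (fun v j => did _)
    (fun v j => fcid) (fun v j => erefl).

Lemma step_base_id X : step_base (estep_id X) = fcid.
Proof. exact: fchom_eq. Qed.

Lemma step_total_id X : step_total (estep_id X) = fcid.
Proof. by apply: fchom_eq => w [[v j] x]. Qed.

Lemma sstep_refl D a (x : subpre D a) : sstep x x.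
Proof.
by exists (estep_id _); rewrite step_base_id step_total_id sp1_id fccomp_idr.
Qed.

(** The elements of X moved along k by the action of Q, with their contexts kept. By eta the base
    context is G, so k can be absorbed into the arguments. *)
Definition push (X : effam) (G : fctx V) (k : fchom (base_ctx X) G) : effam := fun v =>
  @EFam W (Q v) (fidx (G v)) (ffin (G v)) (@fob _ (G v)) (fun j => @eH _ _ (X v) (projT1 (k v j)))
    (fun j => sp1 fcid (projT2 (k v j)) (ew (projT1 (k v j)))).

Definition push_step X G (k : fchom (base_ctx X) G) : estep X (push k) :=
  @EStep X (push k) (fun v j => projT1 (k v j)) (fun v => fh_in (k v))
    (fun v j => projT2 (k v j)) (fun v j => fcid) (fun v j => esym (sp1_id _)).

Definition push_total X G (k : fchom (base_ctx X) G) : fchom (tot_ctx X) (tot_ctx (push k)) :=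
  step_total (push_step k).

Lemma push_base X G (k : fchom (base_ctx X) G) : step_base (push_step k) = k.
Proof. by apply: fchom_eq => v j /=; case: (k v j). Qed.

Lemma gen_push D a X G (k : fchom (base_ctx X) G) (f : sp0 F G a) (h : fchom D (tot_ctx X)) :
  gen (sp1 k (did a) f) h = gen (X := push k) f (fccomp h (push_total k)).
Proof. by apply: (gen_step (st := push_step k)); rewrite ?push_base. Qed.
End Composition.

Section ReflStep.
Context (V W : finType) (Q : V -> species W) (X : effam Q)
  (q' : forall v i, sp0 (Q v) (@eH _ _ (X v) i) (@eb _ _ (X v) i)).

(** Elements that are equal but not convertible are exchanged by a step made of identities. This
    spares a rewrite of the family inside the types of the head and of the context map. *)
Definition relab : effam Q := fun v => EFam (ei_fin (X v)) (@q' v).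

Definition refl_step (e : forall v i, q' i = @ew _ _ (X v) i) : estep relab X :=
  @EStep V W Q relab X (fun _ j => j) (fun v => in_class_id c _) (fun v j => did _)
    (fun v j => fcid) (fun v j => congr1 _ (e v j)).

Lemma refl_base e : step_base (refl_step e) = fcid.
Proof. exact: fchom_eq. Qed.

Lemma refl_total e : step_total (refl_step e) = fcid.
Proof. by apply: fchom_eq => w [[v j] x]. Qed.

Lemma gen_relab (F : species V) D a (f : sp0 F (base_ctx X) a) (h : fchom D (tot_ctx X)) :
  (forall v i, q' i = @ew _ _ (X v) i) ->
  gen (X := relab) f h = gen (X := X) f h.
Proof.
move=> e; apply: (gen_step (st := refl_step e)).
  by rewrite refl_base sp1_id.
by rewrite refl_total fccomp_idr.
Qed.
End ReflStep.

Lemma choice_iso (V : Type) W (Q Q' : V -> species W) : (forall v, sp_iso (Q v) (Q' v)) ->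
  exists (phi : forall v D a, sp0 (Q v) D a -> sp0 (Q' v) D a)
         (psi : forall v D a, sp0 (Q' v) D a -> sp0 (Q v) D a),
    [/\ forall v D a x, psi v D a (phi v D a x) = x,
        forall v D a y, phi v D a (psi v D a y) = y &
        forall v D D' a a' (d : fchom D' D) (g : dhm a a') x,
          phi v D' a' (sp1 d g x) = sp1 d g (phi v D a x)].
Proof.
move=> H.
pose p v := constructive_indefinite_description _ (H v).
pose q v := constructive_indefinite_description _ (proj2_sig (p v)).
exists (fun v => proj1_sig (p v)), (fun v => proj1_sig (q v)).
by split=> v; case: (proj2_sig (q v)).
Qed.

(** * Invariance of composition under isomorphism *)

Section SubFunctor.
Context (V W : finType).

Definition map_efam W0 (Q Q' : species W0) (t : forall D a, sp0 Q D a -> sp0 Q' D a)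
  (X : efam Q) : efam Q' := EFam (ei_fin X) (fun i => t _ _ (@ew _ _ X i)).

Definition map_step (Q Q' : V -> species W) (t : forall v D a, sp0 (Q v) D a -> sp0 (Q' v) D a)
  (N : forall v D D' a a' (d : fchom D' D) (g : dhm a a') x,
          t v D' a' (sp1 d g x) = sp1 d g (t v D a x)) (X Y : effam Q) (st : estep X Y) :
  estep (fun v => map_efam (t v) (X v)) (fun v => map_efam (t v) (Y v)).
Proof.
refine (@EStep V W Q' (fun v => map_efam (t v) (X v)) (fun v => map_efam (t v) (Y v))
  (st_al st) (st_in st) (st_m st) (st_k st) _).
by move=> v j /=; rewrite -!N st_E.
Defined.

Lemma Comp_iso (F F' : species V) (Q Q' : V -> species W) :
  sp_iso F F' -> (forall v, sp_iso (Q v) (Q' v)) -> sp_iso (Comp F Q) (Comp F' Q').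
Proof.
move=> [p [q [K K' N]]] /choice_iso [p' [q' [L L' N']]].
have M D D' a a' (d : fchom D' D) (g : dhm a a') x : q _ _ (sp1 d g x) = sp1 d g (q _ _ x).
  by rewrite -{1}(K' _ _ x) -N K.
have M' v D D' a a' (d : fchom D' D) (g : dhm a a') x :
    q' v _ _ (sp1 d g x) = sp1 d g (q' v _ _ x).
  by rewrite -{1}(L' _ _ _ x) -N' L.
pose phi D a := sub_lift (fun X f h => @gen V W F' Q' D a
  (fun v => map_efam (p' v) (X v)) (p _ _ f) h).
pose psi D a := sub_lift (fun X f h => @gen V W F Q D a
  (fun v => map_efam (q' v) (X v)) (q _ _ f) h).
have phiE D a X f h : phi D a (gen f h) =
    gen (X := fun v => map_efam (p' v) (X v)) (p _ _ f) h.
  rewrite /phi sub_liftE // => {}X Y st {}f {}h.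
  by apply: (gen_step (st := map_step N' st)); rewrite ?N.
have psiE D a X f h : psi D a (gen f h) =
    gen (X := fun v => map_efam (q' v) (X v)) (q _ _ f) h.
  rewrite /psi sub_liftE // => {}X Y st {}f {}h.
  by apply: (gen_step (st := map_step M' st)); rewrite ?M.
exists phi, psi; split=> [D a x|D a x|D D' a a' d g x]; elim/gen_ind: x => X f h.
- by rewrite phiE psiE K; apply: gen_relab => v i /=; rewrite L.
- by rewrite psiE phiE K'; apply: gen_relab => v i /=; rewrite L'.
- by rewrite CompE !phiE CompE N.
Qed.
End SubFunctor.
End Substitution.

(** * Associativity *)

Section PointwiseClosure.
Context (K : Type) (X : K -> Type) (R : forall p, X p -> X p -> Prop).
Context (finK : finite_type K) (Rrefl : forall p x, @R p x x).

Definition upd (z : forall p, X p) (a : K) (b : X a) (p : K) : X p :=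
  match excluded_middle_informative (p = a) with
  | left e => eq_rect_r X b e
  | right _ => z p
  end.

Lemma upd_same z a b : upd z b a = b :> X a.
Proof.
rewrite /upd; case: excluded_middle_informative => // e.
by rewrite (proof_irrelevance _ e erefl).
Qed.

Lemma upd_other z a (b : X a) p : p <> a -> upd z b p = z p.
Proof. by rewrite /upd; case: excluded_middle_informative. Qed.

(* By reflexivity one component can move while the others stay put, so finitely many zigzags
   can be run one after the other. *)
Lemma pointwise_clos_inv (T : Type) (f : (forall p, X p) -> T) :
  (forall x y, (forall p, R (x p) (y p)) -> f x = f y) ->
  forall x y, (forall p, clos_refl_sym_trans _ (@R p) (x p) (y p)) -> f x = f y.
Proof.
move=> Hf x y Hxy.
have step z a b : clos_refl_sym_trans _ (@R a) (z a) b -> f z = f (upd z b).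
  move=> Hab.
  have e0 : upd z (z a) = z.
    apply: functional_extensionality_dep => p.
    by case: (excluded_middle_informative (p = a)) => [->|];
      [rewrite upd_same|move=> /upd_other ->].
  rewrite -{1}e0; apply: (clos_inv (f := fun b => f (upd z b)) _ Hab) => b1 b2 Hb.
  apply: Hf => p; case: (excluded_middle_informative (p = a)) => [->|n].
    by rewrite !upd_same.
  by rewrite !upd_other.
have [E [e He]] := finK.
pose mix (s : seq E) p :=
  if excluded_middle_informative (exists2 t, t \in s & e t = p) then y p else x p.
have mixT s p : (exists2 t, t \in s & e t = p) -> mix s p = y p.
  by rewrite /mix; case: excluded_middle_informative.
have mixF s p : ~ (exists2 t, t \in s & e t = p) -> mix s p = x p.
  by rewrite /mix; case: excluded_middle_informative.
have mixP s : f x = f (mix s).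
  elim: s => [|a s IH].
    by congr f; apply: functional_extensionality_dep => p; rewrite mixF // => -[].
  rewrite IH (step _ (e a) (y (e a))); last first.
    by rewrite /mix; case: (excluded_middle_informative _) => H0; [apply: rst_refl|].
  congr f; apply: functional_extensionality_dep => p.
  case: (excluded_middle_informative (exists2 t, t \in a :: s & e t = p)) => [H|n].
    rewrite mixT //; case: H => t; rewrite inE => /orP[/eqP ->|ts] <-.
      by rewrite upd_same.
    case: (excluded_middle_informative (e t = e a)) => [->|m]; first by rewrite upd_same.
    by rewrite upd_other // mixT //; exists t.
  rewrite mixF // upd_other; last by move=> ep; case: n; exists a; rewrite ?mem_head.
  by rewrite mixF // => -[t ts et]; case: n; exists t; rewrite // inE ts orbT.
rewrite (mixP (enum E)); congr f; apply: functional_extensionality_dep => p.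
have [t et] := He p.
by rewrite mixT //; exists t; rewrite ?mem_enum.
Qed.
End PointwiseClosure.

Section Associativity.
Context (A : category) (c : fclass).
Local Notation dobj := (dobj A).
Local Notation dhm := (@dhom A c).

Local Notation did := (@did A c).
Local Notation fctx := (@fctx A).
Local Notation fchom := (@fchom A c).
Local Notation fcid := (@fcid A c _ _).
Local Notation species := (@species A c).
Context (U V W : finType) (F : species U) (Q : U -> species V) (R : V -> species W).

(* An element of the iterated composite in normal form: each of the operations g of Q
   carries its own family Xp of arguments in R. *)
Record adata := AData {
  aI : U -> Type;
  aI_fin : forall u, finite_type (aI u);
  ab : forall u, aI u -> dobj;
  aX : forall u, aI u -> effam R;
  ag : forall u i, sp0 (Q u) (base_ctx (@aX u i)) (@ab u i) }.

Definition aY (m : adata) : effam Q := fun u =>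
  EFam (@aI_fin m u) (fun i => @ag m u i).

(** The arguments in R of all operations, sorted by variable. The index type at v is that of
    [tot_ctx (aY m) v], so the base context of [aXX m] is the total context of [aY m] by conversion;
    [aleft] can then take the identity as inner context map. *)
Definition aXX (m : adata) : effam R := fun v =>
  @EFam A c W (R v) {p : {u : U & aI m u} & ei (@aX m (projT1 p) (projT2 p) v)}
    (ffin (tot_ctx (aY m) v))
    (fun r => @eb _ _ _ _ (@aX m (projT1 (projT1 r)) (projT2 (projT1 r)) v) (projT2 r))
    (fun r => @eH _ _ _ _ (@aX m (projT1 (projT1 r)) (projT2 (projT1 r)) v) (projT2 r))
    (fun r => @ew _ _ _ _ (@aX m (projT1 (projT1 r)) (projT2 (projT1 r)) v) (projT2 r)).

Definition aZ (m : adata) : effam (fun u => Comp (Q u) R) := fun u =>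
  @EFam A c W (Comp (Q u) R) (aI m u) (@aI_fin m u) (@ab m u) (fun i => tot_ctx (aX i))
    (fun i => gen (ag i) fcid).

(** The bijection from ((v, ((u, i), x)), y) to ((u, i), ((v, x), y)) between the two bracketings of
    the sum. *)
Definition ra_idx m w (q : fidx (tot_ctx (aXX m) w)) : fidx (tot_ctx (aZ m) w) :=
  existT (fun p : {u : U & aI m u} => fidx (tot_ctx (@aX m (projT1 p) (projT2 p)) w))
     (projT1 (projT2 (projT1 q)))
     (existT (fun r : {v : V & ei (@aX m (projT1 (projT1 (projT2 (projT1 q))))
                                      (projT2 (projT1 (projT2 (projT1 q)))) v)} =>
                fidx (eH (projT2 r) w))
        (existT _ (projT1 (projT1 q)) (projT2 (projT2 (projT1 q)))) (projT2 q)).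

Definition ra_idx_inv m w (q : fidx (tot_ctx (aZ m) w)) : fidx (tot_ctx (aXX m) w) :=
  existT (fun p : {v : V & ei (aXX m v)} => fidx (eH (projT2 p) w))
     (existT (fun v => ei (aXX m v)) (projT1 (projT1 (projT2 q)))
     (existT (fun p : {u : U & aI m u} =>
                ei (@aX m (projT1 p) (projT2 p) (projT1 (projT1 (projT2 q)))))
        (projT1 q) (projT2 (projT1 (projT2 q)))))
     (projT2 (projT2 q)).

Lemma ra_idxK m w : cancel (@ra_idx m w) (@ra_idx_inv m w).
Proof. by move=> [[v [[u i] x]] y]. Qed.

Lemma ra_idx_invK m w : cancel (@ra_idx_inv m w) (@ra_idx m w).
Proof. by move=> [[u i] [[v x] y]]. Qed.

Definition reassoc (m : adata) : fchom (tot_ctx (aZ m)) (tot_ctx (aXX m)) := fun w =>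
  @FamHom A c (tot_ctx (aZ m) w) (tot_ctx (aXX m) w)
    (fun q => existT (fun p : fidx (tot_ctx (aZ m) w) => dhm (fob p) (fob (d := tot_ctx (aXX m) w) q))
                (ra_idx q) (did _))
    (in_class_can c (@ra_idxK m w) (@ra_idx_invK m w)).

Definition reassoc_inv (m : adata) : fchom (tot_ctx (aXX m)) (tot_ctx (aZ m)) := fun w =>
  @FamHom A c (tot_ctx (aXX m) w) (tot_ctx (aZ m) w)
    (fun q => existT (fun p : fidx (tot_ctx (aXX m) w) => dhm (fob p) (fob (d := tot_ctx (aZ m) w) q))
                (ra_idx_inv q) (did _))
    (in_class_can c (@ra_idx_invK m w) (@ra_idxK m w)).

Lemma reassoc_invK m : fccomp (reassoc_inv m) (reassoc m) = fcid.
Proof. by apply: fchom_eq => w [[v [[u i] x]] y] /=; rewrite dcomp_idl. Qed.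

Definition aleft D a (m : adata) (f : sp0 F (base_ctx (aY m)) a)
    (h : fchom D (tot_ctx (aXX m))) : sp0 (Comp (Comp F Q) R) D a :=
  gen (F := Comp F Q) (X := aXX m) (gen (X := aY m) f fcid) h.

Definition aright D a (m : adata) (f : sp0 F (base_ctx (aY m)) a)
    (h : fchom D (tot_ctx (aZ m))) : sp0 (Comp F (fun u => Comp (Q u) R)) D a :=
  gen (X := aZ m) f h.

(** One move of the operations of Q together with their arguments in R. It induces a step of each of
    [aY], [aXX] and [aZ], so both iterated composites are invariant under it. *)
Record astep (m m' : adata) := AStep {
  as_al : forall u, aI m' u -> aI m u;
  as_in : forall u, in_class c (@as_al u);
  as_m : forall u j, dhm (ab (as_al j)) (@ab m' u j);
  as_st : forall u j, estep (aX (as_al j)) (@aX m' u j);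
  as_E : forall u j, sp1 fcid (@as_m u j) (ag (as_al j)) =
                     sp1 (step_base (as_st j)) (did _) (@ag m' u j) }.

Definition as_Y m m' (t : astep m m') : estep (aY m) (aY m') :=
  @EStep A c U V Q (aY m) (aY m') (as_al t) (as_in t) (as_m t)
    (fun u j => step_base (as_st t j)) (as_E t).

Definition as_X m m' (t : astep m m') : estep (aXX m) (aXX m') :=
  @EStep A c V W R (aXX m) (aXX m')
    (fun v r => projT1 (step_total (as_Y t) v r))
    (fun v => fh_in (step_total (as_Y t) v))
    (fun v r => projT2 (step_total (as_Y t) v r))
    (fun v r => st_k (as_st t (projT2 (projT1 r))) (projT2 r))
    (fun v r => st_E (as_st t (projT2 (projT1 r))) (projT2 r)).

Lemma as_ZE m m' (t : astep m m') u (j : aI m' u) :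
  sp1 (s := Comp (Q u) R) fcid (as_m t j) (gen (X := aX (as_al t j)) (ag (as_al t j)) fcid) =
  sp1 (s := Comp (Q u) R) (step_total (as_st t j)) (did _) (gen (X := aX j) (ag j) fcid).
Proof.
rewrite !CompE as_E fccomp_idl fccomp_idr sp1_id.
by apply: (gen_step (st := as_st t j)); rewrite ?fccomp_idl.
Qed.

Definition as_Z m m' (t : astep m m') : estep (aZ m) (aZ m') :=
  @EStep A c U W (fun u => Comp (Q u) R) (aZ m) (aZ m') (as_al t) (as_in t) (as_m t)
    (fun u j => step_total (as_st t j)) (fun u j => as_ZE t j).

Lemma aleft_step D a m m' (t : astep m m') f f' (h : fchom D (tot_ctx (aXX m))) h' :
  f' = sp1 (step_base (as_Y t)) (did a) f -> h' = fccomp h (step_total (as_X t)) ->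
  aleft f' h = aleft f h'.
Proof.
move=> -> ->; rewrite /aleft.
(* The inner coend moves first and leaves [step_total (as_Y t)] as inner context map. Read as an
   action on the inner element, this is the base map of [as_X t], which the outer coend absorbs. *)
rewrite (gen_step (F := F) (st := as_Y t) (f := f) (h' := step_total (as_Y t))) ?fccomp_idl //.
have -> : gen f (step_total (as_Y t)) =
    sp1 (s := Comp F Q) (step_total (as_Y t)) (did a) (gen (X := aY m') f fcid).
  by rewrite CompE fccomp_idr sp1_id.
exact: (gen_step (st := as_X t)).
Qed.

Lemma aright_step D a m m' (t : astep m m') f f' (h : fchom D (tot_ctx (aZ m))) h' :
  f' = sp1 (step_base (as_Y t)) (did a) f -> h' = fccomp h (step_total (as_Z t)) ->
  aright f' h = aright f h'.
Proof. by move=> -> ->; apply: (gen_step (st := as_Z t)). Qed.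

(** * Normal forms of the elements of an iterated composite *)

Section Normalise.
Context (X : effam R) (Y : effam Q) (k : fchom (base_ctx X) (tot_ctx Y)).

(** A general element has an arbitrary inner context map k. Pushing the arguments X along k
    distributes them over the operations in Y, and the inner map becomes the identity. *)
Definition amk : adata :=
  @AData (fun u => ei (Y u)) (fun u => ei_fin (Y u)) (fun u => @eb _ _ _ _ (Y u))
    (fun u i v => @EFam A c W (R v) (fidx (@eH _ _ _ _ (Y u) i v))
       (ffin (@eH _ _ _ _ (Y u) i v)) (@fob _ (@eH _ _ _ _ (Y u) i v))
       (fun j => eH (projT1 (k v (existT _ (existT _ u i) j))))
       (fun j => sp1 fcid (projT2 (k v (existT _ (existT _ u i) j))) (ew _)))
    (fun u i => @ew _ _ _ _ (Y u) i).

(** Pairs of [sigT] equal their eta-expansion only propositionally, so the passage between the two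
    convertible index types is named. *)
Let eta v (r : ei (aXX amk v)) : fidx (tot_ctx Y v) :=
  existT (fun p : {u : U & ei (Y u)} => fidx (eH (projT2 p) v))
    (existT _ (projT1 (projT1 r)) (projT2 (projT1 r))) (projT2 r).

Lemma amk_in v : in_class c (fun r : ei (aXX amk v) => projT1 (k v (eta r))).
Proof.
apply: (in_class_comp (fh_in (k v)) (be := @eta v)).
apply: (@in_class_can c _ _ _ (fun q : fidx (tot_ctx Y v) => (q : ei (aXX amk v)))).
- by move=> [[u i] x].
- by move=> [[u i] x].
Qed.

Definition amk_step : estep X (aXX amk) :=
  @EStep A c V W R X (aXX amk) (fun v r => projT1 (k v (eta r))) amk_in
    (fun v r => projT2 (k v (eta r))) (fun v r => fcid) (fun v r => esym (sp1_id _)).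

Lemma amk_base : step_base amk_step = k.
Proof. by apply: fchom_eq => v [[u i] x] /=; rewrite /eta /=; case: (k _ _). Qed.

Lemma amk_gen D a (f : sp0 F (base_ctx Y) a) (h : fchom D (tot_ctx X)) :
  gen (F := Comp F Q) (gen f k) h = aleft (m := amk) f (fccomp h (step_total amk_step)).
Proof.
apply: (gen_step (st := amk_step)) => //.
by rewrite CompE amk_base fccomp_idr sp1_id.
Qed.
End Normalise.

Definition aphi0 D a X Y (f : sp0 F (base_ctx Y) a) k (h : fchom D (tot_ctx X)) :=
  @aright D a (@amk X Y k) f
    (fccomp h (fccomp (step_total (amk_step k)) (reassoc_inv (amk k)))).

(** Here the operations of Q move. The arrows [st_k] between their contexts act as base maps on the
    argument families, whose contexts over W stay fixed. *)
Lemma aphi0_inner D a X Y Y' (st : estep Y Y') (f : sp0 F (base_ctx Y') a) k (h : fchom D (tot_ctx X)) :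
  aphi0 (sp1 (step_base st) (did a) f) k h = aphi0 f (fccomp k (step_total st)) h.
Proof.
have @s u (j : ei (Y' u)) :
    estep (@aX (amk k) u (st_al st j)) (@aX (amk (fccomp k (step_total st))) u j).
  refine (@EStep A c V W R (@aX (amk k) u (st_al st j)) (@aX (amk (fccomp k (step_total st))) u j)
     (fun v x => projT1 (st_k st j v x)) (fun v => fh_in (st_k st j v))
     (fun v x => projT2 (st_k st j v x)) (fun v x => fcid) _).
  by move=> v x /=; rewrite sp1_id sp1_comp fccomp_idl.
have @t : astep (amk k) (amk (fccomp k (step_total st))).
  refine (@AStep (amk k) (amk (fccomp k (step_total st))) (st_al st) (st_in st) (st_m st) s _).
  move=> u j /=; rewrite st_E; congr sp1.
  by apply: fchom_eq => v x /=; case: (st_k _ _ _ _).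
apply: (aright_step (t := t)) => //.
symmetry; apply: fccomp_cut.
apply: fchom_eq => w [[u i] [[v x] y]] /=.
by rewrite !(dcomp_idl, dcomp_idr).
Qed.

(** Here the operations of Q stay fixed, and after normalisation only the contexts over W of the
    arguments vary. *)
Lemma aphi0_outer D a X X' (st : estep X X') Y (f : sp0 F (base_ctx Y) a) k (h : fchom D (tot_ctx X)) :
  aphi0 (D := D) (a := a) (Y := Y) f (fccomp (step_base st) k) h = aphi0 f k (fccomp h (step_total st)).
Proof.
have @s u (j : ei (Y u)) :
    estep (@aX (amk (fccomp (step_base st) k)) u j) (@aX (amk k) u j).
  refine (@EStep A c V W R (@aX (amk (fccomp (step_base st) k)) u j) (@aX (amk k) u j)
     (fun v x => x) (fun v => in_class_id c _)
     (fun v x => did _) (fun v x => st_k st _) _).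
  move=> v x /=; rewrite st_E_comp !sp1_comp fccomp_idl fccomp_idr dcomp_idr //.
have @t : astep (amk (fccomp (step_base st) k)) (amk k).
  refine (@AStep (amk (fccomp (step_base st) k)) (amk k) (fun u j => j)
   (fun u => in_class_id c _) (fun u j => did _) s _).
  by move=> u j /=; congr sp1; apply: fchom_eq.
apply: (aright_step (t := t)).
  by rewrite -[LHS]sp1_id; congr sp1; apply: fchom_eq.
apply: fccomp_sq.
apply: fchom_eq => w [[u i] [[v x] y]] /=.
by rewrite !(dcomp_idl, dcomp_idr).
Qed.

Definition aphi D a : sp0 (Comp (Comp F Q) R) D a -> sp0 (Comp F (fun u => Comp (Q u) R)) D a :=
  sub_lift (F := Comp F Q) (fun X fk h => sub_lift (fun Y f k => aphi0 f k h) fk).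

Lemma aphiE D a X Y f k (h : fchom D (tot_ctx X)) :
  aphi (gen (F := Comp F Q) (@gen A c U V F Q _ a Y f k) h) = aphi0 f k h.
Proof.
have inner X0 Y0 f0 k0 (h0 : fchom D (tot_ctx X0)) :
    sub_lift (fun Y f k => aphi0 f k h0) (@gen A c U V F Q _ a Y0 f0 k0) = aphi0 f0 k0 h0.
  by rewrite sub_liftE // => *; apply: aphi0_inner.
rewrite /aphi sub_liftE ?inner // => X1 X2 st f1 h1.
elim/gen_ind: f1 => Y1 f1 k1; rewrite CompE !inner sp1_id.
exact: aphi0_outer.
Qed.

Lemma aphi_aleft D a m f (h : fchom D (tot_ctx (aZ m))) :
  aphi (aleft f (fccomp h (reassoc m))) = aright (a := a) f h.
Proof.
rewrite /aleft aphiE /aphi0.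
have @s u (j : aI m u) : estep (@aX m u j) (@aX (@amk (aXX m) (aY m) fcid) u j).
  refine (@EStep A c V W R (@aX m u j) (@aX (@amk (aXX m) (aY m) fcid) u j)
    (fun v x => x) (fun v => in_class_id c _) (fun v x => did _) (fun v x => fcid) _).
  by move=> v x /=; rewrite !sp1_id.
have @t : astep m (@amk (aXX m) (aY m) fcid).
  refine (@AStep m (@amk (aXX m) (aY m) fcid) (fun u j => j)
   (fun u => in_class_id c _) (fun u j => did _) s _).
  by move=> u j /=; congr sp1; apply: fchom_eq.
apply/esym/(aright_step (t := t)).
  by rewrite -[LHS]sp1_id; congr sp1; apply: fchom_eq.
apply: fccomp_cut.
apply: fchom_eq => w [[u i] [[v x] y]] /=.
by rewrite !(dcomp_idl, dcomp_idr).
Qed.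

(** * Choosing representatives of the arguments *)

Section Choice.
Context (I : U -> Type) (I_fin : forall u, finite_type (I u)).
Context (b : forall u, I u -> dobj) (H : forall u, I u -> fctx W)
  (D : fctx W) (a : dobj).

(** The representatives are left arbitrary, not tied to [qrep], because the proofs below exchange
    one system of representatives for another. *)
Definition areps := forall p : {u : U & I u},
  @subpre A c V W (Q (projT1 p)) R (H (projT2 p)) (b (projT2 p)).

Definition adata_of (r : areps) : adata :=
  @AData I I_fin b (fun u i => sX (r (existT _ u i))) (fun u i => sf (r (existT _ u i))).

Definition apsi0 (r : areps) (f : sp0 F (fun u => Family (I_fin u) (@b u)) a)
    (h : fchom D (osum (finite_sigma (finite_finType U) I_fin) (fun p : {u : U & I u} => H (projT2 p)))) :=
  aleft (m := adata_of r) f (fccomp h (fccomp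
    (@osum_hom A c W {u : U & I u} {u : U & I u} _ (finite_sigma (finite_finType U) I_fin)
       (fun p => H (projT2 p)) (fun p => tot_ctx (@aX (adata_of r) (projT1 p) (projT2 p))) (fun p => p)
       (in_class_id c _) (fun p => sh (r (existT _ (projT1 p) (projT2 p))))) (reassoc (adata_of r)))).

(** [pointwise_clos_inv] reduces equivalence at each argument to one simultaneous step at all
    arguments. The steps then assemble into an [astep] that fixes indices and bases. *)
Lemma apsi0_indep r r' f h :
  (forall p, qcls (@sstep _ _ _ _ _ _ _ _) (r p) = qcls (@sstep _ _ _ _ _ _ _ _) (r' p)) ->
  apsi0 r f h = apsi0 r' f h.
Proof.
move=> e.
apply: (@pointwise_clos_inv {u : U & I u} (fun p : {u : U & I u} =>
    @subpre A c V W (Q (projT1 p)) R (H (projT2 p)) (b (projT2 p)))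
   (fun p => @sstep A c V W (Q (projT1 p)) R (H (projT2 p)) (b (projT2 p)))
   (finite_sigma (finite_finType U) I_fin) _ _ (fun r => apsi0 r f h) _ r r');
  last by move=> p; apply: qcls_inv; apply: e.
  by move=> p x; apply: sstep_refl.
move=> {e} {}r {}r' Hs.
have [s sE] : exists s : forall p, estep (sX (r p)) (sX (r' p)), forall p,
    sf (r p) = sp1 (step_base (s p)) (did _) (sf (r' p)) /\
    sh (r' p) = fccomp (sh (r p)) (step_total (s p)).
  pose s p := constructive_indefinite_description _ (Hs p).
  by exists (fun p => proj1_sig (s p)) => p; case: (proj2_sig (s p)).
have @t : astep (adata_of r) (adata_of r').
  refine (@AStep (adata_of r) (adata_of r') (fun u j => j)
   (fun u => in_class_id c _) (fun u j => did _)
   (fun u j => s (existT _ u j)) _).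
  move=> u j /=; case: (sE (existT _ u j)) => -> _.
  by rewrite sp1_comp fccomp_idl dcomp_idr.
apply: (aleft_step (t := t)).
  by rewrite -[LHS]sp1_id; congr sp1; apply: fchom_eq.
symmetry; apply: fccomp_cut; apply: fchom_eq => w [[v [[u i] x]] y] /=.
case: (sE (existT _ u i)) => _ -> /=.
by rewrite !(dcomp_idl, dcomp_idr).
Qed.
End Choice.

Definition arep (Z : effam (fun u => Comp (Q u) R)) (p : {u : U & ei (Z u)}) :
    @subpre A c V W (Q (projT1 p)) R (eH (projT2 p)) (eb (projT2 p)) :=
  @qrep _ (@sstep A c V W (Q (projT1 p)) R (eH (projT2 p)) (eb (projT2 p))) (ew (projT2 p)).

Lemma arepE (Z : effam (fun u => Comp (Q u) R)) u (j : ei (Z u)) :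
  ew j = gen (sf (arep (existT _ u j))) (sh (arep (existT _ u j))).
Proof. by rewrite -[LHS]qrepK /gen /arep /=; case: (qrep _). Qed.

Definition apsi D a : sp0 (Comp F (fun u => Comp (Q u) R)) D a -> sp0 (Comp (Comp F Q) R) D a :=
  sub_lift (Q := fun u => Comp (Q u) R) (fun Z f h => @apsi0 (fun u => ei (Z u)) (fun u => ei_fin (Z u))
     (fun u => @eb _ _ _ _ (Z u))
     (fun u => @eH _ _ _ _ (Z u)) D a (@arep Z) f h).

(** A step from Z to Z' is cut at families with the bases of Z' and the contexts of Z. There [r1]
    pushes representatives of Z along [st_m], while [r2] pulls back those of Z' along [st_k]. By
    [st_E] they represent the same elements, so [apsi0_indep] joins them. *)
Lemma apsiE D a Z f (h : fchom D (tot_ctx Z)) :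
  apsi (@gen A c U W F (fun u => Comp (Q u) R) D a Z f h) =
  @apsi0 (fun u => ei (Z u)) (fun u => ei_fin (Z u))
     (fun u => @eb _ _ _ _ (Z u))
     (fun u => @eH _ _ _ _ (Z u)) D a (@arep Z) f h.
Proof.
rewrite /apsi sub_liftE // => {f h} {}Z Z' st f h.
pose r := @arep Z; pose r' := @arep Z'.
pose al (p : {u : U & ei (Z' u)}) : {u : U & ei (Z u)} := existT _ (projT1 p) (st_al st (projT2 p)).
pose H u (j : ei (Z' u)) := @eH _ _ _ _ (Z u) (st_al st j).
pose bb u (j : ei (Z' u)) := eb j.
pose r1 : @areps (fun u => ei (Z' u)) bb H := fun p =>
  @SubPre A c V W (Q (projT1 p)) R _ _ (sX (r (al p)))
    (sp1 fcid (st_m st (projT2 p)) (sf (r (al p)))) (sh (r (al p))).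
pose r2 : @areps (fun u => ei (Z' u)) bb H := fun p =>
  @SubPre A c V W (Q (projT1 p)) R _ _ (sX (r' p)) (sf (r' p))
   (fccomp (st_k st (projT2 p)) (sh (r' p))).
pose h1 := fccomp h (@osum_hom A c W _ _ _ (finite_sigma (finite_finType U) (fun u => ei_fin (Z' u)))
    (fun p => eH (projT2 p)) (fun p => @H (projT1 p) (projT2 p))
    al (in_class_sigma (in_class_id c U) (st_in st)) (fun p => fcid)).
transitivity (apsi0 (I_fin := fun u => ei_fin (Z' u)) r1 f h1).
  have @t : astep (@adata_of (fun u => ei (Z u)) (fun u => ei_fin (Z u))
     (fun u => @eb _ _ _ _ (Z u))
     (fun u => @eH _ _ _ _ (Z u)) r) (adata_of (fun u => ei_fin (Z' u)) r1).
    refine (@AStep (@adata_of (fun u => ei (Z u)) (fun u => ei_fin (Z u))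
     (fun u => @eb _ _ _ _ (Z u))
     (fun u => @eH _ _ _ _ (Z u)) r) (adata_of (fun u => ei_fin (Z' u)) r1) (st_al st) (st_in st)
     (st_m st) (fun u j => estep_id _) _).
    by move=> u j; rewrite step_base_id sp1_id.
  apply: (aleft_step (t := t)) => //.
  apply: fccomp_sq; apply: fchom_eq => w [[v [[u i] x]] y] /=.
  by rewrite !(dcomp_idl, dcomp_idr).
rewrite (apsi0_indep (r' := r2)).
  congr aleft; apply: fccomp_sq; apply: fchom_eq => w [[v [[u i] x]] y] /=.
  by rewrite !(dcomp_idl, dcomp_idr).
move=> [u j]; have := st_E st j.
by rewrite !arepE !CompE fccomp_idl sp1_id.
Qed.

Lemma aleft_surj D a (x : sp0 (Comp (Comp F Q) R) D a) :
  exists m f h, x = aleft (m := m) f (fccomp h (reassoc m)).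
Proof.
elim/gen_ind: x => X fk h; elim/gen_ind: fk => Y f k.
exists (amk k), f, (fccomp h (fccomp (step_total (amk_step k)) (reassoc_inv (amk k)))).
by rewrite amk_gen !fccompA reassoc_invK fccomp_idr.
Qed.

Lemma apsi_aright D a m f (h : fchom D (tot_ctx (aZ m))) :
  apsi (aright (a := a) f h) = aleft f (fccomp h (reassoc m)).
Proof.
rewrite /aright apsiE (apsi0_indep (r' := fun p => SubPre (ag (projT2 p)) fcid)).
  apply: (f_equal (fun h => aleft f h)); apply: (f_equal (fccomp h)).
  apply: fchom_eq => w [[v [[u i] x]] y] /=.
  by rewrite !(dcomp_idl, dcomp_idr).
by move=> [u i]; rewrite qrepK.
Qed.

Lemma aphi_psi D a (x : sp0 (Comp F (fun u => Comp (Q u) R)) D a) : aphi (apsi x) = x.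
Proof.
elim/gen_ind: x => Z f h; rewrite apsiE /apsi0 -fccompA aphi_aleft.
set r := @arep Z.
(* The context maps of the representatives form a step from Z to the family whose arguments carry
   the identity instead. *)
have @t : estep Z (aZ (@adata_of (fun u => ei (Z u)) (fun u => ei_fin (Z u))
     (fun u => @eb _ _ _ _ (Z u))
     (fun u => @eH _ _ _ _ (Z u)) r)).
  refine (@EStep A c U W (fun u => Comp (Q u) R) Z
     (aZ (@adata_of (fun u => ei (Z u)) (fun u => ei_fin (Z u))
     (fun u => @eb _ _ _ _ (Z u))
     (fun u => @eH _ _ _ _ (Z u)) r)) (fun u j => j) (fun u => in_class_id c _)
     (fun u j => did _) (fun u j => sh (r (existT _ u j))) _).
  move=> u j /=; rewrite sub1_id sub1_gen fccomp_idr sp1_id.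
  exact: arepE.
apply/esym/(gen_step (st := t)).
  by rewrite -[LHS]sp1_id; congr sp1; apply: fchom_eq.
by apply: (f_equal (fccomp h)); apply: fchom_eq => w [[u i] x].
Qed.

Lemma Comp_assoc : sp_iso (Comp (Comp F Q) R) (Comp F (fun u => Comp (Q u) R)).
Proof.
exists aphi, apsi; split=> [D a x|D a x|D D' a a' d g x].
- by have [m [f [h ->]]] := aleft_surj x; rewrite aphi_aleft apsi_aright.
- exact: aphi_psi.
- have [m [f [h ->]]] := aleft_surj x.
  by rewrite CompE CompE -fccompA fccomp_idl !aphi_aleft CompE.
Qed.

End Associativity.

(** * Variables *)

Section Variables.
Context (A : category) (c : fclass).
Local Notation dobj := (dobj A).
Local Notation dhm := (@dhom A c).

Local Notation did := (@did A c).
Local Notation fctx := (@fctx A).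
Local Notation fchom := (@fchom A c).
Local Notation fcid := (@fcid A c _ _).
Local Notation species := (@species A c).

Lemma finite_prop (P : Prop) : finite_type P.
Proof.
case: (excluded_middle_informative P) => [p|n].
  by exists unit, (fun _ => p) => q; exists tt; apply: proof_irrelevance.
by exists void, (fun t : void => match t return P with end) => q.
Qed.

(* Indexing by the proofs of w = v replaces a case distinction on w inside the type. *)
Definition sing (V : Type) (v : V) (a : dobj) : fctx V := fun w =>
  Family (finite_prop (w = v)) (fun _ => a).

Definition sing_hom (V : Type) (v : V) a a' (g : dhm a a') : fchom (sing v a) (sing v a') :=
  fun w => @FamHom A c (sing v a w) (sing v a' w)
    (fun e => existT (fun e' : fidx (sing v a w) => dhm (fob e') (fob (d := sing v a' w) e)) e g)
    (in_class_id c _).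

Lemma sing_hom_id (V : Type) (v : V) a : sing_hom v (did a) = fcid.
Proof. exact: fchom_eq. Qed.

Lemma sing_hom_comp (V : Type) (v : V) a a' a'' (g : dhm a a') (g' : dhm a' a'') :
  fccomp (sing_hom v g) (sing_hom v g') = sing_hom v (dcomp g g').
Proof. exact: fchom_eq. Qed.

Section Var.
Context (V : Type) (v : V).

Definition var1 (D D' : fctx V) a a' (d : fchom D' D) (g : dhm a a') (x : fchom D (sing v a)) :
  fchom D' (sing v a') := fccomp d (fccomp x (sing_hom v g)).

Lemma var1_id D a (x : fchom D (sing v a)) : var1 fcid (did a) x = x.
Proof. by rewrite /var1 fccomp_idl sing_hom_id fccomp_idr. Qed.

Lemma var1_comp D D' D'' a a' a'' (d : fchom D' D) (d' : fchom D'' D')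
     (g : dhm a a') (g' : dhm a' a'') (x : fchom D (sing v a)) :
  var1 d' g' (var1 d g x) = var1 (fccomp d' d) (dcomp g g') x.
Proof. by rewrite /var1 !fccompA sing_hom_comp. Qed.

Definition var_sp : species V := Species var1_id var1_comp.
End Var.

Definition empty_sp (V : Type) : species V.
Proof.
by refine (@Species A c V (fun _ _ => Empty_set) (fun _ _ _ _ _ _ e => e) _ _).
Defined.

Lemma Comp_empty (V W : finType) (Q : V -> species W) :
  sp_iso (Comp (empty_sp V) Q) (empty_sp W).
Proof.
exists (fun D a => sub_lift (F := empty_sp V) (Q := Q) (fun X f h => (f : Empty_set))).
exists (fun D a (x : Empty_set) => match x with end).
by split=> // [D a x|D D' a a' d g x]; elim/gen_ind: x.
Qed.

(** * The left unit law *)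

Section UnitLaw.
Context (V W : finType) (Q : V -> species W) (v0 : V).
Local Notation F := (var_sp v0).

(** If the class demands surjectivity, every index of X is hit by a proof of v = v0, so the argument
    selected by f is the only one. Otherwise the remaining arguments may be dropped. *)
Lemma uproj_in a (X : effam Q) (f : sp0 F (base_ctx X) a) v (e : v = v0) w :
  in_class c (fun z : fidx (eH (projT1 (f v e)) w) =>
    existT (fun p : {v : V & ei (X v)} => fidx (eH (projT2 p) w))
      (existT _ v (projT1 (f v e))) z).
Proof.
subst v; apply: in_class_by => Hc; first by move=> z z' e; exact: (inj_pair2 _ _ _ _ _ e).
move=> [[v' x'] z].
have [e' ex] := in_class_surj Hc (fh_in (f v')) x'.
have e1 : v' = v0 := e'.
subst v'; have ee : e' = erefl :> (v0 = v0) := proof_irrelevance _ _ _.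
move: ex; rewrite ee /= => ex; subst x'.
by exists z.
Qed.

Definition uproj a (X : effam Q) (f : sp0 F (base_ctx X) a) v (e : v = v0) :
    fchom (tot_ctx X) (eH (projT1 (f v e))) := fun w =>
  @FamHom A c (tot_ctx X w) (eH (projT1 (f v e)) w) (fun z =>
    existT (fun p : fidx (tot_ctx X w) => dhm (fob p) (fob z))
      (existT (fun p : {v : V & ei (X v)} => fidx (eH (projT2 p) w))
         (existT _ v (projT1 (f v e))) z)
      (did _)) (uproj_in f e w).

Definition uphi0 D a (X : effam Q) (f : sp0 F (base_ctx X) a) (h : fchom D (tot_ctx X)) : sp0 (Q v0) D a :=
  sp1 (fccomp h (uproj f erefl)) (projT2 (f v0 erefl)) (ew (projT1 (f v0 erefl))).

Lemma uphi0_step D a (X Y : effam Q) (st : estep X Y) (f : sp0 F (base_ctx Y) a) (h : fchom D (tot_ctx X)) :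
  uphi0 (sp1 (step_base st) (did a) f) h = uphi0 f (fccomp h (step_total st)).
Proof.
rewrite /uphi0 /= dcomp_idr.
set j := projT1 (f v0 erefl); set n := projT2 (f v0 erefl).
rewrite sp1_ctx st_E_comp sp1_comp dcomp_idr.
congr sp1; apply: fccomp_sq; apply: fchom_eq => w z /=.
by rewrite !(dcomp_idl, dcomp_idr).
Qed.

Definition uphi D a : sp0 (Comp F Q) D a -> sp0 (Q v0) D a :=
  sub_lift (F := F) (fun X f h => uphi0 f h).

Lemma uphiE D a (X : effam Q) (f : sp0 F (base_ctx X) a) (h : fchom D (tot_ctx X)) :
  uphi (gen f h) = uphi0 f h.
Proof. by rewrite /uphi sub_liftE // => *; apply: uphi0_step. Qed.

Definition ucast D a (q : sp0 (Q v0) D a) v (e : v = v0) : sp0 (Q v) D a :=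
  eq_rect_r (fun v => sp0 (Q v) D a) q e.

(** The single argument q placed at v0, with the proofs of v = v0 as indices; at the other variables
    the family is empty. *)
Definition uX D a (q : sp0 (Q v0) D a) : effam Q := fun v =>
  @EFam A c W (Q v) (v = v0) (finite_prop _) (fun _ => a) (fun _ => D) (fun e => ucast q e).

Lemma uinj_in D a (q : sp0 (Q v0) D a) w :
  in_class c (fun p : fidx (tot_ctx (uX q) w) => (projT2 p : fidx (D w))).
Proof.
apply: (@in_class_can c _ _ _ (fun z : fidx (D w) =>
  existT (fun p : {v : V & ei (uX q v)} => fidx (eH (projT2 p) w))
    (existT (fun v => ei (uX q v)) v0 (erefl v0)) z)) => [|//].
by move=> [[v e]]; change (v = v0) in e; subst v.
Qed.

Definition uinj D a (q : sp0 (Q v0) D a) : fchom D (tot_ctx (uX q)) := fun w =>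
  @FamHom A c (D w) (tot_ctx (uX q) w) (fun p =>
    existT (fun z : fidx (D w) => dhm (fob z) (fob (d := tot_ctx (uX q) w) p))
      (projT2 p) (did _)) (uinj_in q w).

Definition upsi D a (q : sp0 (Q v0) D a) : sp0 (Comp F Q) D a :=
  gen (F := F) (X := uX q) (fcid : fchom (sing v0 a) (sing v0 a)) (uinj q).

Lemma uphiK D a (x : sp0 (Comp F Q) D a) : upsi (uphi x) = x.
Proof.
elim/gen_ind: x => X f h; rewrite uphiE.
set q := uphi0 f h.
have @t : estep (uX q) (push (f : fchom _ (sing v0 a))).
  refine (@EStep A c V W Q (uX q) (push (f : fchom _ (sing v0 a))) (fun v e => e)
    (fun v => in_class_id c _) (fun v e => did _) (fun v e => fccomp h (uproj f e)) _).
  move=> v e; change (v = v0) in e; subst v => /=.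
  by rewrite sp1_id sp1_comp fccomp_idr dcomp_idr.
(* Yoneda: the head f is itself an arrow into [sing v0 a], so it can be absorbed into the arguments,
   leaving the identity as head. *)
have -> : gen f h = gen (F := F) (X := push (f : fchom _ (sing v0 a)))
   (fcid : fchom (sing v0 a) (sing v0 a)) (fccomp h (push_total f)).
  rewrite -gen_push; congr gen.
  by rewrite /= /var1 fccomp_idl sing_hom_id fccomp_idr.
apply: (gen_step (st := t)).
  by apply: fchom_eq => v e /=; rewrite !(dcomp_idl, dcomp_idr).
apply: fchom_eq => w [[v e] z] /=.
by rewrite !(dcomp_idl, dcomp_idr).
Qed.

Lemma upsiK D a (q : sp0 (Q v0) D a) : uphi (upsi q) = q.
Proof.
rewrite /upsi uphiE /uphi0 /= -[RHS]sp1_id; congr sp1.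
by apply: fchom_eq => w z /=; rewrite !(dcomp_idl, dcomp_idr).
Qed.

Lemma Comp_var : sp_iso (Comp F Q) (Q v0).
Proof.
exists uphi, upsi; split=> [D a x|D a x|D D' a a' d g x].
- exact: uphiK.
- exact: upsiK.
elim/gen_ind: x => X f h; rewrite CompE !uphiE /uphi0 sp1_comp.
rewrite /= dcomp_idl; congr sp1; rewrite -fccompA.
by apply: (f_equal (fccomp (fccomp d h))); apply: fchom_eq.
Qed.
End UnitLaw.
End Variables.

(** * Renaming *)

Section Renaming.
Context (A : category) (c : fclass).
Local Notation dobj := (dobj A).
Local Notation dhm := (@dhom A c).
Local Notation dfam := (dfam A).
Local Notation did := (@did A c).
Local Notation fctx := (@fctx A).
Local Notation fchom := (@fchom A c).
Local Notation fcid := (@fcid A c _ _).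
Local Notation species := (@species A c).

(* The empty map into X lies in the class: X can be weakened away. *)
Definition discardable (X : dfam) : Prop := c = CBij \/ c = CSurj -> fidx X -> False.

Lemma discardable_hom (X Y : dfam) (s : famhom c X Y) : discardable Y -> discardable X.
Proof.
move=> dY Hc i; have [j _] := in_class_surj Hc (fh_in s) i; exact: dY Hc j.
Qed.

Definition ren_ctx (V W : Type) (r : V -> W) (D : fctx W) : fctx V := fun v => D (r v).
Definition ren_hom (V W : Type) (r : V -> W) (D D' : fctx W) (d : fchom D' D) :
  fchom (ren_ctx r D') (ren_ctx r D) := fun v => d (r v).

Section Ren.
Context (V W : Type) (r : V -> W) (F : species V).

Definition off_image (D : fctx W) : Prop :=
  forall w, (forall v, r v <> w) -> discardable (D w).

(** For injective r this is a formula without coend for composing F with the variables r v: restrict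
    the context along r and weaken away the rest. *)
Definition ren0 (D : fctx W) (a : dobj) : Type := {f : sp0 F (ren_ctx r D) a | off_image D}.

Lemma ren0_eq D a (x y : ren0 D a) : proj1_sig x = proj1_sig y -> x = y.
Proof. by case: x y => x p [y q] /= e; subst y; rewrite (proof_irrelevance _ p q). Qed.

Lemma off_image_hom D D' (d : fchom D' D) : off_image D -> off_image D'.
Proof. by move=> H w /H; apply: discardable_hom; apply: d. Qed.

Definition ren1 D D' a a' (d : fchom D' D) (g : dhm a a') (x : ren0 D a) : ren0 D' a' :=
  exist _ (sp1 (ren_hom r d) g (proj1_sig x)) (off_image_hom d (proj2_sig x)).

Lemma ren1_id D a (x : ren0 D a) : ren1 fcid (did a) x = x.
Proof. by apply: ren0_eq; apply: sp1_id. Qed.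

Lemma ren1_comp D D' D'' a a' a'' (d : fchom D' D) (d' : fchom D'' D')
     (g : dhm a a') (g' : dhm a' a'') (x : ren0 D a) :
  ren1 d' g' (ren1 d g x) = ren1 (fccomp d' d) (dcomp g g') x.
Proof. by apply: ren0_eq; apply: sp1_comp. Qed.

Definition ren : species W := Species ren1_id ren1_comp.
End Ren.

Lemma ren_iso (V W : Type) (r : V -> W) (F G : species V) : sp_iso F G -> sp_iso (ren r F) (ren r G).
Proof.
move=> [p [q [K K' N]]].
exists (fun D a (x : ren0 r F D a) => exist _ (p _ _ (proj1_sig x)) (proj2_sig x) : ren0 r G D a).
exists (fun D a (x : ren0 r G D a) => exist _ (q _ _ (proj1_sig x)) (proj2_sig x) : ren0 r F D a).
by split=> [D a x|D a x|D D' a a' d g x]; apply: ren0_eq; rewrite /= ?K ?K' ?N.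
Qed.

Lemma ren_id_iso (V : Type) (F : species V) : sp_iso (ren id F) F.
Proof.
exists (fun D a (x : ren0 id F D a) => proj1_sig x).
unshelve eexists (fun D a (x : sp0 F D a) => exist _ x _ : ren0 id F D a).
  by move=> w H; case: (H w).
by split=> [D a x|D a x|D D' a a' d g x] //; apply: ren0_eq.
Qed.

(** * Renaming as composition with variables *)

Section RenComp.
Context (V W : finType) (r : V -> W) (F : species V).
Context (r_inj : injective r).
Local Notation Q := (fun v => var_sp A c (r v)).

Section Proj.
Context (X : effam Q) (v : V).

Let e0 (i : ei (X v)) := (ew i : fchom (eH i) (sing (r v) (eb i))) (r v) erefl.

Lemma rproj_in : in_class c (fun i : fidx (base_ctx X v) =>
  existT (fun p : {v : V & ei (X v)} => fidx (eH (projT2 p) (r v)))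
    (existT (fun v => ei (X v)) v i) (projT1 (e0 i))).
Proof.
apply: in_class_by => Hc.
  move=> i i' e; have := f_equal (@projT1 _ _) e; exact: inj_pair2.
move=> [[v' i'] x].
have [e ex] := in_class_surj Hc (fh_in ((ew i' : fchom (eH i') (sing (r v') (eb i'))) (r v))) x.
have ev := r_inj e; subst v'; exists i'; rewrite /e0 -ex.
by have -> : e = erefl :> (r v = r v) := proof_irrelevance _ _ _.
Qed.

Definition rproj : famhom c (tot_ctx X (r v)) (base_ctx X v) :=
  @FamHom A c (tot_ctx X (r v)) (base_ctx X v)
    (fun i => existT (fun p : fidx (tot_ctx X (r v)) => dhm (fob p) (fob (d := base_ctx X v) i))
       (existT (fun p : {v : V & ei (X v)} => fidx (eH (projT2 p) (r v)))
         (existT (fun v => ei (X v)) v i) (projT1 (e0 i))) (projT2 (e0 i))) rproj_in.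
End Proj.

Lemma tot_off_image (X : effam Q) : off_image r (tot_ctx X).
Proof.
move=> w H Hc [[v i] x].
have [e _] := in_class_surj Hc (fh_in ((ew i : fchom (eH i) (sing (r v) (eb i))) w)) x.
by case: (H v).
Qed.

Definition rphi0 D a (X : effam Q) (f : sp0 F (base_ctx X) a) (h : fchom D (tot_ctx X)) :
    sp0 (ren r F) D a :=
  exist _ (sp1 (fun v => fcomp (h (r v)) (rproj X v)) (did a) f)
    (off_image_hom h (@tot_off_image X)).

(** For variables, [st_E] is an equation between morphisms into [sing]. Its value at the index
    [erefl] is the naturality wanted here. *)
Lemma rproj_step (X Y : effam Q) (st : estep X Y) v :
  fcomp (rproj X v) (step_base st v) = fcomp (step_total st (r v)) (rproj Y v).
Proof.
apply: famhom_eq => j.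
have := st_E st j; rewrite /= /var1 fccomp_idl sing_hom_id fccomp_idr => E.
have {E} := f_equal (fun s : fchom _ (sing (r v) _) => s (r v) erefl) E.
move=> /(f_equal (fun p => existT
   (fun q : fidx (tot_ctx X (r v)) => dhm (fob q) (fob (d := base_ctx Y v) j))
   (existT (fun p : {v : V & ei (X v)} => fidx (eH (projT2 p) (r v)))
      (existT (fun v => ei (X v)) v (st_al st j)) (projT1 p)) (projT2 p))) /= ->.
done.
Qed.

Definition rphi D a : sp0 (Comp F Q) D a -> sp0 (ren r F) D a :=
  sub_lift (F := F) (fun X f h => rphi0 f h).

Lemma rphiE D a (X : effam Q) (f : sp0 F (base_ctx X) a) (h : fchom D (tot_ctx X)) :
  rphi (gen f h) = rphi0 f h.
Proof.
rewrite /rphi sub_liftE // => {f h} {}X Y st f h; apply: ren0_eq => /=.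
rewrite sp1_comp dcomp_idl; congr sp1; apply: functional_extensionality_dep => v.
by rewrite /fccomp !fcompA rproj_step.
Qed.

Definition rtr (D : fctx W) w w' (e : w = w') :
    forall i : fidx (D w'), {i' : fidx (D w) & dhm (fob i') (fob i)} :=
  match e in _ = w' return forall i : fidx (D w'), {i' : fidx (D w) & dhm (fob i') (fob i)} with
  | erefl => fun i => existT _ i (did _)
  end.

Definition rX (D : fctx W) : effam Q := fun v =>
  @EFam A c W (Q v) (fidx (D (r v))) (ffin (D (r v))) (@fob _ (D (r v)))
    (fun i => sing (r v) (fob i)) (fun i => fcid).

(** Injectivity of r makes the index map injective. Surjectivity needs [off_image]: indices lying
    off the image of r would not be reached. *)
Lemma rinj_in D (HD : off_image r D) w : in_class c (fun p : fidx (tot_ctx (rX D) w) =>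
  projT1 (rtr (projT2 p : w = r (projT1 (projT1 p))) (projT2 (projT1 p)))).
Proof.
apply: in_class_by => Hc.
  move=> [[v1 i1] e1] [[v2 i2] e2] /=.
  change (w = r v1) in e1; change (w = r v2) in e2.
  subst w; have ev := r_inj e2; subst v2.
  have -> : e2 = erefl :> (r v1 = r v1) := proof_irrelevance _ _ _.
  by move=> /= ->.
move=> i; case: (excluded_middle_informative (exists v, r v = w)) => [[v e]|n].
  by subst w; exists (existT _ (existT _ v i) erefl).
by case: (HD w) => // v e; case: n; exists v.
Qed.

Definition rinj D (HD : off_image r D) : fchom D (tot_ctx (rX D)) := fun w =>
  @FamHom A c (D w) (tot_ctx (rX D) w) (fun p =>
    rtr (projT2 p : w = r (projT1 (projT1 p))) (projT2 (projT1 p))) (rinj_in HD w).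

Definition rpsi D a (x : sp0 (ren r F) D a) : sp0 (Comp F Q) D a :=
  gen (F := F) (X := rX D) (proj1_sig x) (rinj (proj2_sig x)).

Lemma rpsiK D a (x : sp0 (ren r F) D a) : rphi (rpsi x) = x.
Proof.
rewrite /rpsi rphiE; apply: ren0_eq; rewrite /= -[RHS]sp1_id; congr sp1.
by apply: fchom_eq => v i /=; rewrite dcomp_idl.
Qed.

Lemma rphiK D a (x : sp0 (Comp F Q) D a) : rpsi (rphi x) = x.
Proof.
elim/gen_ind: x => X f h; rewrite rphiE /rpsi /=.
(* Both sides step to [X0], whose arguments are identities of [sing]: X reaches it through the
   contexts, by taking its own elements as arrows, and [rX D] through the bases. *)
pose X0 : effam Q := fun v =>
  @EFam A c W (Q v) (ei (X v)) (ei_fin (X v)) (@eb _ _ _ _ (X v))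
    (fun i => sing (r v) (eb i)) (fun i => fcid).
have @s : estep X X0.
  refine (@EStep A c V W Q X X0 (fun v i => i) (fun v => in_class_id c _)
    (fun v i => did _) (fun v i => @ew _ _ _ _ (X v) i) _).
  by move=> v i; rewrite sp1_id /= /var1 fccomp_idl sing_hom_id fccomp_idr.
have @t : estep (rX D) X0.
  refine (@EStep A c V W Q (rX D) X0
    (fun v i => projT1 (fcomp (h (r v)) (rproj X v) i))
    (fun v => fh_in (fcomp (h (r v)) (rproj X v)))
    (fun v i => projT2 (fcomp (h (r v)) (rproj X v) i))
    (fun v i => sing_hom (r v) (projT2 (fcomp (h (r v)) (rproj X v) i))) _).
  by move=> v i; rewrite /= /var1 !fccomp_idl sing_hom_id fccomp_idr.
rewrite (gen_step (F := F) (st := t) (f := f)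
  (h' := fccomp (rinj (proj2_sig (rphi0 f h))) (step_total t))) //.
symmetry; apply: (gen_step (st := s)).
  by rewrite -[LHS]sp1_id; congr sp1; apply: fchom_eq.
apply: fchom_eq => w [[v i] e] /=; change (w = r v) in e; subst w => /=.
by rewrite dcomp_idl.
Qed.

Lemma Comp_ren : sp_iso (Comp F Q) (ren r F).
Proof.
exists rphi, rpsi; split=> [D a x|D a x|D D' a a' d g x].
- exact: rphiK.
- exact: rpsiK.
elim/gen_ind: x => X f h; rewrite CompE !rphiE; apply: ren0_eq => /=.
rewrite !sp1_comp fccomp_idr dcomp_idr dcomp_idl; congr sp1.
by apply: functional_extensionality_dep => v; rewrite /fccomp fcompA.
Qed.
End RenComp.

Lemma Comp_var_id (V : finType) (F : species V) : sp_iso (Comp F (@var_sp A c V)) F.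
Proof.
apply: sp_iso_trans (ren_id_iso F).
exact: (@Comp_ren V V id F (fun _ _ e => e)).
Qed.

Definition cons_sp (V W : finType) (Q : V -> species W) (P : species W) (o : option V) : species W :=
  match o with Some v => Q v | None => P end.

(** A substitution after weakening ignores the new variable. With weakening seen as composition with
    variables, this is associativity and the left unit law. *)
Lemma Comp_ren_cons (V W : finType) (F : species V) (Q : V -> species W) (P : species W) :
  sp_iso (Comp (ren Some F) (cons_sp Q P)) (Comp F Q).
Proof.
apply: sp_iso_trans.
  apply: (Comp_iso (F' := Comp F (fun v => var_sp A c (Some v))) (Q' := cons_sp Q P)).
    by apply: sp_iso_sym; apply: Comp_ren => v v' [].
  by move=> o; apply: sp_iso_refl.
apply: sp_iso_trans (Comp_assoc _ _ _) _.
by apply: Comp_iso => [|v]; [apply: sp_iso_refl|apply: (Comp_var (cons_sp Q P) (Some v))].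
Qed.
End Renaming.

(** * Abstraction and its inverse *)

Section Abstraction.
Context (A : category) (c : fclass).
Local Notation dobj := (dobj A).
Local Notation dhm := (@dhom A c).
Local Notation dfam := (dfam A).
Local Notation did := (@did A c).
Local Notation fctx := (@fctx A).
Local Notation fchom := (@fchom A c).
Local Notation fcid := (@fcid A c _ _).
Local Notation fid := (@fid A c).
Local Notation species := (@species A c).

(** Equalities of objects are turned into arrows, so that transports become composites and proof
    irrelevance disposes of them. *)
Definition eqh (a b : dobj) (e : a = b) : dhm a b :=
  match e in _ = b return dhm a b with erefl => did a end.

Lemma eqh_refl a (e : a = a) : eqh e = did a.
Proof. by rewrite (proof_irrelevance _ e erefl). Qed.

Lemma existT_eqh (X : dfam) (i j : fidx X) b (e : fob i = b) (f : dhm (fob j) b) :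
  forall (ij : i = j), f = eqh (etrans (congr1 _ (esym ij)) e) ->
  existT (fun i => dhm (fob i) b) i (eqh e) = existT _ j f.
Proof. by move=> ij; subst j => ->; congr existT; congr eqh; apply: proof_irrelevance. Qed.

Section FamIso.
Context (X Y : dfam) (g : fidx Y -> fidx X) (g' : fidx X -> fidx Y)
  (K : cancel g g') (K' : cancel g' g) (E : forall j, fob (g j) = fob j).

Definition fam_to : famhom c X Y :=
  @FamHom A c X Y (fun j => existT (fun i => dhm (fob i) (fob j)) (g j) (eqh (E j)))
    (in_class_can c K K').

Definition fam_fromE i : fob (g' i) = fob i := etrans (esym (E (g' i))) (congr1 _ (K' i)).

Definition fam_from : famhom c Y X :=
  @FamHom A c Y X (fun i => existT (fun j => dhm (fob j) (fob i)) (g' i) (eqh (fam_fromE i)))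
    (in_class_can c K' K).

Lemma eqh_comp (x y z : dobj) (e : x = y) (e' : y = z) : dcomp (eqh e) (eqh e') = eqh (etrans e e').
Proof. by case: _ / e'; rewrite /= dcomp_idr. Qed.

Lemma fam_toK : fcomp fam_to fam_from = fid X.
Proof.
apply: famhom_eq => i /=; rewrite eqh_comp; apply: (existT_eqh (ij := K' i)).
by rewrite eqh_refl.
Qed.

Lemma fam_fromK : fcomp fam_from fam_to = fid Y.
Proof.
apply: famhom_eq => j /=; rewrite eqh_comp; apply: (existT_eqh (ij := K j)).
by rewrite eqh_refl.
Qed.
End FamIso.

Definition fl (l : seq dobj) : dfam := Family (finite_finType 'I_(size l)) (lnth l).

Lemma lnth_map (T T' : Type) (f : T -> T') (s : seq T) (i : 'I_(size (map f s))) :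
  lnth (map f s) i = f (lnth s (cast_ord (size_map f s) i)).
Proof.
rewrite (lnth_nth _ (f (lnth s (cast_ord (size_map f s) i)))).
rewrite (nth_map (lnth s (cast_ord (size_map f s) i))); last first.
  by rewrite -(size_map f s).
by congr f; rewrite [RHS](lnth_nth _ (lnth s (cast_ord (size_map f s) i))).
Qed.

(** Of each fibre of the surjection onto the index type, only the point chosen by a section is kept.
    The resulting list enumerates the indices without repetition, as bijectivity requires, and
    equality is decided only in the finite type above. *)
Lemma lst_ex (X : dfam) : exists l : seq dobj, exists st : famhom c (fl l) X * famhom c X (fl l),
  fcomp st.1 st.2 = fid (fl l) /\ fcomp st.2 st.1 = fid X.
Proof.
have [T [e He]] := ffin X.
pose sec x := proj1_sig (constructive_indefinite_description _ (He x)).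
have secK x : e (sec x) = x by exact: proj2_sig (constructive_indefinite_description _ (He x)).
pose s := [seq t <- enum T | sec (e t) == t].
pose l := [seq fob (e t) | t <- s].
have us : uniq s by rewrite filter_uniq ?enum_uniq.
have ss x : sec x \in s by rewrite mem_filter secK eqxx mem_enum.
pose g (i : fidx (fl l)) : fidx X := e (lnth s (cast_ord (size_map _ s) i)).
have lt x : index (sec x) s < size l by rewrite size_map index_mem.
pose g' (x : fidx X) : fidx (fl l) := Ordinal (lt x).
have K : cancel g g'.
  move=> i; apply: ord_inj => /=; rewrite /g.
  set t := lnth s _; have ts : t = nth t s i by rewrite /t {1}(lnth_nth _ t).
  have is_ : i < size s by rewrite -(size_map (fun t => fob (e t)) s).
  have : t \in s by rewrite ts mem_nth.
  by rewrite mem_filter => /andP[/eqP -> _]; rewrite ts index_uniq.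
have K' : cancel g' g.
  move=> x; rewrite /g; set t := lnth s _.
  suff -> : t = sec x by [].
  by rewrite /t (lnth_nth _ (sec x)) /= nth_index.
have E (x : fidx X) : fob (g' x) = fob x.
  transitivity (fob (g (g' x))); last by rewrite K'.
  exact: (@lnth_map _ _ (fun t => fob (e t)) s (g' x)).
exists l, (fam_to K' K E, fam_from K' K E).
by rewrite /= fam_toK fam_fromK.
Qed.

Definition lst (X : dfam) : seq dobj := proj1_sig (constructive_indefinite_description _ (lst_ex X)).
Definition lst_pair (X : dfam) :=
  constructive_indefinite_description _ (proj2_sig (constructive_indefinite_description _ (lst_ex X))).
Definition of_lst (X : dfam) : famhom c (fl (lst X)) X := (proj1_sig (lst_pair X)).1.
Definition to_lst (X : dfam) : famhom c X (fl (lst X)) := (proj1_sig (lst_pair X)).2.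
Lemma of_lstK X : fcomp (of_lst X) (to_lst X) = fid _.
Proof. exact: (proj2_sig (lst_pair X)).1. Qed.
Lemma to_lstK X : fcomp (to_lst X) (of_lst X) = fid _.
Proof. exact: (proj2_sig (lst_pair X)).2. Qed.

Definition mkArr l l' a a' (s : famhom c (fl l') (fl l)) (g : dhm a a') :
    dhm (Arr l a) (Arr l' a') :=
  @HArr A c l a l' a' (fun i => projT1 (s i)) (fh_in s) (fun i => projT2 (s i)) g.

Lemma mkArr_comp l l' l'' a a' a'' (s : famhom c (fl l') (fl l)) (t : famhom c (fl l'') (fl l'))
    (g : dhm a a') (g' : dhm a' a'') :
  dcomp (mkArr s g) (mkArr t g') = mkArr (fcomp t s) (dcomp g g').
Proof. by rewrite /mkArr dcomp_arr; apply: HArr_eq. Qed.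

Lemma mkArr_id l a : mkArr (fid (fl l)) (did a) = did (Arr l a).
Proof. by rewrite did_arr; apply: HArr_eq. Qed.

Lemma mkArr_ind l a (Pr : forall d, dhm (Arr l a) d -> Prop) :
  (forall l' a' (s : famhom c (fl l') (fl l)) (g : dhm a a'), Pr _ (mkArr s g)) ->
  forall d g, Pr d g.
Proof.
move=> H; apply: dhom_from_arr_ind => l' a' al Hal fs f.
exact: (H l' a' (@FamHom A c (fl l') (fl l) (fun i => existT _ (al i) (fs i)) Hal) f).
Qed.

(** [Arr] needs a list where contexts supply a family. Conjugation by the isomorphisms with the
    chosen lists makes the passage functorial. *)
Definition arrX (X Y : dfam) a a' (s : famhom c Y X) (g : dhm a a') :
    dhm (Arr (lst X) a) (Arr (lst Y) a') :=
  mkArr (fcomp (of_lst Y) (fcomp s (to_lst X))) g.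

Lemma arrX_id X a : arrX (fid X) (did a) = did _.
Proof. by rewrite /arrX fcomp_idl of_lstK mkArr_id. Qed.

Lemma arrX_comp (X Y Z : dfam) a a' a'' (s : famhom c Y X) (t : famhom c Z Y)
    (g : dhm a a') (g' : dhm a' a'') :
  dcomp (arrX s g) (arrX t g') = arrX (fcomp t s) (dcomp g g').
Proof.
rewrite /arrX mkArr_comp; congr mkArr.
by rewrite !fcompA -[fcomp (to_lst Y) _]fcompA to_lstK fcomp_idl.
Qed.

Definition fext V (D : fctx V) (X : dfam) : fctx (option V) := fun o =>
  match o with Some v => D v | None => X end.

Definition fext_hom V (D D' : fctx V) (X X' : dfam) (d : fchom D D') (s : famhom c X X') :
    fchom (fext D X) (fext D' X') := fun o =>
  match o with Some v => d v | None => s end.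

Lemma fext_hom_id V (D : fctx V) (X : dfam) :
  fext_hom (fcid : fchom D D) (fid X) = fcid.
Proof. by apply: fchom_eq => -[]. Qed.

Lemma fext_hom_comp V (D D' D'' : fctx V) (X X' X'' : dfam) (d : fchom D D') (d' : fchom D' D'')
    (s : famhom c X X') (s' : famhom c X' X'') :
  fccomp (fext_hom d s) (fext_hom d' s') = fext_hom (fccomp d d') (fcomp s s').
Proof. by apply: fchom_eq => -[]. Qed.

(* Inverse to lam_sp only on one side: lam_sp (unlam_sp F) is empty at atoms. *)
Section Unlam.
Context (V : Type) (F : species V).

Definition unlam0 (G : fctx (option V)) a := sp0 F (ren_ctx Some G) (Arr (lst (G None)) a).

Definition unlam1 (D D' : fctx (option V)) a a' (d : fchom D' D) (g : dhm a a') :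
  unlam0 D a -> unlam0 D' a' := sp1 (ren_hom Some d) (arrX (d None) g).

Lemma unlam1_id D a (x : unlam0 D a) : unlam1 fcid (did a) x = x.
Proof. by rewrite /unlam1 arrX_id; apply: sp1_id. Qed.

Lemma unlam1_comp D D' D'' a a' a'' (d : fchom D' D) (d' : fchom D'' D')
     (g : dhm a a') (g' : dhm a' a'') (x : unlam0 D a) :
  unlam1 d' g' (unlam1 d g x) = unlam1 (fccomp d' d) (dcomp g g') x.
Proof. by rewrite /unlam1 sp1_comp arrX_comp. Qed.

Definition unlam_sp : species (option V) := Species unlam1_id unlam1_comp.
End Unlam.

Lemma unlam_iso V (F G : species V) : sp_iso F G -> sp_iso (unlam_sp F) (unlam_sp G).
Proof.
move=> [p [q [K K' N]]]; exists (fun D a => p _ _), (fun D a => q _ _).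
by split=> [D a x|D a x|D D' a a' d g x]; rewrite ?K ?K' ?N //= /unlam1 N.
Qed.

Section Lam.
Context (V : Type) (P : species (option V)).

Definition lam_sp0 (D : fctx V) (a : dobj) : Type :=
  match a with Arr l b => sp0 P (fext D (fl l)) b | Atom _ => Empty_set end.

Definition lam_sp1 (D D' : fctx V) a a' (d : fchom D' D) (g : dhm a a') :
    lam_sp0 D a -> lam_sp0 D' a' :=
  match g in dhom _ a a' return lam_sp0 D a -> lam_sp0 D' a' with
  | HAtom _ _ _ => fun x => x
  | HArr l b l' b' al Hal fs f0 => fun x =>
      sp1 (fext_hom d (@FamHom A c (fl l') (fl l) (fun i => existT _ (al i) (fs i)) Hal)) f0 x
  end.

Lemma lam_sp1E (D D' : fctx V) (d : fchom D' D) l a l' a' (s : famhom c (fl l') (fl l))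
    (g : dhm a a') (x : lam_sp0 D (Arr l a)) :
  lam_sp1 d (mkArr s g) x = sp1 (fext_hom d s) g x.
Proof.
rewrite /lam_sp1 /mkArr; congr sp1; congr fext_hom.
by apply: famhom_eq => i /=; case: (s i).
Qed.

Lemma lam_sp1_id D a (x : lam_sp0 D a) : lam_sp1 fcid (did a) x = x.
Proof. by case: a x => // l b x; rewrite -mkArr_id lam_sp1E fext_hom_id sp1_id. Qed.

Lemma lam_sp1_comp D D' D'' a a' a'' (d : fchom D' D) (d' : fchom D'' D')
     (g : dhm a a') (g' : dhm a' a'') (x : lam_sp0 D a) :
  lam_sp1 d' g' (lam_sp1 d g x) = lam_sp1 (fccomp d' d) (dcomp g g') x.
Proof.
case: a x g => // l b x g; move: a' g a'' g'.
apply: mkArr_ind => l' b' s g; apply: mkArr_ind => l'' b'' s' g'.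
by rewrite mkArr_comp !lam_sp1E sp1_comp fext_hom_comp.
Qed.

Definition lam_sp : species V := Species lam_sp1_id lam_sp1_comp.
End Lam.

Lemma lam_iso V (F G : species (option V)) : sp_iso F G -> sp_iso (lam_sp F) (lam_sp G).
Proof.
move=> [p [q [K K' N]]].
exists (fun D a => match a return lam_sp0 F D a -> lam_sp0 G D a with
  Arr l b => p _ _ | Atom _ => id end).
exists (fun D a => match a return lam_sp0 G D a -> lam_sp0 F D a with
  Arr l b => q _ _ | Atom _ => id end).
split=> [D [//|l b] x|D [//|l b] x|D D' [//|l b]]; rewrite ?K ?K' //.
move=> a' d g; move: a' g; apply: mkArr_ind => l' b' s g x.
change (p _ _ (lam_sp1 (P := F) d (mkArr s g) x) = lam_sp1 (P := G) d (mkArr s g) (p _ _ x)).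
by rewrite !lam_sp1E N.
Qed.

(** The two sides differ only in that the last component [G None] is replaced by its chosen list, so
    the isomorphism is restriction along [to_lst], with inverse along [of_lst]. *)
Lemma unlam_lam_iso V (P : species (option V)) : sp_iso (unlam_sp (lam_sp P)) P.
Proof.
pose up (G : fctx (option V)) : fchom G (fext (ren_ctx Some G) (fl (lst (G None)))) := fun o =>
  match o with Some v => fid (G (Some v)) | None => to_lst (G None) end.
pose dn (G : fctx (option V)) : fchom (fext (ren_ctx Some G) (fl (lst (G None)))) G := fun o =>
  match o with Some v => fid (G (Some v)) | None => of_lst (G None) end.
have upK G : fccomp (up G) (dn G) = fcid.
  by apply: functional_extensionality_dep => -[v|]; [apply: fcomp_idl|apply: to_lstK].
have dnK G : fccomp (dn G) (up G) = fcid.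
  by apply: functional_extensionality_dep => -[v|]; [apply: fcomp_idl|apply: of_lstK].
exists (fun G a (x : sp0 P (fext (ren_ctx Some G) (fl (lst (G None)))) a) => sp1 (up G) (did a) x).
exists (fun G a x => sp1 (dn G) (did a) x).
split=> [D a x|D a x|D D' a a' d g x].
- by rewrite sp1_comp dnK dcomp_idl sp1_id.
- by rewrite sp1_comp upK dcomp_idl sp1_id.
change (sp1 (up D') (did a') (lam_sp1 (P := P) (ren_hom Some d) (arrX (d None) g) x) =
  sp1 d g (sp1 (up D) (did a) x)).
rewrite /arrX lam_sp1E !sp1_comp dcomp_idl dcomp_idr; congr sp1.
apply: functional_extensionality_dep => -[v|]; rewrite /fccomp /=.
  by rewrite fcomp_idl fcomp_idr.
by rewrite -fcompA to_lstK fcomp_idl.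
Qed.

Lemma lam_unlam_iso V (F : species V) :
  (forall D o, sp0 F D (Atom o) -> False) -> sp_iso F (lam_sp (unlam_sp F)).
Proof.
move=> F0.
exists (fun D a => match a return sp0 F D a -> lam_sp0 (unlam_sp F) D a with
  Arr l b => fun x => sp1 fcid (mkArr (of_lst (fl l)) (did b)) x
| Atom o => fun x => match F0 D o x with end end).
exists (fun D a => match a return lam_sp0 (unlam_sp F) D a -> sp0 F D a with
  Arr l b => fun x => sp1 fcid (mkArr (to_lst (fl l)) (did b)) x
| Atom o => fun x : Empty_set => match x with end end).
split=> [D [o|l b] x|D [o|l b] x|D D' [o|l b]] //.
- by case: (F0 _ _ x).
- by rewrite sp1_comp mkArr_comp to_lstK fccomp_idl dcomp_idl mkArr_id sp1_id.
- by rewrite sp1_comp mkArr_comp of_lstK fccomp_idl dcomp_idl mkArr_id sp1_id.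
- by move=> a' d g x; case: (F0 _ _ x).
move=> a' d g; move: a' g; apply: mkArr_ind => l' b' s g x.
set y := sp1 fcid (mkArr (of_lst (fl l)) (did b)) x.
change (sp1 fcid (mkArr (of_lst (fl l')) (did b')) (sp1 d (mkArr s g) x) =
  lam_sp1 (P := unlam_sp F) d (mkArr s g) y).
rewrite lam_sp1E /= /unlam1 /arrX /y !sp1_comp !mkArr_comp /=.
rewrite fccomp_idl fccomp_idr dcomp_idl dcomp_idr; congr sp1; congr mkArr.
by rewrite !fcompA to_lstK fcomp_idr.
Qed.
End Abstraction.

(** * Uncurrying commutes with composition *)

Section Exponential.
Context (A : category) (c : fclass).
Local Notation dhm := (@dhom A c).
Local Notation dfam := (dfam A).
Local Notation did := (@did A c).
Local Notation fctx := (@fctx A).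
Local Notation fchom := (@fchom A c).
Local Notation fcid := (@fcid A c _ _).
Local Notation fid := (@fid A c).
Local Notation species := (@species A c).
Context (V W : finType) (F : species V) (R : V -> species W).

Definition lift_sp : option V -> species (option W) :=
  cons_sp (fun v => ren Some (R v)) (@var_sp A c (option W) None).

Definition empty_fam : dfam := Family (finite_prop False) (fun e : False => match e with end).

Definition to_empty (X : dfam) (dX : discardable c X) : famhom c X empty_fam.
Proof.
refine (@FamHom A c X empty_fam (fun e : False => match e with end) _).
by apply: in_class_by => Hc; [case|move=> i; case: (dX Hc i)].
Defined.

Lemma weaken_off (H : fctx W) : off_image c Some (fext H empty_fam).
Proof. by move=> [w|] n Hc //; case: (n w). Qed.

(** Arguments for the substitution under a binder: those of X, weakened by an empty last component,
    and one generic bound variable for each index of L. *)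
Definition lX (X : effam R) (L : dfam) : effam lift_sp := fun o =>
  match o with
  | Some v => @EFam A c (option W) (ren Some (R v)) (ei (X v)) (ei_fin (X v)) (@eb _ _ _ _ (X v))
      (fun i => fext (@eH _ _ _ _ (X v) i) empty_fam)
      (fun i => exist _ (@ew _ _ _ _ (X v) i) (@weaken_off (@eH _ _ _ _ (X v) i)))
  | None => @EFam A c (option W) (var_sp A c None) (fidx L) (ffin L) (@fob _ L)
      (fun i => sing None (fob i)) (fun i => fcid)
  end.

Section Up.
Context (D : fctx (option W)) (X : effam R) (h : fchom (ren_ctx Some D) (tot_ctx X)).
Local Notation L := (D None).
Local Notation Y := (lX X L).

Definition up_some w (p : fidx (tot_ctx Y (Some w))) :
    {z : fidx (D (Some w)) & dhm (fob z) (fob p)} :=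
  match p with
  | existT (existT (Some v) i) x =>
      h w (existT (fun q : {v : V & ei (X v)} => fidx (eH (projT2 q) w)) (existT _ v i) x)
  | existT (existT None i) e =>
      match (e : Some w = None) in _ = o
      return match o with Some _ => True | None => _ end with erefl => I end
  end.

Definition up_none (p : fidx (tot_ctx Y None)) :
    {z : fidx (D None) & dhm (fob z) (fob p)} :=
  match p with
  | existT (existT (Some v) i) x => match (x : False) with end
  | existT (existT None i) e => existT _ i (did (fob i))
  end.

Lemma up_some_in w : in_class c (fun p => projT1 (@up_some w p)).
Proof.
apply: in_class_by => Hc.
  move=> [[[v|] i] x] [[[v'|] i'] x'] //= /(in_class_inj Hc (fh_in (h w))) e.
  move: (f_equal (fun q : fidx (tot_ctx X w) =>
    existT (fun p => fidx (@eH _ _ _ _ (Y (projT1 p)) (projT2 p) (Some w)))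
      (existT (fun o => ei (Y o)) (Some (projT1 (projT1 q))) (projT2 (projT1 q))) (projT2 q)) e).
  by [].
move=> z; have [[[v i] x] <-] := in_class_surj Hc (fh_in (h w)) z.
by exists (existT (fun p => fidx (@eH _ _ _ _ (Y (projT1 p)) (projT2 p) (Some w)))
      (existT (fun o => ei (Y o)) (Some v) i) x).
Qed.

Lemma up_none_in : in_class c (fun p => projT1 (@up_none p)).
Proof.
apply: (@in_class_can c _ _ _ (fun i => 
   existT (fun p => fidx (@eH _ _ _ _ (Y (projT1 p)) (projT2 p) None))
      (existT (fun o => ei (Y o)) None i) (erefl None))) => //.
move=> [[[v|] i] x] /=; first by case: x.
change (None = None :> option W) in x.
by have -> : x = erefl := proof_irrelevance _ _ _.
Qed.

(** The total context of [lX X L] is that of X at the old variables and L at the new one, so h and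
    the identity of L make up the map. *)
Definition up_hom : fchom D (tot_ctx Y) := fun o =>
  match o with
  | Some w => @FamHom A c (D (Some w)) (tot_ctx Y (Some w)) (@up_some w) (@up_some_in w)
  | None => @FamHom A c (D None) (tot_ctx Y None) up_none up_none_in
  end.
End Up.

Section Down.
Context (Y : effam lift_sp).
Local Notation YS v := (Y (Some v) : efam (ren Some (R v))).
Local Notation YN := (Y None : efam (@var_sp A c (option W) None)).

Definition dX : effam R := fun v =>
  @EFam A c W (R v) (ei (YS v)) (ei_fin (YS v)) (@eb _ _ _ _ (YS v))
    (fun i => ren_ctx Some (@eH _ _ _ _ (YS v) i))
    (fun i => proj1_sig (@ew _ _ _ _ (YS v) i)).

Definition yvar (i : ei YN) : fchom (eH i) (sing None (eb i)) := @ew _ _ _ _ YN i.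

(** The arguments for the bound variable are dropped. Under surjectivity they have no index at
    [Some w], as such an index would come from a proof of Some w = None. *)
Lemma down_some_in w : in_class c (fun q : fidx (tot_ctx dX w) =>
  existT (fun p => fidx (@eH _ _ _ _ (Y (projT1 p)) (projT2 p) (Some w)))
      (existT (fun o => ei (Y o)) (Some (projT1 (projT1 q))) (projT2 (projT1 q))) (projT2 q)).
Proof.
apply: in_class_by => Hc.
  move=> [[v i] x] [[v' i'] x'] /= e.
  have e1 := f_equal (fun p => projT1 (projT1 p)) e; case: e1 => e1; subst v'.
  have e2 := inj_pair2 _ _ _ _ _ (f_equal (@projT1 _ _) e); subst i'.
  by have e3 := inj_pair2 _ _ _ _ _ e; rewrite /= in e3; subst x'.
move=> [[[v|] i] x].
  by exists (existT (fun q : {v : V & ei (dX v)} => fidx (eH (projT2 q) w))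
      (existT (fun v => ei (dX v)) v i) x).
by have [] := in_class_surj Hc (fh_in (yvar i (Some w))) x.
Qed.

Definition down_some : fchom (ren_ctx Some (tot_ctx Y)) (tot_ctx dX) := fun w =>
  @FamHom A c (tot_ctx Y (Some w)) (tot_ctx dX w) (fun q =>
    existT (fun p : fidx (tot_ctx Y (Some w)) => dhm (fob p) (fob (d := tot_ctx dX w) q))
    (existT (fun p => fidx (@eH _ _ _ _ (Y (projT1 p)) (projT2 p) (Some w)))
      (existT (fun o => ei (Y o)) (Some (projT1 (projT1 q))) (projT2 (projT1 q))) (projT2 q))
    (did _)) (down_some_in w).

(** Under surjectivity a weakened argument has no index at the new variable, by the side condition
    in [ren], and an argument for the bound variable has exactly the one it selects. *)
Lemma down_none_in : in_class c (fun i : ei YN =>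
  existT (fun p => fidx (@eH _ _ _ _ (Y (projT1 p)) (projT2 p) None))
      (existT (fun o => ei (Y o)) None i) (projT1 (yvar i None erefl))).
Proof.
apply: in_class_by => Hc.
  move=> i i' e; exact: (inj_pair2 _ _ _ _ _ (f_equal (@projT1 _ _) e)).
move=> [[[v|] i] x].
  by case: (proj2_sig (@ew _ _ _ _ (YS v) i) None _ Hc x).
exists i; have [e <-] := in_class_surj Hc (fh_in (yvar i None)) x.
by have -> : e = erefl :> (None = None :> option W) := proof_irrelevance _ _ _.
Qed.

Definition down_none : famhom c (tot_ctx Y None) (base_ctx Y None) :=
  @FamHom A c (tot_ctx Y None) (base_ctx Y None) (fun i =>
    existT (fun p : fidx (tot_ctx Y None) => dhm (fob p) (fob (d := base_ctx Y None) i))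
    (existT (fun p => fidx (@eH _ _ _ _ (Y (projT1 p)) (projT2 p) None))
      (existT (fun o => ei (Y o)) None i) (projT1 (yvar i None erefl)))
    (projT2 (yvar i None erefl))) down_none_in.
End Down.

Definition lphi0 (D : fctx (option W)) a (X : effam R)
    (f : sp0 F (base_ctx X) (Arr (lst c (D None)) a)) (h : fchom (ren_ctx Some D) (tot_ctx X)) :
    sp0 (Comp (unlam_sp F) lift_sp) D a :=
  gen (F := unlam_sp F) (X := lX X (D None)) f (up_hom h).

Definition lpsi0 D a (Y : effam lift_sp) (f : sp0 (unlam_sp F) (base_ctx Y) a)
    (h : fchom D (tot_ctx Y)) : sp0 (unlam_sp (Comp F R)) D a :=
  gen (F := F) (X := dX Y)
    (sp1 (s := F) fcid (arrX (fcomp (h None) (down_none Y)) (did a)) f)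
    (fccomp (ren_hom Some h) (down_some Y)).

Lemma lX_stepE (X X' : effam R) (st : estep X X') (L : dfam) o j :
  sp1 (s := lift_sp o) fcid (match o return forall j : ei (lX X' L o),
      dhm (@eb _ _ _ _ (lX X L o) (match o return ei (lX X' L o) -> ei (lX X L o) with
        Some v => @st_al _ _ _ _ _ _ _ st v | None => id end j)) (@eb _ _ _ _ (lX X' L o) j) with
        Some v => @st_m _ _ _ _ _ _ _ st v | None => fun i => did _ end j) (ew _) =
  sp1 (s := lift_sp o) (match o return forall j : ei (lX X' L o),
      fchom (@eH _ _ _ _ (lX X L o) (match o return ei (lX X' L o) -> ei (lX X L o) with
        Some v => @st_al _ _ _ _ _ _ _ st v | None => id end j)) (@eH _ _ _ _ (lX X' L o) j) with
        Some v => fun i => fext_hom (st_k st i) (fid empty_fam) | None => fun i => fcid end j) (did _) (ew j).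
Proof.
case: o j => [v|] j //=; apply: ren0_eq => /=.
have E := st_E st j; rewrite -E; congr sp1.
Qed.

Definition lX_step (X X' : effam R) (st : estep X X') (L : dfam) : estep (lX X L) (lX X' L).
Proof.
refine (@EStep A c (option V) (option W) lift_sp (lX X L) (lX X' L)
  (fun o => match o return ei (lX X' L o) -> ei (lX X L o) with
        Some v => @st_al _ _ _ _ _ _ _ st v | None => id end) _ _ _ (@lX_stepE X X' st L)).
by case=> [v|]; [exact: (st_in st v)|apply: in_class_id].
Defined.

Lemma lphi0_step (D : fctx (option W)) a X X' (st : estep X X')
    (f : sp0 F (base_ctx X') (Arr (lst c (D None)) a)) (h : fchom (ren_ctx Some D) (tot_ctx X)) :
  lphi0 (sp1 (step_base st) (did _) f) h = lphi0 f (fccomp h (step_total st)).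
Proof.
apply: (gen_step (st := lX_step st (D None))).
  rewrite /= /unlam1; congr (sp1 _ _ _) => //.
  have -> : step_base (lX_step st (D None)) None = fid _ by apply: famhom_eq.
  by rewrite arrX_id.
apply: fchom_eq => -[w|] [[[v|] i] x] //=.
by rewrite dcomp_idl.
Qed.

Definition lphi D a : sp0 (unlam_sp (Comp F R)) D a -> sp0 (Comp (unlam_sp F) lift_sp) D a :=
  sub_lift (F := F) (Q := R) (fun X f h => lphi0 f h).

Lemma lphiE (D : fctx (option W)) a (X : effam R)
    (f : sp0 F (base_ctx X) (Arr (lst c (D None)) a)) (h : fchom (ren_ctx Some D) (tot_ctx X)) :
  lphi (gen f h) = lphi0 f h.
Proof. by rewrite /lphi sub_liftE // => *; apply: lphi0_step. Qed.

Definition dX_step (Y Y' : effam lift_sp) (st : estep Y Y') : estep (dX Y) (dX Y').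
Proof.
refine (@EStep A c V W R (dX Y) (dX Y') (fun v => @st_al _ _ _ _ _ _ _ st (Some v))
  (fun v => st_in st (Some v)) (fun v => @st_m _ _ _ _ _ _ _ st (Some v))
  (fun v j => ren_hom Some (@st_k _ _ _ _ _ _ _ st (Some v) j)) _).
by move=> v j; have /(f_equal (@proj1_sig _ _)) := @st_E _ _ _ _ _ _ _ st (Some v) j.
Defined.

Lemma down_none_step (Y Y' : effam lift_sp) (st : estep Y Y') :
  fcomp (down_none Y) (step_base st None) = fcomp (step_total st None) (down_none Y').
Proof.
apply: famhom_eq => j.
have := @st_E _ _ _ _ _ _ _ st None j.
rewrite /= /var1 fccomp_idl sing_hom_id fccomp_idr => E.
have {E} := f_equal (fun s : fchom _ (sing None _) => s None erefl) E.
by move=> /(f_equal (fun p => existT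
   (fun q : fidx (tot_ctx Y None) => dhm (fob q) (fob (d := base_ctx Y' None) j))
   (existT (fun p => fidx (@eH _ _ _ _ (Y (projT1 p)) (projT2 p) None))
      (existT (fun o => ei (Y o)) None (st_al st j)) (projT1 p)) (projT2 p))) /= ->.
Qed.

Lemma lpsi0_step D a (Y Y' : effam lift_sp) (st : estep Y Y')
    (f : sp0 (unlam_sp F) (base_ctx Y') a) (h : fchom D (tot_ctx Y)) :
  lpsi0 (sp1 (step_base st) (did a) f) h = lpsi0 f (fccomp h (step_total st)).
Proof.
apply: (gen_step (st := dX_step st)).
  rewrite /= /unlam1 !sp1_comp !fccomp_idl fccomp_idr arrX_comp dcomp_idl dcomp_idr.
  congr sp1; congr arrX.
  by rewrite /fccomp !fcompA down_none_step.
apply: fchom_eq => w [[v i] x] /=.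
by rewrite !(dcomp_idl, dcomp_idr).
Qed.

Definition lpsi D a : sp0 (Comp (unlam_sp F) lift_sp) D a -> sp0 (unlam_sp (Comp F R)) D a :=
  sub_lift (F := unlam_sp F) (Q := lift_sp) (fun X f h => lpsi0 f h).

Lemma lpsiE D a (Y : effam lift_sp) (f : sp0 (unlam_sp F) (base_ctx Y) a) (h : fchom D (tot_ctx Y)) :
  lpsi (gen f h) = lpsi0 f h.
Proof. by rewrite /lpsi sub_liftE // => *; apply: lpsi0_step. Qed.

Lemma lphiK D a (x : sp0 (unlam_sp (Comp F R)) D a) : lpsi (lphi x) = x.
Proof.
elim/gen_ind: x => X f h; rewrite lphiE /lphi0 lpsiE /lpsi0.
have -> : fcomp (up_hom h None) (down_none (lX X (D None))) = fid _.
  by apply: famhom_eq => i /=; rewrite dcomp_idl.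
rewrite arrX_id sp1_id; congr gen.
by apply: fchom_eq => w [[v i] x] /=; rewrite dcomp_idr; case: (h _ _).
Qed.

Section Relabel.
Context (X : effam R) (L L' : dfam) (k : famhom c L L').

Definition relabel_al o : ei (lX X L' o) -> ei (lX X L o) :=
  match o return ei (lX X L' o) -> ei (lX X L o) with
  | Some v => id | None => fun j => projT1 (k j) end.

Definition relabel_m o : forall j : ei (lX X L' o), dhm (@eb _ _ _ _ (lX X L o) (relabel_al j)) (eb j) :=
  match o return forall j : ei (lX X L' o), dhm (@eb _ _ _ _ (lX X L o) (relabel_al j)) (eb j) with
  | Some v => fun j => did _ | None => fun j => projT2 (k j) end.

Definition relabel_k o : forall j : ei (lX X L' o), fchom (@eH _ _ _ _ (lX X L o) (relabel_al j)) (eH j) :=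
  match o return forall j : ei (lX X L' o), fchom (@eH _ _ _ _ (lX X L o) (relabel_al j)) (eH j) with
  | Some v => fun j => fcid | None => fun j => sing_hom None (projT2 (k j)) end.

Definition relabel_step : estep (lX X L) (lX X L').
Proof.
refine (@EStep A c (option V) (option W) lift_sp (lX X L) (lX X L') relabel_al _ relabel_m relabel_k _).
  by case=> [v|]; [apply: in_class_id|apply: (fh_in k)].
case=> [v|] j //=.
by rewrite /var1 !fccomp_idl sing_hom_id !fccomp_idr.
Defined.

Lemma relabel_base a (f : unlam0 F (base_ctx (lX X L')) a) :
  sp1 (s := unlam_sp F) (step_base relabel_step) (did a) f = sp1 (s := F) fcid (arrX k (did a)) f.
Proof.
by rewrite /= /unlam1; congr (sp1 _ (arrX _ _) _); apply: famhom_eq => j /=; case: (k j).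
Qed.
End Relabel.

Section DownUp.
Context (Y : effam lift_sp).
Local Notation Y0 := (lX (dX Y) (base_ctx Y None)).

Definition norm_al (o : option V) : ei (Y0 o) -> ei (Y o) :=
  match o return ei (Y0 o) -> ei (Y o) with Some v => id | None => id end.

Definition norm_m o : forall j : ei (Y0 o), dhm (@eb _ _ _ _ (Y o) (norm_al j)) (eb j) :=
  match o return forall j : ei (Y0 o), dhm (@eb _ _ _ _ (Y o) (norm_al j)) (eb j) with
  | Some v => fun j => did _ | None => fun j => did _ end.

Lemma weaken_none v (i : ei (Y (Some v))) : discardable c (@eH _ _ _ _ (Y (Some v)) i None).
Proof. exact: (proj2_sig (@ew _ _ _ _ (Y (Some v)) i)). Qed.

Definition norm_k o : forall j : ei (Y0 o), fchom (@eH _ _ _ _ (Y o) (norm_al j)) (eH j) :=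
  match o return forall j : ei (Y0 o), fchom (@eH _ _ _ _ (Y o) (norm_al j)) (eH j) with
  | Some v => fun j o => match o with
      | Some w => fid _
      | None => to_empty (@weaken_none v j) end
  | None => fun j => @yvar Y j end.

(** Brings an arbitrary family to the form [lX]: the discardable last component of a weakened
    argument becomes the empty family, and each bound variable becomes generic. *)
Definition norm_step : estep Y Y0.
Proof.
refine (@EStep A c (option V) (option W) lift_sp Y Y0 norm_al _ norm_m norm_k _).
  by case=> [v|]; apply: in_class_id.
case=> [v|] j /=; first by apply: ren0_eq => /=; congr sp1.
by rewrite /yvar /var1 !fccomp_idl sing_hom_id !fccomp_idr.
Defined.

End DownUp.

Lemma lpsiK D a (x : sp0 (Comp (unlam_sp F) lift_sp) D a) : lphi (lpsi x) = x.
Proof.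
elim/gen_ind: x => Y f h; rewrite lpsiE /lpsi0 lphiE /lphi0.
pose k := fcomp (h None) (down_none Y).
(* The meeting point has the generic bound variables over the bases of Y. [relabel_step] reaches it
   from the round trip and [norm_step] from Y. *)
transitivity (gen (F := unlam_sp F) (X := lX (dX Y) (base_ctx Y None)) f
   (fccomp h (step_total (norm_step Y)))).
  apply: (gen_step (st := relabel_step (dX Y) k)); first by rewrite relabel_base.
  apply: fchom_eq => -[w|] [[[v|] i] x] //=; try by case: x.
  - by rewrite !(dcomp_idl, dcomp_idr).
  - change (None = None :> option W) in x.
    have -> : x = erefl := proof_irrelevance _ _ _.
    by rewrite /= dcomp_idl.
apply/esym/(gen_step (st := norm_step Y)) => //.
by rewrite -[LHS]sp1_id; congr sp1.
Qed.

Lemma unlam_Comp : sp_iso (unlam_sp (Comp F R)) (Comp (unlam_sp F) lift_sp).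
Proof.
exists lphi, lpsi; split=> [D a x|D a x|D D' a a' d g x].
- exact: lphiK.
- exact: lpsiK.
elim/gen_ind: x => X f h.
rewrite [sp1 d g _]CompE !lphiE CompE.
apply: (gen_step (st := relabel_step X (d None))).
  rewrite relabel_base; apply/esym.
  by rewrite /= /unlam1 sp1_comp fccomp_idl arrX_comp fcomp_idr dcomp_idr.
apply: fchom_eq => -[w|] [[[v|] i] x] //=; try by case: x.
  by rewrite dcomp_idr.
by rewrite !dcomp_idl dcomp_idr; case: (d _ _).
Qed.
End Exponential.

(** * Substitution and beta on species *)

Section Soundness.
Context (A : category) (c : fclass).
Local Notation species := (@species A c).

(* By the Yoneda lemma, composing with the variables on V accounts for the context G_0 of the
   function part in the coend formula for an application. *)
Definition app_sp (V : finType) (P Q : species V) : species V :=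
  Comp (unlam_sp P) (cons_sp (@var_sp A c V) Q).

Lemma app_iso (V : finType) (P P' Q Q' : species V) :
  sp_iso P P' -> sp_iso Q Q' -> sp_iso (app_sp P Q) (app_sp P' Q').
Proof.
move=> HP HQ; apply: Comp_iso; first exact: unlam_iso.
by case=> [v|] //; apply: sp_iso_refl.
Qed.

(** Both sides are the composite of [unlam_sp P] with [cons_sp R (Comp Q R)]. The left is so by
    associativity; on the right [unlam_Comp] produces [lift_sp R], whose weakening is undone by the
    substitution of the argument. *)
Lemma Comp_app (V W : finType) (P Q : species V) (R : V -> species W) :
  sp_iso (Comp (app_sp P Q) R) (app_sp (Comp P R) (Comp Q R)).
Proof.
apply: (@sp_iso_trans _ _ _ _ (Comp (unlam_sp P) (cons_sp R (Comp Q R)))).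
  apply: sp_iso_trans (Comp_assoc _ _ _) _.
  apply: Comp_iso; first exact: sp_iso_refl.
  by case=> [v|]; [apply: Comp_var|apply: sp_iso_refl].
apply: sp_iso_sym.
apply: (@sp_iso_trans _ _ _ _ (Comp (Comp (unlam_sp P) (lift_sp R)) (cons_sp (@var_sp A c W) (Comp Q R)))).
  apply: Comp_iso; first exact: unlam_Comp.
  by move=> o; apply: sp_iso_refl.
apply: sp_iso_trans (Comp_assoc _ _ _) _.
apply: Comp_iso; first exact: sp_iso_refl.
case=> [v|]; last exact: (@Comp_var A c (option W) W _ None).
exact: sp_iso_trans (Comp_ren_cons _ _ _) (Comp_var_id _).
Qed.

Lemma Comp_lam (V W : finType) (P : species (option V)) (R : V -> species W) :
  sp_iso (Comp (lam_sp P) R) (lam_sp (Comp P (lift_sp R))).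
Proof.
apply: sp_iso_trans (lam_unlam_iso _) (lam_iso _).
  (* A composite with an abstraction as head has no element at an atom, so it may be recovered from
     its uncurried form. *)
  by move=> D o x; elim/gen_ind: x => X [].
apply: sp_iso_trans (unlam_Comp _ _) _.
apply: Comp_iso; first exact: unlam_lam_iso.
by move=> o; apply: sp_iso_refl.
Qed.

Definition opt_sp (V W : finType) (R : V -> species W) (o : option V) : species W :=
  match o with Some v => R v | None => empty_sp A c W end.

Definition env_lift (V : Type) (env : nat -> option V) (k : nat) : option (option V) :=
  match k with 0 => Some None | k'.+1 => omap Some (env k') end.

Fixpoint den_sp (t : term) (V : finType) (env : nat -> option V) : species V :=
  match t with
  | Var k => opt_sp (@var_sp A c V) (env k)
  | Lam t1 => lam_sp (@den_sp t1 (option V) (env_lift env))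
  | App t1 t2 => app_sp (den_sp t1 env) (den_sp t2 env)
  end.

Lemma ren_var (V : finType) (v : V) : sp_iso (ren Some (var_sp A c v)) (var_sp A c (Some v)).
Proof.
apply: (@sp_iso_trans _ _ _ _ (Comp (var_sp A c v) (fun v => var_sp A c (Some v)))).
  by apply: sp_iso_sym; apply: Comp_ren => v1 v2 [].
exact: (Comp_var (fun v => var_sp A c (Some v))).
Qed.

Lemma Comp_opt (V W : finType) (R : V -> species W) (o : option V) :
  sp_iso (Comp (opt_sp (@var_sp A c V) o) R) (opt_sp R o).
Proof. by case: o => [v|]; [apply: Comp_var|apply: Comp_empty]. Qed.

Lemma den_rename t (V W : finType) (r : V -> W) (env : nat -> option V) :
  sp_iso (Comp (den_sp t env) (fun v => var_sp A c (r v))) (den_sp t (fun k => omap r (env k))).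
Proof.
elim: t V W r env => [k|t IH|t1 IH1 t2 IH2] V W r env /=.
- by apply: sp_iso_trans (Comp_opt _ _) _; case: (env k) => [v|]; apply: sp_iso_refl.
- apply: sp_iso_trans (Comp_lam _ _) (lam_iso _).
  have -> : env_lift (fun k => omap r (env k)) = (fun k => omap (omap r) (env_lift env k)).
    by apply: functional_extensionality => -[|k] //=; case: (env k).
  apply: sp_iso_trans (IH (option V) (option W) (omap r) (env_lift env)).
  apply: Comp_iso; first exact: sp_iso_refl.
  by case=> [v|] /=; [apply: ren_var|apply: sp_iso_refl].
- exact: sp_iso_trans (Comp_app _ _ _) (app_iso (IH1 _ _ _ _) (IH2 _ _ _ _)).
Qed.

Lemma ren_den t (V : finType) (env : nat -> option V) :
  sp_iso (ren Some (den_sp t env)) (@den_sp t (option V) (fun k => omap Some (env k))).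
Proof.
apply: sp_iso_trans (den_rename t (W := option V) Some env).
by apply: sp_iso_sym; apply: Comp_ren => v1 v2 [].
Qed.

(** An equality and not just an isomorphism, because the shift of indices is absorbed by the
    environment. *)
Lemma den_lift t d k (V : finType) (env : nat -> option V) :
  den_sp (tlift d k t) env = den_sp t (fun m => env (if k <= m then m + d else m)).
Proof.
elim: t k V env => [m|t IH|t1 IH1 t2 IH2] k V env /=.
- by case: ifP.
- rewrite IH; congr (lam_sp (den_sp _ _)).
  by apply: functional_extensionality => -[|m] //=; rewrite ltnS; case: ifP.
- by rewrite IH1 IH2.
Qed.

(** R and the environments are tied together only through the variables, in the form that [tsubst]
    gives them. This passes under a binder, where R becomes [lift_sp R] and k becomes k + 1. *)
Lemma den_subst t u (V W : finType) (env : nat -> option V) (env' : nat -> option W)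
    (R : V -> species W) k :
  (forall m, sp_iso (opt_sp R (env m)) (den_sp (tsubst (Var m) k u) env')) ->
  sp_iso (Comp (den_sp t env) R) (den_sp (tsubst t k u) env').
Proof.
elim: t V W env env' R k => [m|t IH|t1 IH1 t2 IH2] V W env env' R k H.
- exact: sp_iso_trans (Comp_opt _ _) (H m).
- apply: sp_iso_trans (Comp_lam _ _) (lam_iso _).
  apply: (IH (option V) (option W)) => -[|m] /=; first exact: sp_iso_refl.
  have -> : opt_sp (lift_sp R) (omap Some (env m)) =
      match env m with Some v => ren Some (R v) | None => empty_sp A c (option W) end.
    by case: (env m).
  apply: (@sp_iso_trans _ _ _ _ (ren Some (opt_sp R (env m)))).
    case: (env m) => [v|]; first exact: sp_iso_refl.
    exists (fun _ _ (x : Empty_set) => match x with end).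
    exists (fun D a (x : ren0 Some (empty_sp A c W) D a) => match proj1_sig x : Empty_set with end).
    by split=> [D a []|D a [[]]|D D' a a' d g []].
  apply: sp_iso_trans (ren_iso _ (H m)) _.
  apply: sp_iso_trans (ren_den _ _) _.
  (* For m other than k both sides are one variable renamed along [Some]. For m = k the extra
     lifting of u amounts to a shift of the environment. *)
  rewrite [tsubst _ _ _]/= ltnS eqSS; case: ltngtP => [lt|gt|eq].
  + exact: sp_iso_refl.
  + case: m gt {H} => // m _; exact: sp_iso_refl.
  + rewrite !den_lift /=; subst m.
    have -> : (fun m => env_lift env' (m + k.+1)) = (fun m => omap Some (env' (m + k))).
      by apply: functional_extensionality => m; rewrite addnS.
    exact: sp_iso_refl.
- exact: sp_iso_trans (Comp_app _ _ _) (app_iso (IH1 _ _ _ _ _ _ H) (IH2 _ _ _ _ _ _ H)).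
Qed.

Lemma den_beta M N : beta M N -> forall (V : finType) (env : nat -> option V),
  sp_iso (den_sp M env) (den_sp N env).
Proof.
elim=> [t u|t t' _ IH|t t' u _ IH|t u u' _ IH] V env.
- apply: (@sp_iso_trans _ _ _ _ (Comp (@den_sp t (option V) (env_lift env))
    (cons_sp (@var_sp A c V) (den_sp u env)))).
    by apply: Comp_iso; [apply: unlam_lam_iso|move=> o; apply: sp_iso_refl].
  apply: (@den_subst t u (option V) V) => -[|m].
    rewrite [tsubst _ _ _]/= den_lift /=.
    have -> : (fun m => env (m + 0)) = env by apply: functional_extensionality => m; rewrite addn0.
    exact: sp_iso_refl.
  by rewrite /=; case: (env m) => [v|]; apply: sp_iso_refl.
- exact: lam_iso (IH _ _).
- exact: app_iso (IH _ _) (sp_iso_refl _).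
- exact: app_iso (sp_iso_refl _) (IH _ _).
Qed.
End Soundness.

(** * From lists to families *)

Section Transfer.
Context (A : category) (c : fclass).
Local Notation dobj := (dobj A).
Local Notation dhm := (@dhom A c).
Local Notation shom := (@shom A c).
Local Notation ctx := (@ctx A).
Local Notation chom := (@chom A c).
Local Notation cidc := (@cidc A c _).
Local Notation psh := (@psh A c).
Local Notation did := (@did A c).
Local Notation fctx := (@fctx A).
Local Notation fchom := (@fchom A c).
Local Notation fcid := (@fcid A c _ _).
Local Notation fid := (@fid A c).
Local Notation species := (@species A c).

Definition ush (x y : seq dobj) (s : shom x y) : famhom c (fl x) (fl y) :=
  @FamHom A c (fl x) (fl y)
    (fun i => existT (fun j : fidx (fl x) => dhm (fob j) (fob (d := fl y) i)) (sfun s i) (scmp s i))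
    (sinC s).

Definition ush_inv (x y : seq dobj) (s : famhom c (fl x) (fl y)) : shom x y :=
  @SHom A c x y (fun i => projT1 (s i)) (fh_in s) (fun i => projT2 (s i)).

Lemma ushK x y : cancel (@ush x y) (@ush_inv x y).
Proof. by case. Qed.

Lemma ush_invK x y : cancel (@ush_inv x y) (@ush x y).
Proof. by move=> s; apply: famhom_eq => i /=; case: (s i). Qed.

Lemma ush_id x : ush (sid c x) = fid (fl x).
Proof. exact: famhom_eq. Qed.

Lemma ush_comp x y z (s : shom x y) (t : shom y z) : ush (scomp s t) = fcomp (ush s) (ush t).
Proof. exact: famhom_eq. Qed.

Section Contexts.
Context (n : nat) (V : finType) (b : V -> 'I_n) (b' : 'I_n -> V).
Context (K : cancel b b') (K' : cancel b' b).

(** The variables correspond by a bijection b and are not fixed to be ['I_n]: a binder adds [None]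
    to V but [ord_max] to the ordinal. *)
Definition uctx (D : ctx n) : fctx V := fun v => fl (D (b v)).
Definition uhom (D D' : ctx n) (d : chom D D') : fchom (uctx D) (uctx D') := fun v => ush (d (b v)).

Lemma uhom_id D : uhom (cidc D) = fcid.
Proof. by apply: functional_extensionality_dep => v; apply: ush_id. Qed.

Lemma uhom_comp (D D' D'' : ctx n) (d : chom D D') (d' : chom D' D'') :
  uhom (ccompc d d') = fccomp (uhom d) (uhom d').
Proof. by apply: functional_extensionality_dep => v; apply: ush_comp. Qed.

Definition uhom_inv (D D' : ctx n) (s : fchom (uctx D) (uctx D')) : chom D D' := fun i =>
  match K' i in _ = j return shom (D j) (D' j) with erefl => ush_inv (s (b' i)) end.

Lemma uhom_invK D D' : cancel (@uhom_inv D D') (@uhom D D').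
Proof.
move=> s; apply: functional_extensionality_dep => v; rewrite /uhom /uhom_inv.
have e := K v; move: (K' (b v)); rewrite e => e'.
by rewrite (proof_irrelevance _ e' erefl) ush_invK.
Qed.

Lemma uhom_inj D D' : injective (@uhom D D').
Proof.
move=> d d' e; apply: functional_extensionality_dep => i; rewrite -(K' i).
apply: (can_inj (@ushK _ _)).
exact: (f_equal (fun s : fchom (uctx D) (uctx D') => s (b' i)) e).
Qed.

Lemma uhomK D D' : cancel (@uhom D D') (@uhom_inv D D').
Proof. by move=> d; apply: uhom_inj; rewrite uhom_invK. Qed.

(** Every family context is isomorphic to a list context, by [lto] and [lfrom]: essential
    surjectivity of the inclusion. *)
Definition lctx (G : fctx V) : ctx n := fun i => lst c (G (b' i)).

Definition lto (G : fctx V) : fchom (uctx (lctx G)) G := fun v =>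
  match K v in _ = v' return famhom c (fl (lctx G (b v))) (G v') with
  | erefl => of_lst _ _ end.

Definition lfrom (G : fctx V) : fchom G (uctx (lctx G)) := fun v =>
  match K v in _ = v' return famhom c (G v') (fl (lctx G (b v))) with
  | erefl => to_lst _ _ end.

Lemma lfromK G : fccomp (lfrom G) (lto G) = fcid.
Proof.
apply: functional_extensionality_dep => v; rewrite /fccomp /lto /lfrom.
suff H v' (e : b' (b v) = v') :
  fcomp match e in _ = v' return famhom c (G v') (fl (lctx G (b v))) with erefl => to_lst _ _ end
        match e in _ = v' return famhom c (fl (lctx G (b v))) (G v') with erefl => of_lst _ _ end
  = fid (G v') by apply: H.
by case: _ / e; apply: to_lstK.
Qed.

(** P is the restriction of F along the inclusion of list contexts, up to natural isomorphism. *)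
Definition represents (P : psh n) (F : species V) : Prop :=
  exists (phi : forall D a, F0 P D a -> sp0 F (uctx D) a)
         (psi : forall D a, sp0 F (uctx D) a -> F0 P D a),
    [/\ forall D a x, psi D a (phi D a x) = x,
        forall D a y, phi D a (psi D a y) = y &
        forall D D' a a' (d : chom D' D) (g : dhm a a') x,
          phi D' a' (F1 d g x) = sp1 (uhom d) g (phi D a x)].

Section Single.
Context (P : Prop) (bb : bool) (HP : P -> bb) (HP' : bb -> P) (a : dobj).
Local Notation X := (fl (if bb then [:: a] else [::])).
Local Notation Y := (Family (finite_prop P) (fun _ : P => a)).

(** [single] decides equality of variables by a boolean, while [sing] takes the proofs of equality
    as indices. This section matches the two for any boolean that reflects P. *)
Definition single_idx (p : fidx Y) : fidx X.
Proof. by move: (HP p); case: bb => // _; exact: (ord0 : 'I_1). Defined.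

Definition single_pf (i : fidx X) : fidx Y.
Proof. by move: i HP'; case: bb => [_|[]//]; apply. Defined.

Lemma single_fob p : fob (single_idx p) = fob p.
Proof. by rewrite /single_idx; move: (HP p); case: bb => //. Qed.

Lemma single_idxK : cancel single_idx single_pf.
Proof. by move=> p; exact: (proof_irrelevance P). Qed.

Lemma single_pfK : cancel single_pf single_idx.
Proof.
move=> i; rewrite /single_idx; move: (HP _) => h; move: i h.
case: bb => [i h|[]//]; exact/esym/ord1.
Qed.
End Single.

Lemma single_nat (P : Prop) (bb : bool) (HP : P -> bb) (HP' : bb -> P) a a' (g : dhm a a') :
  fcomp (ush (match bb as b0 return
             shom (if b0 then [:: a] else [::]) (if b0 then [:: a'] else [::]) with
           | true => Defs.sing_hom g
           | false => sid c [::]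
           end)) (fam_to c (single_idxK HP HP' (a := a')) (single_pfK HP HP' (a := a'))
        (single_fob HP (a := a'))) =
  fcomp (fam_to c (single_idxK HP HP' (a := a)) (single_pfK HP HP' (a := a)) (single_fob HP (a := a)))
    (@FamHom A c (Family (finite_prop P) (fun _ : P => a)) (Family (finite_prop P) (fun _ : P => a'))
       (fun p => existT (fun _ : P => dhm a a') p g) (in_class_id c P)).
Proof.
apply: famhom_eq => p /=; move: (@single_fob P bb HP a p) (@single_fob P bb HP a' p); rewrite /single_idx.
move: (HP p); case: bb {HP HP'} => // h e e' /=.
by rewrite !eqh_refl dcomp_idl dcomp_idr.
Qed.

Section Var.
Context (v : V).

Let HP w : w = v -> b w == b v. Proof. by move=> ->. Qed.
Let HP' w : b w == b v -> w = v. Proof. by move=> /eqP /(can_inj K). Qed.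

Definition sing_to a : fchom (uctx (single (b v) a)) (sing v a) := fun w =>
  fam_to c (single_idxK (@HP w) (@HP' w) (a := a)) (single_pfK (@HP w) (@HP' w) (a := a))
    (single_fob (@HP w) (a := a)).
Definition sing_from a : fchom (sing v a) (uctx (single (b v) a)) := fun w =>
  fam_from c (single_idxK (@HP w) (@HP' w) (a := a)) (single_pfK (@HP w) (@HP' w) (a := a))
    (single_fob (@HP w) (a := a)).

Lemma sing_toK a : fccomp (sing_to a) (sing_from a) = fcid.
Proof. by apply: functional_extensionality_dep => w; apply: fam_toK. Qed.
Lemma sing_fromK a : fccomp (sing_from a) (sing_to a) = fcid.
Proof. by apply: functional_extensionality_dep => w; apply: fam_fromK. Qed.

Lemma sing_to_nat a a' (g : dhm a a') :
  fccomp (uhom (single_hom (b v) g)) (sing_to a') = fccomp (sing_to a) (sing_hom v g).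
Proof. by apply: functional_extensionality_dep => w; apply: single_nat. Qed.

Lemma represents_var : represents (den_var A c (Some (b v))) (var_sp A c v).
Proof.
exists (fun D a (h : chom D (single (b v) a)) => fccomp (uhom h) (sing_to a)).
exists (fun D a (h : fchom (uctx D) (sing v a)) => uhom_inv (fccomp h (sing_from a))).
split=> [D a x|D a y|D D' a a' d g x].
- by rewrite fccompA sing_toK fccomp_idr uhomK.
- by rewrite uhom_invK fccompA sing_fromK fccomp_idr.
by rewrite /= /var1 !uhom_comp !fccompA sing_to_nat.
Qed.
End Var.
End Contexts.

Lemma represents_none n (V : finType) (b : V -> 'I_n) : represents b (den_var A c None) (empty_sp A c V).
Proof.
exists (fun _ _ (x : Empty_set) => match x with end).
exists (fun _ _ (x : Empty_set) => match x with end).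
by split=> [D a []|D a []|D D' a a' d g []].
Qed.

Section Lam.
Context (n : nat) (V : finType) (b : V -> 'I_n) (b' : 'I_n -> V).
Context (K : cancel b b') (K' : cancel b' b).

Definition blift (o : option V) : 'I_n.+1 :=
  match o with Some v => widen_ord (leqnSn n) (b v) | None => ord_max end.
Definition bunlift (i : 'I_n.+1) : option V := omap b' (unlift ord_max i).

Lemma widen_lift (i : 'I_n) : widen_ord (leqnSn n) i = lift ord_max i.
Proof. by apply: ord_inj; rewrite lift_max. Qed.

Lemma unlift_blift o : unlift ord_max (blift o) = omap b o.
Proof. by case: o => [v|] /=; rewrite ?unlift_none // widen_lift liftK. Qed.

Lemma bliftK : cancel blift bunlift.
Proof. by move=> o; rewrite /bunlift unlift_blift; case: o => [v|] //=; rewrite K. Qed.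

Lemma bunliftK : cancel bunlift blift.
Proof.
move=> i; rewrite /bunlift; case: unliftP => [j|] -> //=.
by rewrite K' widen_lift.
Qed.

Definition seq_iso (x y : seq dobj) (e : x = y) : famhom c (fl x) (fl y) :=
  match e in _ = z return famhom c (fl x) (fl z) with erefl => fid (fl x) end.

Lemma seq_isoK x y (e : x = y) (e' : y = x) : fcomp (seq_iso e) (seq_iso e') = fid (fl x).
Proof. by subst y; rewrite (proof_irrelevance _ e' erefl) fcomp_idl. Qed.

(** The value of [unlift] is generalised to u, so that equations about [ext] are obtained by
    substitution rather than by rewriting inside dependent matches. *)
Definition ext_match (D : ctx n) l (u : option 'I_n) :=
  match u with Some j => D j | None => l end.
Lemma ext_at (D : ctx n) l i u (E : unlift ord_max i = u) : ext D l i = ext_match D l u.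
Proof. by rewrite /ext E. Qed.

Lemma cext_at (D D' : ctx n) l l' (d : chom D D') (s : shom l l') i u (E : unlift ord_max i = u) :
  fcomp (ush (cext d s i)) (seq_iso (ext_at D' l' E)) =
  fcomp (seq_iso (ext_at D l E))
    (match u return famhom c (fl (ext_match D l u)) (fl (ext_match D' l' u)) with
     | Some j => ush (d j) | None => ush s end).
Proof.
subst u; rewrite (proof_irrelevance _ (ext_at D l _) erefl) (proof_irrelevance _ (ext_at D' l' _) erefl).
rewrite /= fcomp_idl fcomp_idr /cext /ext.
by case: (unlift ord_max i).
Qed.

Definition ext_to (D : ctx n) l : fchom (uctx blift (ext D l)) (fext (uctx b D) (fl l)) := fun o =>
  match o return famhom c (uctx blift (ext D l) o) (fext (uctx b D) (fl l) o) with
  | Some v => seq_iso (ext_at D l (unlift_blift (Some v)))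
  | None => seq_iso (ext_at D l (unlift_blift None)) end.

Definition ext_from (D : ctx n) l : fchom (fext (uctx b D) (fl l)) (uctx blift (ext D l)) := fun o =>
  match o return famhom c (fext (uctx b D) (fl l) o) (uctx blift (ext D l) o) with
  | Some v => seq_iso (esym (ext_at D l (unlift_blift (Some v))))
  | None => seq_iso (esym (ext_at D l (unlift_blift None))) end.

Lemma ext_toK D l : fccomp (ext_to D l) (ext_from D l) = fcid.
Proof. by apply: functional_extensionality_dep => -[v|]; apply: seq_isoK. Qed.
Lemma ext_fromK D l : fccomp (ext_from D l) (ext_to D l) = fcid.
Proof. by apply: functional_extensionality_dep => -[v|]; apply: seq_isoK. Qed.

Lemma ext_to_nat D D' l l' (d : chom D D') (s : shom l l') :
  fccomp (uhom blift (cext d s)) (ext_to D' l') =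
  fccomp (ext_to D l) (fext_hom (uhom b d) (ush s)).
Proof. apply: functional_extensionality_dep => -[v|].
  exact: (cext_at d s (unlift_blift (Some v))).
exact: (cext_at d s (unlift_blift None)). Qed.

Lemma ext_from_nat D D' l l' (d : chom D D') (s : shom l l') :
  fccomp (ext_from D l) (uhom blift (cext d s)) =
  fccomp (fext_hom (uhom b d) (ush s)) (ext_from D' l').
Proof.
rewrite -[LHS]fccomp_idr -(ext_toK D' l') -fccompA; congr fccomp.
by rewrite fccompA ext_to_nat -fccompA ext_fromK fccomp_idl.
Qed.

Lemma represents_lam (P : psh n.+1) (F : species (option V)) :
  represents blift P F -> represents b (den_lam P) (lam_sp F).
Proof.
move=> [phi [psi [H H' N]]].
exists (fun D a => match a return lam0 P D a -> lam_sp0 F (uctx b D) a with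
  | Atom _ => id | Arr l a' => fun x => sp1 (ext_from D l) (did a') (phi _ _ x) end).
exists (fun D a => match a return lam_sp0 F (uctx b D) a -> lam0 P D a with
  | Atom _ => id | Arr l a' => fun x => psi _ _ (sp1 (ext_to D l) (did a') x) end).
split=> [D [//|l a] x|D [//|l a] y|D D' [//|l a] a' d g].
- by rewrite sp1_comp ext_toK dcomp_idl sp1_id H.
- by rewrite H' sp1_comp ext_fromK dcomp_idl sp1_id.
move: a' g; apply: mkArr_ind => l' a' s g x.
set y := sp1 _ _ (phi _ _ x).
change (sp1 (ext_from D' l') (did a') (phi _ _ (F1 (cext d (ush_inv s)) g x)) =
  lam_sp1 (P := F) (uhom b d) (mkArr s g) y).
rewrite lam_sp1E N /y !sp1_comp ext_from_nat ush_invK.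
by rewrite dcomp_idl dcomp_idr.
Qed.
End Lam.
End Transfer.

(** * Flattening as a dependent sum *)

Section Flatten.
Context (A : category) (c : fclass).
Local Notation dobj := (dobj A).
Local Notation dhm := (@dhom A c).
Local Notation shom := (@shom A c).

Lemma tr_eqh (x x' y y' : dobj) (e1 : x = x') (e2 : y = y') (f : dhm x y) :
  tr e1 e2 f = dcomp (eqh c (esym e1)) (dcomp f (eqh c e2)).
Proof. by subst x' y'; rewrite /= dcomp_idl dcomp_idr. Qed.

Section Split.
Context (I : Type) (rX : seq I) (X : I -> seq dobj).
Local Notation FX := (flatten (map X rX)).

Definition blk (p : 'I_(size FX)) : {o : I & 'I_(size (X o))} :=
  existT _ (lnth rX (bh_r p)) (bh_c p).

Definition blk_hom (p : 'I_(size FX)) : dhm (lnth (X (projT1 (blk p))) (projT2 (blk p))) (lnth FX p) :=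
  eqh c (bh_eqY p).
End Split.

Lemma existT_dcomp (T : Type) (ob : T -> dobj) (i j : T) a a' (ij : i = j) (e : ob i = a) 
   (f : dhm a a') (f' : dhm (ob j) a') :
  f' = dcomp (eqh c (etrans (congr1 ob (esym ij)) e)) f ->
  existT (fun i => dhm (ob i) a') i (dcomp (eqh c e) f) = existT _ j f'.
Proof. by subst j => ->; congr existT; congr dcomp; congr eqh; apply: proof_irrelevance. Qed.

Section BlockNat.
Context (I J : Type) (rX : seq I) (rY : seq J) (X : I -> seq dobj) (Y : J -> seq dobj)
  (be : 'I_(size rY) -> 'I_(size rX)) (Hbe : inC c be)
  (bs : forall i : 'I_(size rY), shom (X (lnth rX (be i))) (Y (lnth rY i))).
Local Notation FX := (flatten (map X rX)).
Local Notation FY := (flatten (map Y rY)).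

Lemma blk_rho p : blk (bh_rho bs p) =
  existT (fun o => 'I_(size (X o))) (lnth rX (be (bh_r p))) (sfun (bs (bh_r p)) (bh_c p)).
Proof.
have h : sfun (bs (bh_r p)) (bh_c p) < nth 0 (shape (map X rX)) (be (bh_r p)).
  by rewrite bh_shX_nth.
have er : bh_r (bh_rho bs p) = be (bh_r p).
  by apply: ord_inj; rewrite /= flatten_indexKl.
have ec : val (bh_c (bh_rho bs p)) = val (sfun (bs (bh_r p)) (bh_c p)).
  by rewrite /= flatten_indexKr.
rewrite /blk; move: (bh_c (bh_rho bs p)) ec; rewrite er => z ez.
by congr existT; apply: val_inj.
Qed.

(** Read in block coordinates, the morphism built by [bhom] is be on labels and bs inside each
    block; all index arithmetic of flattening stops here. *)
Lemma blk_nat p :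
  existT (fun q => dhm (lnth (X (projT1 q)) (projT2 q)) (lnth FY p)) (blk (bh_rho bs p))
    (dcomp (blk_hom (bh_rho bs p)) (scmp (bhom Hbe bs) p)) =
  existT _ (existT (fun o => 'I_(size (X o))) (lnth rX (be (bh_r p))) (sfun (bs (bh_r p)) (bh_c p)))
    (dcomp (scmp (bs (bh_r p)) (bh_c p)) (blk_hom p)).
Proof.
rewrite /blk_hom; apply: (existT_dcomp (ob := fun q => lnth (X (projT1 q)) (projT2 q)) (ij := blk_rho p)).
rewrite /= tr_eqh -dcomp_assoc eqh_comp eqh_refl dcomp_idl.
done.
Qed.
End BlockNat.

Section Tensor.
Context (n : nat) (V : finType) (b : V -> 'I_n).
Local Notation ctx := (@ctx A n).
Local Notation chom := (@chom A c n).
Local Notation uctx := (@uctx A n V b).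
Local Notation uhom := (@uhom A c n V b).
Local Notation fchom := (@fchom A c).
Local Notation fcid := (@fcid A c _ _).

Definition usum k (G0 : ctx) (Gs : 'I_k -> ctx) : fctx A V :=
  osum (finite_finType (option 'I_k)) (fun o => uctx (fam G0 Gs o)).

Section TensIso.
Context (k : nat) (G0 : ctx) (Gs : 'I_k -> ctx) (v : V).
Local Notation X := (fun o => fam G0 Gs o (b v)).
Local Notation sh := (shape (map X (labs k))).

Definition tblk (p : fidx (uctx (tens G0 Gs) v)) : fidx (usum G0 Gs v) := blk p.

Lemma tpos_lt (q : fidx (usum G0 Gs v)) :
  flatten_index sh (lab_pos (projT1 q)) (projT2 q : 'I_(size (fam G0 Gs (projT1 q) (b v))))
    < size (tens G0 Gs (b v)).
Proof.
rewrite /tens size_flatten; apply: flatten_indexP.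
by rewrite bh_shX_nth lab_posK.
Qed.

Definition tpos (q : fidx (usum G0 Gs v)) : fidx (uctx (tens G0 Gs) v) := Ordinal (tpos_lt q).

Lemma tblkK : cancel tblk tpos.
Proof. move=> p; apply: ord_inj.
change (flatten_index sh (lab_pos (lnth (labs k) (bh_r (Y := X) p))) (bh_c (Y := X) p) = p).
by rewrite lnth_labsK; apply: bh_pK. Qed.

Lemma tposK : cancel tpos tblk.
Proof.
move=> [o z]; have h : (z : 'I_(size (fam G0 Gs o (b v)))) < nth 0 sh (lab_pos o).
  by rewrite bh_shX_nth lab_posK.
have er : bh_r (Y := X) (tpos (existT _ o z)) = lab_pos o.
  by apply: ord_inj; rewrite /= flatten_indexKl.
have ec : val (bh_c (Y := X) (tpos (existT _ o z))) = val (z : 'I_(size (fam G0 Gs o (b v)))).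
  by rewrite /= flatten_indexKr.
rewrite /tblk /blk; move: (bh_c _) ec; rewrite er lab_posK => z' ez.
by congr existT; apply: val_inj.
Qed.

Definition tblk_fob (p : fidx (uctx (tens G0 Gs) v)) : fob (tblk p) = fob p :=
  bh_eqY (Y := X) p.
End TensIso.

Definition tens_in k (G0 : ctx) (Gs : 'I_k -> ctx) : fchom (usum G0 Gs) (uctx (tens G0 Gs)) :=
  fun v => fam_to c (@tblkK k G0 Gs v) (@tposK k G0 Gs v) (@tblk_fob k G0 Gs v).
Definition tens_out k (G0 : ctx) (Gs : 'I_k -> ctx) : fchom (uctx (tens G0 Gs)) (usum G0 Gs) :=
  fun v => fam_from c (@tblkK k G0 Gs v) (@tposK k G0 Gs v) (@tblk_fob k G0 Gs v).

Lemma tens_inK k G0 (Gs : 'I_k -> ctx) : fccomp (tens_in G0 Gs) (tens_out G0 Gs) = fcid.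
Proof. by apply: functional_extensionality_dep => v; apply: fam_toK. Qed.
Lemma tens_outK k G0 (Gs : 'I_k -> ctx) : fccomp (tens_out G0 Gs) (tens_in G0 Gs) = fcid.
Proof. by apply: functional_extensionality_dep => v; apply: fam_fromK. Qed.

Definition fam_hom k m (al : 'I_m -> 'I_k) (G0 G0' : ctx) (Gs : 'I_k -> ctx) (Gs' : 'I_m -> ctx)
    (g0 : fchom (uctx G0) (uctx G0')) (gs : forall j, fchom (uctx (Gs (al j))) (uctx (Gs' j))) o :
    fchom (uctx (fam G0 Gs (omap al o))) (uctx (fam G0' Gs' o)) :=
  match o with None => g0 | Some j => gs j end.

Lemma in_class_omap (I J : Type) (al : J -> I) : in_class c al -> in_class c (omap al).
Proof.
move=> H; apply: in_class_by => Hc.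
  move=> [j|] [j'|] //= [] e; by rewrite (in_class_inj Hc H e).
by move=> [i|]; [have [j <-] := in_class_surj Hc H i; exists (Some j)|exists None].
Qed.

Definition usum_hom k m (al : 'I_m -> 'I_k) (Hal : in_class c al) G0 G0' Gs Gs' g0 gs :
    fchom (usum G0 Gs) (usum G0' Gs') :=
  osum_hom _ _ (in_class_omap Hal) (@fam_hom k m al G0 G0' Gs Gs' g0 gs).

Lemma tens_hom_nat k (G0 G0' : ctx) (Gs Gs' : 'I_k -> ctx) (g0 : chom G0 G0')
    (gs : forall j, chom (Gs j) (Gs' j)) :
  fccomp (tens_in G0 Gs) (uhom (tens_hom g0 gs)) =
  fccomp (usum_hom (in_class_id c 'I_k) (uhom g0) (fun j => uhom (gs j))) (tens_in G0' Gs').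
Proof.
apply: fchom_eq => v p.
refine (etrans (blk_nat (inC_id c _) _ p) _).
pose bs o := match o return shom (fam G0 Gs o (b v)) (fam G0' Gs' o (b v)) with
  | None => g0 (b v) | Some i => gs i (b v) end.
(* The label read off from [labs k] is generalised to o, after which both matches on it reduce by
   cases. *)
have H o z y (f : dhm (lnth (fam G0' Gs' o (b v)) z) y) :
  existT (fun q : fidx (usum G0 Gs v) => dhm (fob q) y)
    (existT (fun o => 'I_(size (fam G0 Gs o (b v)))) o (sfun (bs o) z)) (dcomp (scmp (bs o) z) f) =
  existT (fun q : fidx (usum G0 Gs v) => dhm (fob q) y)
    (existT _ (omap id o) (projT1 (@fam_hom k k id G0 G0' Gs Gs' (uhom g0) (fun j => uhom (gs j)) o v z)))
    (dcomp (projT2 (@fam_hom k k id G0 G0' Gs Gs' (uhom g0) (fun j => uhom (gs j)) o v z)) f).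
  by case: o z f => [j|] z f.
exact: (H (lnth (labs k) (bh_r p)) (bh_c p) _ (blk_hom p)).
Qed.

Lemma sigma_hom_nat k m (G0 : ctx) (Gs : 'I_k -> ctx) (al : 'I_m -> 'I_k) (Hal : inC c al) :
  fccomp (tens_in G0 Gs) (uhom (sigma_hom G0 Gs Hal)) =
  fccomp (@usum_hom k m al Hal G0 G0 Gs (fun j => Gs (al j)) fcid (fun j => fcid))
    (tens_in G0 (fun j => Gs (al j))).
Proof.
apply: fchom_eq => v p.
refine (etrans (blk_nat (inC_omap_pos Hal) _ p) _).
have H o' o (eo : o' = omap al o) (e : fam G0 Gs o' (b v) = fam G0 (fun j => Gs (al j)) o (b v))
    z y (f : dhm (lnth (fam G0 (fun j => Gs (al j)) o (b v)) z) y) :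
  existT (fun q : fidx (usum G0 Gs v) => dhm (fob q) y)
    (existT (fun o => 'I_(size (fam G0 Gs o (b v)))) o' (sfun (shom_eq c e) z))
    (dcomp (scmp (shom_eq c e) z) f) =
  existT (fun q : fidx (usum G0 Gs v) => dhm (fob q) y)
    (existT _ (omap al o) (projT1 (@fam_hom k m al G0 G0 Gs (fun j => Gs (al j)) fcid (fun j => fcid) o v z)))
    (dcomp (projT2 (@fam_hom k m al G0 G0 Gs (fun j => Gs (al j)) fcid (fun j => fcid) o v z)) f).
  by subst o'; case: o e z f => [j|] e; rewrite (proof_irrelevance _ e erefl).
exact: (H _ (lnth (labs m) (bh_r p)) (lab_posK _) _ (bh_c p) _ (blk_hom p)).
Qed.
End Tensor.
End Flatten.

(** * Application of list functors *)

Section OsumFunctor.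
Context (A : category) (c : fclass).
Local Notation fctx := (@fctx A).
Local Notation fchom := (@fchom A c).
Local Notation fcid := (@fcid A c _ _).

Lemma osum_hom_comp W I J L HI HJ HL (H : I -> fctx W) (H' : J -> fctx W) (H'' : L -> fctx W)
    (al : J -> I) (be : L -> J) Ha Hb Hab
    (k : forall j, fchom (H (al j)) (H' j)) (k' : forall l, fchom (H' (be l)) (H'' l)) k'' :
  (forall l, k'' l = fccomp (k (be l)) (k' l)) ->
  fccomp (osum_hom HI HJ Ha k) (osum_hom HJ HL Hb k') =
  osum_hom HI HL (al := fun l => al (be l)) Hab k''.
Proof. by move=> e; apply: fchom_eq => w [l x] /=; rewrite e. Qed.

(* The equality of dependent pairs avoids a transport along st_al st j = projT1 p. *)
Lemma step_pair (V W : finType) (Q : V -> species A c W) (Y Y' : effam Q) (st : estep Y Y') v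
    (j : ei (Y' v)) a (n' : dhom c (eb j) a) (p : {i : ei (Y v) & dhom c (eb i) a}) :
  existT (fun i => dhom c (eb i) a) (st_al st j) (dcomp (st_m st j) n') = p ->
  {K : fchom (eH (projT1 p)) (eH j) |
    sp1 fcid (projT2 p) (ew (projT1 p)) = sp1 K n' (ew j) /\
    forall w z, existT (fun q : fidx (tot_ctx Y w) => dhom c (fob q) (fob z))
      (existT (fun r : {v : V & ei (Y v)} => fidx (eH (projT2 r) w)) (existT _ v (projT1 p)) (projT1 (K w z)))
         (projT2 (K w z)) =
      existT (fun q : fidx (tot_ctx Y w) => dhom c (fob q) (fob z))
      (existT (fun r : {v : V & ei (Y v)} => fidx (eH (projT2 r) w)) (existT _ v (st_al st j))
         (projT1 (st_k st j w z))) (projT2 (st_k st j w z)) }.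
Proof. by move=> <-; exists (st_k st j); split=> //; apply: st_E_comp. Qed.
End OsumFunctor.

Section AppTransfer.
Context (A : category) (c : fclass).
Context (n : nat) (V : finType) (b : V -> 'I_n) (b' : 'I_n -> V).
Context (K : cancel b b') (K' : cancel b' b).
Local Notation dobj := (dobj A).
Local Notation dhm := (@dhom A c).
Local Notation ctx := (@ctx A n).
Local Notation chom := (@chom A c n).
Local Notation uctx := (@uctx A n V b).
Local Notation uhom := (@uhom A c n V b).
Local Notation uhom_inv := (@uhom_inv A c n V b b' K').
Local Notation lctx := (@lctx A c n V b').
Local Notation lto := (@lto A c n V b b' K).
Local Notation lfrom := (@lfrom A c n V b b' K).
Local Notation did := (@did A c).
Local Notation fctx := (@fctx A).
Local Notation fchom := (@fchom A c).
Local Notation fcid := (@fcid A c _ _).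
Local Notation fid := (@fid A c).
Local Notation species := (@species A c).
Local Notation usum := (@usum A n V b).
Local Notation tens_in := (@tens_in A c n V b).
Local Notation tens_out := (@tens_out A c n V b).
Context (P Q : psh A c n) (F G : species V).
Context (phiP : forall D a, F0 P D a -> sp0 F (uctx D) a) (psiP : forall D a, sp0 F (uctx D) a -> F0 P D a).
Context (PK : forall D a x, psiP (@phiP D a x) = x) (PK' : forall D a y, phiP (@psiP D a y) = y).
Context (PN : forall D D' a a' (d : chom D' D) (g : dhm a a') x,
  phiP (F1 d g x) = sp1 (uhom d) g (@phiP D a x)).
Context (phiQ : forall D a, F0 Q D a -> sp0 G (uctx D) a) (psiQ : forall D a, sp0 G (uctx D) a -> F0 Q D a).
Context (QK : forall D a x, psiQ (@phiQ D a x) = x) (QK' : forall D a y, phiQ (@psiQ D a y) = y).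
Context (QN : forall D D' a a' (d : chom D' D) (g : dhm a a') x,
  phiQ (F1 d g x) = sp1 (uhom d) g (@phiQ D a x)).
Local Notation apre := (@apre A c n P Q).
Local Notation R := (cons_sp (@var_sp A c V) G).

Definition hsum D a (x : apre D a) : fchom (uctx D) (usum (ap_G0 x) (@ap_Gs _ _ _ _ _ _ _ x)) :=
  fccomp (uhom (ap_h x)) (tens_out _ _).

(* Common generalisation of the two generating relations of the coend, along morphisms of
   families rather than of lists. *)
Record move D a (x y : apre D a) := Move {
  mv_s : famhom c (fl (ap_as x)) (fl (ap_as y));
  mv_g0 : fchom (uctx (ap_G0 x)) (uctx (ap_G0 y));
  mv_gs : forall j : 'I_(size (ap_as y)), fchom (uctx (ap_Gs (projT1 (mv_s j)))) (uctx (ap_Gs j));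
  mv_p : phiP (ap_p x) = sp1 mv_g0 (mkArr mv_s (did a)) (phiP (ap_p y));
  mv_q : forall j : 'I_(size (ap_as y)), sp1 fcid (projT2 (mv_s j)) (phiQ (ap_q (projT1 (mv_s j)))) =
     sp1 (mv_gs j) (did _) (phiQ (ap_q j));
  mv_h : hsum y = fccomp (hsum x) (usum_hom (fh_in mv_s) mv_g0 mv_gs) }.

Lemma tens_out_nat k m (al : 'I_m -> 'I_k) Hal (G0 G0' : ctx) (Gs : 'I_k -> ctx) (Gs' : 'I_m -> ctx)
    g0 gs (t : chom (tens G0 Gs) (tens G0' Gs')) :
  fccomp (tens_in G0 Gs) (uhom t) =
    fccomp (@usum_hom A c n V b k m al Hal G0 G0' Gs Gs' g0 gs) (tens_in G0' Gs') ->
  fccomp (uhom t) (tens_out G0' Gs') = fccomp (tens_out G0 Gs) (usum_hom Hal g0 gs).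
Proof.
move=> e; rewrite -[uhom t]fccomp_idl -(tens_outK c b G0 Gs) (fccompA (tens_out _ _)) e.
by rewrite !fccompA tens_inK fccomp_idr.
Qed.

Lemma arel_move D a (x y : apre D a) : arel x y -> inhabited (move x y).
Proof.
case=> [as_ G0 G0' Gs Gs' g0 gs p q h|as_ bs s G0 Gs p q h]; constructor.
- apply: (@Move _ _ (APre _ _ _) (APre _ _ _) (fid (fl as_)) (uhom g0) (fun j => uhom (gs j))) => /=.
  + by rewrite mkArr_id PN.
  + by move=> j; rewrite QN sp1_id.
  + rewrite /hsum /= uhom_comp fccompA (tens_out_nat (tens_hom_nat b _ _)).
    by rewrite fccompA.
- apply: (@Move _ _ (APre _ _ _) (APre _ _ _) (ush s)
    (fcid : fchom (uctx G0) (uctx G0))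
    (fun j => fcid : fchom (uctx (Gs (sfun s j))) (uctx (Gs (sfun s j))))) => /=.
  + by rewrite PN uhom_id.
  + by move=> j; rewrite QN uhom_id sp1_id.
  + have E := tens_out_nat (sigma_hom_nat b G0 Gs (sinC s)).
    rewrite /hsum /= uhom_comp [LHS]fccompA [RHS]fccompA.
    exact: (f_equal (fccomp (uhom h)) E).
Qed.

Lemma phiP_inj D a : injective (@phiP D a).
Proof. exact: can_inj (@PK D a). Qed.
Lemma phiQ_inj D a : injective (@phiQ D a).
Proof. exact: can_inj (@QK D a). Qed.

Lemma hsum_in D a (x : apre D a) : uhom (ap_h x) = fccomp (hsum x) (tens_in _ _).
Proof. by rewrite /hsum fccompA tens_outK fccomp_idr. Qed.

(** A move factors as [arel_seq] along its list morphism, with contexts kept, followed by [arel_ctx]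
    along its context morphisms. Morphisms between the families of lists come from list morphisms,
    so the generators of the coend suffice. *)
Lemma move_arel D a (x y : apre D a) : move x y -> clos_refl_sym_trans _ (@arel A c n P Q D a) x y.
Proof.
case: x y => [as_ G0 Gs p q h] [bs G0' Gs' p' q' h'] [/= s g0 gs Ep Eq Eh].
pose s' := ush_inv s.
pose p1 := F1 (uhom_inv g0) (did (Arr bs a)) p'.
have -> : p = F1 (cidc c G0) (HArr (sinC s') (scmp s') (did a)) p1.
  apply: phiP_inj; rewrite Ep /p1 !PN uhom_id (uhom_invK K).
  apply/esym/(etrans (sp1_comp _ _ _ _ _)).
  by rewrite fccomp_idl dcomp_idl.
apply: rst_trans.
  by apply: rst_step; apply: (arel_seq s' p1 q h).
have -> : (fun j => F1 (cidc c (Gs (sfun s' j))) (scmp s' j) (q (sfun s' j))) =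
    (fun j => F1 (uhom_inv (gs j)) (did (lnth bs j)) (q' j)).
  apply: functional_extensionality_dep => j; apply: phiQ_inj.
  by rewrite !QN uhom_id (uhom_invK K); apply: Eq.
have -> : h' = ccompc (ccompc h (sigma_hom G0 Gs (sinC s')))
    (tens_hom (uhom_inv g0) (fun j => uhom_inv (gs j))).
  have E : fccomp (usum_hom (fh_in s) g0 gs) (tens_in G0' Gs') = fccomp (tens_in G0 Gs)
      (fccomp (uhom (sigma_hom G0 Gs (sinC s'))) (uhom (tens_hom (uhom_inv g0) (fun j => uhom_inv (gs j))))).
    rewrite -fccompA (sigma_hom_nat b G0 Gs (sinC s')) fccompA.
    rewrite (tens_hom_nat b (uhom_inv g0) (fun j => uhom_inv (gs j))) -fccompA.
    apply: (f_equal (fun z => fccomp z (tens_in G0' Gs'))); apply/esym.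
    rewrite (uhom_invK K).
    have -> : (fun j => uhom (uhom_inv (gs j))) = gs.
      by apply: functional_extensionality_dep => j; apply: (uhom_invK K).
    apply: fchom_eq => v [[j|] z] /=; rewrite dcomp_idl.
      by case: (gs j v z).
    by case: (g0 v z).
  apply: (uhom_inj K'); rewrite !uhom_comp.
  refine (etrans (hsum_in (APre p' q' h')) _); rewrite Eh.
  refine (etrans (fccompA _ _ _) _).
  refine (etrans (f_equal (fccomp (hsum (APre p q h))) E) _).
  refine (etrans (esym (fccompA _ _ _)) _).
  refine (etrans (f_equal (fun z => fccomp z _) (esym (hsum_in (APre p q h)))) _).
  by rewrite /= fccompA.
exact: rst_step (arel_ctx _ _ _ _ _).
Qed.

Lemma arel_iff_move D a (T : Type) (f : apre D a -> T) :
  (forall x y, move x y -> f x = f y) -> forall x y, arel x y -> f x = f y.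
Proof. by move=> H x y /arel_move [m]; apply: H. Qed.

(** * From applications on lists to composites of species *)

Section Phi.
Context (L : seq dobj) (G0 : ctx) (Gs : 'I_(size L) -> ctx)
  (q : forall j : 'I_(size L), sp0 G (uctx (Gs j)) (lnth L j)).

(** The context G0 of the function enters as arguments too, one generic variable per entry. The
    total context is then that of G0 and all Gs together, as [usum_args] makes explicit. *)
Definition app_args : effam R := fun o =>
  match o return efam (R o) with
  | Some v => @EFam A c V (var_sp A c v) (fidx (uctx G0 v)) (ffin (uctx G0 v)) (@fob _ (uctx G0 v))
      (fun i => sing v (fob i)) (fun i => fcid)
  | None => @EFam A c V G (fidx (fl L)) (ffin (fl L)) (@fob _ (fl L)) (fun j => uctx (Gs j)) q
  end.

Definition usum_args_idx w (p : fidx (tot_ctx app_args w)) : {z : fidx (usum G0 Gs w) & dhm (fob z) (fob p)} :=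
  match p as p0 return {z : fidx (usum G0 Gs w) & dhm (fob z) (fob (d := tot_ctx app_args w) p0)} with
  | existT (existT (Some v) i) e =>
      let r := @rtr A c V (uctx G0) w v e i in
      existT (fun z : fidx (usum G0 Gs w) => dhm (fob z) (fob i))
        (existT (fun o => fidx (uctx (fam G0 Gs o) w)) None (projT1 r)) (projT2 r)
  | existT (existT None j) z =>
      existT (fun z' : fidx (usum G0 Gs w) => dhm (fob z') (fob (d := uctx (Gs j) w) z))
        (existT (fun o => fidx (uctx (fam G0 Gs o) w)) (Some j) z) (did (fob (d := uctx (Gs j) w) z))
  end.

Definition usum_args_inv w (z : fidx (usum G0 Gs w)) : fidx (tot_ctx app_args w) :=
  match z with
  | existT None i =>
      existT (fun p : {o : option V & ei (app_args o)} => fidx (eH (projT2 p) w))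
       (existT (fun o => ei (app_args o)) (Some w) i) (erefl w)
  | existT (Some j) z =>
      existT (fun p : {o : option V & ei (app_args o)} => fidx (eH (projT2 p) w))
       (existT (fun o => ei (app_args o)) None j) z
  end.

Lemma usum_args_in w : in_class c (fun p => projT1 (@usum_args_idx w p)).
Proof.
apply: (@in_class_can c _ _ _ (@usum_args_inv w)).
  by move=> [[[v|] i] e] //; change (w = v) in e; subst v.
by move=> [[j|] z].
Qed.

Definition usum_args : fchom (usum G0 Gs) (tot_ctx app_args) := fun w =>
  @FamHom A c (usum G0 Gs w) (tot_ctx app_args w) (@usum_args_idx w) (@usum_args_in w).
End Phi.

Definition app_f L (G0 : ctx) a (p : sp0 F (uctx G0) (Arr L a)) : sp0 F (uctx G0) (Arr (lst c (fl L)) a) :=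
  sp1 fcid (mkArr (of_lst c (fl L)) (did a)) p.

Definition app_gen D a (x : apre D a) : sp0 (Comp (unlam_sp F) R) (uctx D) a :=
  gen (F := unlam_sp F) (X := app_args (ap_G0 x) (fun j => phiQ (@ap_q _ _ _ _ _ _ _ x j)))
    (app_f (phiP (ap_p x))) (fccomp (hsum x) (usum_args _ _)).

Section MoveStep.
Context (L L' : seq dobj) (G0 G0' : ctx) (Gs : 'I_(size L) -> ctx) (Gs' : 'I_(size L') -> ctx)
  (q : forall j : 'I_(size L), sp0 G (uctx (Gs j)) (lnth L j))
  (q' : forall j : 'I_(size L'), sp0 G (uctx (Gs' j)) (lnth L' j))
  (s : famhom c (fl L) (fl L')) (g0 : fchom (uctx G0) (uctx G0'))
  (gs : forall j : 'I_(size L'), fchom (uctx (Gs (projT1 (s j)))) (uctx (Gs' j)))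
  (Eq : forall j : 'I_(size L'), sp1 fcid (projT2 (s j)) (q (projT1 (s j))) = sp1 (gs j) (did _) (q' j)).
Local Notation X := (app_args G0 q).
Local Notation X' := (app_args G0' q').

Definition ms_al o : ei (X' o) -> ei (X o) :=
  match o return ei (X' o) -> ei (X o) with
  | Some v => fun i => projT1 (g0 v i) | None => fun j => projT1 (s j) end.
Definition ms_m o : forall j : ei (X' o), dhm (@eb _ _ _ _ (X o) (ms_al j)) (eb j) :=
  match o return forall j : ei (X' o), dhm (@eb _ _ _ _ (X o) (ms_al j)) (eb j) with
  | Some v => fun i => projT2 (g0 v i) | None => fun j => projT2 (s j) end.
Definition ms_k o : forall j : ei (X' o), fchom (@eH _ _ _ _ (X o) (ms_al j)) (eH j) :=
  match o return forall j : ei (X' o), fchom (@eH _ _ _ _ (X o) (ms_al j)) (eH j) with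
  | Some v => fun i => sing_hom v (projT2 (g0 v i)) | None => gs end.

Definition ms_step : estep X X'.
Proof.
refine (@EStep A c (option V) V R X X' ms_al _ ms_m ms_k _).
  by case=> [v|]; [apply: (fh_in (g0 v))|apply: (fh_in s)].
case=> [v|] j; last exact: Eq.
by rewrite /= /var1 !fccomp_idl sing_hom_id fccomp_idr.
Defined.
End MoveStep.

Lemma app_gen_move D a (x y : apre D a) : move x y -> app_gen x = app_gen y.
Proof.
move=> [s g0 gs Ep Eq Eh].
pose st := @ms_step (ap_as x) (ap_as y) (ap_G0 x) (ap_G0 y) _ _
  (fun j => phiQ (@ap_q _ _ _ _ _ _ _ x j)) (fun j => phiQ (@ap_q _ _ _ _ _ _ _ y j)) s g0 gs Eq.
apply: (gen_step (st := st)).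
  rewrite /= /unlam1 /app_f Ep !sp1_comp.
  have eN : step_base st None = s by apply: famhom_eq => j /=; case: (s j).
  have eS : ren_hom Some (step_base st) = g0.
    by apply: fchom_eq => v j /=; case: (g0 v j).
  rewrite fccomp_idl fccomp_idr eS /arrX eN !mkArr_comp !dcomp_idl; congr (sp1 _ (mkArr _ _) _).
  by rewrite !fcompA to_lstK fcomp_idr.
rewrite Eh; apply: fccomp_sq; apply: fchom_eq => w [[[v|] i] z] /=.
  change (w = v) in z; subst w => /=.
  by rewrite dcomp_idr dcomp_idl.
by rewrite dcomp_idr dcomp_idl.
Qed.

Lemma lfrom_lto_cut (G1 H1 : fctx V) (t : fchom G1 H1) : fccomp (lfrom G1) (fccomp (lto G1) t) = t.
Proof. by rewrite -fccompA lfromK fccomp_idl. Qed.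

(** * From composites of species to applications on lists *)

Section Psi.
Context (D : ctx) (a : dobj).

Section RhoOm.
Context (Y : effam R).
Local Notation YN := (base_ctx Y None).
Local Notation L := (lst c YN).

Definition xN (j : 'I_(size L)) : ei (Y None) := projT1 (to_lst c YN j).

Definition rfam (o : option 'I_(size L)) : fctx V :=
  match o with None => ren_ctx Some (base_ctx Y) | Some j => @eH _ _ _ _ (Y None) (xN j) end.

Definition yv v (i : ei (Y (Some v))) : fchom (@eH _ _ _ _ (Y (Some v)) i) (sing v (eb i)) :=
  @ew _ _ _ _ (Y (Some v)) i.

Definition rho_idx w (p : {o : option 'I_(size L) & fidx (rfam o w)}) :
    {q : fidx (tot_ctx Y w) & dhm (fob q) (fob (d := osum (finite_finType _) rfam w) p)} :=
  match p as p0
    return {q : fidx (tot_ctx Y w) & dhm (fob q) (fob (d := osum (finite_finType _) rfam w) p0)} with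
  | existT None i => let r := @yv w i w erefl in
      existT (fun q : fidx (tot_ctx Y w) => dhm (fob q) (eb i))
        (existT (fun p : {o : option V & ei (Y o)} => fidx (eH (projT2 p) w))
          (existT (fun o => ei (Y o)) (Some w) i) (projT1 r)) (projT2 r)
  | existT (Some j) z =>
      existT (fun q : fidx (tot_ctx Y w) => dhm (fob q) (fob (d := @eH _ _ _ _ (Y None) (xN j) w) z))
        (existT (fun p : {o : option V & ei (Y o)} => fidx (eH (projT2 p) w))
          (existT (fun o => ei (Y o)) None (xN j)) z) (did _)
  end.

Lemma rho_in w : in_class c (fun p => projT1 (@rho_idx w p)).
Proof.
apply: in_class_by => Hc.
  move=> [[j|] z] [[j'|] z'] /= e.
  - have ex : xN j = xN j' by apply: inj_pair2 (f_equal (@projT1 _ _) e).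
    have ej := in_class_inj Hc (fh_in (to_lst c YN)) ex; subst j'.
    by have -> := inj_pair2 _ _ _ _ _ e.
  - by have := f_equal (fun q => projT1 (projT1 q)) e.
  - by have := f_equal (fun q => projT1 (projT1 q)) e.
  - by have -> : z = z' by apply: inj_pair2 (f_equal (@projT1 _ _) e).
move=> [[[v|] x] y].
  have [e ey] := in_class_surj Hc (fh_in (@yv v x w)) y.
  have e1 : w = v := e; subst v.
  exists (existT (fun o => fidx (rfam o w)) None x); rewrite /= -ey.
  by have -> : e = erefl :> (w = w) := proof_irrelevance _ _ _.
have [j ej] := in_class_surj Hc (fh_in (to_lst c YN)) x; subst x.
by exists (existT (fun o => fidx (rfam o w)) (Some j) y).
Qed.

(** An arbitrary Y need not have generic variables. Evaluating each variable argument at its only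
    index turns these arguments into the base context, which serves as G0; the arguments in G are
    listed through [to_lst]. *)
Definition rho : fchom (tot_ctx Y) (osum (finite_finType _) rfam) := fun w =>
  @FamHom A c (tot_ctx Y w) (osum (finite_finType _) rfam w) (@rho_idx w) (@rho_in w).

Definition yG0 : ctx := lctx (ren_ctx Some (base_ctx Y)).
Definition yGs (j : 'I_(size L)) : ctx := lctx (@eH _ _ _ _ (Y None) (xN j)).

Definition lf o : fchom (rfam o) (uctx (fam yG0 yGs o)) :=
  match o return fchom (rfam o) (uctx (fam yG0 yGs o)) with
  | None => lfrom _ | Some j => lfrom _ end.

Definition om : fchom (tot_ctx Y) (usum yG0 yGs) :=
  fccomp rho (osum_hom (finite_finType _) (finite_finType _) (in_class_id c _) lf).
End RhoOm.

Definition app_pre (Y : effam R) (f : sp0 (unlam_sp F) (base_ctx Y) a) (h : fchom (uctx D) (tot_ctx Y)) :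
    apre D a :=
  @APre A c n P Q D a (lst c (base_ctx Y None)) (yG0 Y) (@yGs Y)
    (psiP (sp1 (lto (ren_ctx Some (base_ctx Y))) (did _) f))
    (fun j => psiQ (sp1 (lto _) (projT2 (to_lst c (base_ctx Y None) j)) (@ew _ _ _ _ (Y None) (xN j))))
    (uhom_inv (fccomp (fccomp h (om Y)) (tens_in _ _))).

Lemma hsum_psi Y f h : hsum (@app_pre Y f h) = fccomp h (om Y).
Proof. by rewrite /hsum /= (uhom_invK K) fccompA tens_inK fccomp_idr. Qed.

Section PsiStep.
Context (Y Y' : effam R) (st : estep Y Y').
Local Notation X := (base_ctx Y None).
Local Notation X' := (base_ctx Y' None).

Definition ps_s : famhom c (fl (lst c X)) (fl (lst c X')) :=
  fcomp (of_lst c X) (fcomp (step_base st None) (to_lst c X')).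

(** Follows from [to_lst] after [of_lst] cancelling between the two chosen lists. The indices agree
    only propositionally, which is why [step_pair] supplies the context arrow [ps_K]. *)
Lemma ps_eq (j : 'I_(size (lst c X'))) :
  existT (fun i => dhm (eb i) (lnth (lst c X') j)) (st_al st (xN j))
    (dcomp (st_m st (xN j)) (projT2 (to_lst c X' j))) =
  existT _ (xN (projT1 (ps_s j))) (dcomp (projT2 (to_lst c X (projT1 (ps_s j)))) (projT2 (ps_s j))).
Proof.
have e : fcomp (to_lst c X) ps_s = fcomp (step_base st None) (to_lst c X').
  by rewrite /ps_s -fcompA to_lstK fcomp_idl.
have e1 := f_equal (fun t : famhom c X (fl (lst c X')) => fh t j) (esym e).
exact: e1.
Qed.

Definition ps_K (j : 'I_(size (lst c X'))) :
    fchom (@eH _ _ _ _ (Y None) (xN (projT1 (ps_s j)))) (@eH _ _ _ _ (Y' None) (xN j)) :=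
  proj1_sig (step_pair (ps_eq j)).

Definition ps_g0 : fchom (uctx (yG0 Y)) (uctx (yG0 Y')) :=
  fccomp (lto _) (fccomp (ren_hom Some (step_base st)) (lfrom _)).
Definition ps_gs (j : 'I_(size (lst c X'))) : fchom (uctx (yGs (projT1 (ps_s j)))) (uctx (yGs j)) :=
  fccomp (lto _) (fccomp (ps_K j) (lfrom _)).

Definition ps_mid (o : option 'I_(size (lst c X'))) :
    fchom (rfam (omap (fun j => projT1 (ps_s j)) o)) (rfam o) :=
  match o with None => ren_hom Some (step_base st) | Some j => ps_K j end.

Lemma rho_step :
  fccomp (step_total st) (rho Y') =
  fccomp (rho Y) (osum_hom (finite_finType _) (finite_finType _) (in_class_omap (fh_in ps_s)) ps_mid).
Proof.
apply: fchom_eq => w [[j|] z].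
  have [_ /(_ w z)] := proj2_sig (step_pair (ps_eq j)).
  rewrite -/(ps_K j) /= => e.
  by rewrite dcomp_idl dcomp_idr; apply/esym.
have := @st_E _ _ _ _ _ _ _ st (Some w) z.
rewrite /= /var1 fccomp_idl sing_hom_id fccomp_idr => E.
have {E} := f_equal (fun s : fchom _ (sing w _) => s w erefl) E.
move=> /(f_equal (fun p => existT
   (fun q : fidx (tot_ctx Y w) => dhm (fob q) (eb z))
   (existT (fun p => fidx (@eH _ _ _ _ (Y (projT1 p)) (projT2 p) w))
      (existT (fun o => ei (Y o)) (Some w) (st_al st z)) (projT1 p)) (projT2 p))) /= E.
exact: esym E.
Qed.

Lemma om_step :
  fccomp (step_total st) (om Y') = fccomp (om Y) (usum_hom (fh_in ps_s) ps_g0 ps_gs).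
Proof.
rewrite /om -fccompA rho_step !fccompA; congr (fccomp (rho Y) _).
pose k'' (o : option 'I_(size (lst c X'))) := fccomp (ps_mid o) (lf o).
rewrite (@osum_hom_comp A c V _ _ _ _ _ (finite_finType _) _ _ _ _ _ _ _
  (in_class_omap (fh_in ps_s)) _ _ k'') //.
apply/esym; apply: (@osum_hom_comp A c V _ _ _ _ (finite_finType _) (finite_finType _)) => -[j|].
  exact: (esym (lfrom_lto_cut _)).
exact: (esym (lfrom_lto_cut _)).
Qed.

Lemma psi_move (f : sp0 (unlam_sp F) (base_ctx Y') a) (h : fchom (uctx D) (tot_ctx Y)) :
  move (app_pre (sp1 (s := unlam_sp F) (step_base st) (did a) f) h) (app_pre f (fccomp h (step_total st))).
Proof.
apply: (@Move _ _ (app_pre _ h) (app_pre _ _) ps_s ps_g0 ps_gs).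
- rewrite /= !PK' !sp1_comp /ps_g0 !fccompA lfromK fccomp_idr dcomp_idl dcomp_idr.
  by [].
- move=> j /=; rewrite !QK' !sp1_comp fccomp_idl dcomp_idr.
  have [e _] := proj2_sig (step_pair (ps_eq j)).
  rewrite sp1_ctx e sp1_comp dcomp_idr /ps_gs !fccompA lfromK fccomp_idr.
  by [].
rewrite !hsum_psi; apply: fccomp_sq; exact: om_step.
Qed.
End PsiStep.

Section PhiPsi.
Context (Y : effam R).

(** Y with generic variables: [vn_step] leads from Y to it, and [pr_step] from it to the arguments
    rebuilt from lists. *)
Definition var_norm : effam R := fun o =>
  match o return efam (R o) with
  | Some v => @EFam A c V (var_sp A c v) (ei (Y (Some v))) (ei_fin (Y (Some v))) (@eb _ _ _ _ (Y (Some v)))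
      (fun i => sing v (eb i)) (fun i => fcid)
  | None => Y None
  end.

Definition vn_al o : ei (var_norm o) -> ei (Y o) :=
  match o return ei (var_norm o) -> ei (Y o) with Some v => id | None => id end.
Definition vn_m o : forall j : ei (var_norm o), dhm (@eb _ _ _ _ (Y o) (vn_al j)) (eb j) :=
  match o return forall j : ei (var_norm o), dhm (@eb _ _ _ _ (Y o) (vn_al j)) (eb j) with
  | Some v => fun i => did _ | None => fun j => did _ end.
Definition vn_k o : forall j : ei (var_norm o), fchom (@eH _ _ _ _ (Y o) (vn_al j)) (eH j) :=
  match o return forall j : ei (var_norm o), fchom (@eH _ _ _ _ (Y o) (vn_al j)) (eH j) with
  | Some v => fun i => @yv Y v i | None => fun j => fcid end.

Definition vn_step : estep Y var_norm.
Proof.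
refine (@EStep A c (option V) V R Y var_norm vn_al _ vn_m vn_k _).
  by case=> [v|]; apply: in_class_id.
by case=> [v|] j //=; rewrite /yv /var1 !fccomp_idl sing_hom_id.
Defined.

Definition yq (j : 'I_(size (lst c (base_ctx Y None)))) :=
  phiQ (psiQ (sp1 (lto _) (projT2 (to_lst c (base_ctx Y None) j)) (@ew _ _ _ _ (Y None) (xN j)))).
Local Notation X := (app_args (yG0 Y) yq).

Definition pr_al o : ei (X o) -> ei (var_norm o) :=
  match o return ei (X o) -> ei (var_norm o) with
  | Some v => fun i => projT1 (lfrom (ren_ctx Some (base_ctx Y)) v i) | None => @xN Y end.
Definition pr_m o : forall j : ei (X o), dhm (@eb _ _ _ _ (var_norm o) (pr_al j)) (eb j) :=
  match o return forall j : ei (X o), dhm (@eb _ _ _ _ (var_norm o) (pr_al j)) (eb j) with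
  | Some v => fun i => projT2 (lfrom (ren_ctx Some (base_ctx Y)) v i)
  | None => fun j => projT2 (to_lst c (base_ctx Y None) j) end.
Definition pr_k o : forall j : ei (X o), fchom (@eH _ _ _ _ (var_norm o) (pr_al j)) (eH j) :=
  match o return forall j : ei (X o), fchom (@eH _ _ _ _ (var_norm o) (pr_al j)) (eH j) with
  | Some v => fun i => sing_hom v (projT2 (lfrom (ren_ctx Some (base_ctx Y)) v i))
  | None => fun j => lfrom _ end.

Definition pr_step : estep var_norm X.
Proof.
refine (@EStep A c (option V) V R var_norm X pr_al _ pr_m pr_k _).
  by case=> [v|];
    [apply: (fh_in (lfrom (ren_ctx Some (base_ctx Y)) v))|apply: (fh_in (to_lst c (base_ctx Y None)))].
case=> [v|] j.
  by rewrite /= /var1 !fccomp_idl sing_hom_id fccomp_idr.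
by rewrite /= /yq QK' sp1_comp lfromK dcomp_idr.
Defined.

Lemma phi_psi_gen (f : sp0 (unlam_sp F) (base_ctx Y) a) (h : fchom (uctx D) (tot_ctx Y)) :
  app_gen (app_pre f h) = gen f h.
Proof.
have -> : gen f h = gen (F := unlam_sp F) (X := var_norm) f (fccomp h (step_total vn_step)).
  apply: (gen_step (st := vn_step)) => //.
  by rewrite -[LHS]sp1_id; congr sp1.
apply/esym; apply: (gen_step (st := pr_step)).
  rewrite /= /unlam1 /app_f PK' !sp1_comp fccomp_idr.
  have eN : step_base pr_step None = to_lst c (base_ctx Y None).
    by apply: famhom_eq => j /=; rewrite /xN; case: (to_lst _ _ j).
  have eS : ren_hom Some (step_base pr_step) = lfrom (ren_ctx Some (base_ctx Y)).
    by apply: fchom_eq => v j /=; case: (lfrom _ v j).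
  rewrite eN eS lfromK dcomp_idl /arrX mkArr_comp.
  rewrite !fcompA to_lstK fcomp_idr of_lstK dcomp_idl.
  by rewrite mkArr_id sp1_id.
rewrite hsum_psi; apply: fccomp_sq; apply: fchom_eq => w [[[v|] i] z] /=.
  change (w = v) in z; subst w => /=.
  by rewrite dcomp_idr.
by rewrite dcomp_idr.
Qed.
End PhiPsi.

Section PsiPhi.
Context (x : apre D a).
Local Notation L := (ap_as x).
Local Notation Y := (app_args (ap_G0 x) (fun j => phiQ (@ap_q _ _ _ _ _ _ _ x j))).
Local Notation f := (app_f (phiP (ap_p x))).
Local Notation h := (fccomp (hsum x) (usum_args _ _)).

Definition pp_s : famhom c (fl (lst c (base_ctx Y None))) (fl L) := of_lst c (fl L).

Lemma pp_eq (j : 'I_(size L)) :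
  existT (fun i => dhm (@eb _ _ _ _ (Y None) i) (lnth L j)) (st_al (estep_id Y) (j : ei (Y None)))
     (dcomp (st_m (estep_id Y) (j : ei (Y None))) (did (lnth L j))) =
  existT _ (xN (Y := Y) (projT1 (pp_s j)))
    (dcomp (projT2 (to_lst c (base_ctx Y None) (projT1 (pp_s j)))) (projT2 (pp_s j))).
Proof.
have e1 := f_equal (fun t : famhom c (fl L) (fl L) => fh t j) (esym (to_lstK c (fl L))).
refine (etrans _ e1).
by rewrite /= dcomp_idl.
Qed.

Definition pp_K (j : 'I_(size L)) :
    fchom (@eH _ _ _ _ (Y None) (xN (Y := Y) (projT1 (pp_s j)))) (uctx (@ap_Gs _ _ _ _ _ _ _ x j)) :=
  proj1_sig (step_pair (pp_eq j)).

Definition pp_gs (j : 'I_(size L)) :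
    fchom (uctx (yGs (Y := Y) (projT1 (pp_s j)))) (uctx (@ap_Gs _ _ _ _ _ _ _ x j)) :=
  fccomp (lto _) (pp_K j).

Definition pp_mid (o : option 'I_(size L)) :
    fchom (rfam (Y := Y) (omap (fun j => projT1 (pp_s j)) o))
      (uctx (fam (ap_G0 x) (@ap_Gs _ _ _ _ _ _ _ x) o)) :=
  match o with None => fcid | Some j => pp_K j end.

(** Splitting the context of an application into generic variables and arguments and evaluating them
    again restores it; this settles the context part of [psi_phi_move]. *)
Lemma usum_args_rho :
  fccomp (usum_args _ _) (fccomp (rho Y) (osum_hom (finite_finType _) (finite_finType _)
    (in_class_omap (fh_in pp_s)) pp_mid)) = (fcid : fchom (usum (ap_G0 x) (@ap_Gs _ _ _ _ _ _ _ x)) _).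
Proof.
apply: fchom_eq => w [[j|] z].
  have [_ /(_ w z)] := proj2_sig (step_pair (pp_eq j)).
  move=> /(f_equal (fun r =>
     existT (fun q : fidx (usum (ap_G0 x) (@ap_Gs _ _ _ _ _ _ _ x) w) => dhm (fob q) _)
     (projT1 (usum_args _ _ w (projT1 r))) (dcomp (projT2 (usum_args _ _ w (projT1 r))) (projT2 r)))).
  rewrite -/(pp_K j) /= => e.
  rewrite !dcomp_idl; rewrite !dcomp_idl in e; exact: e.
by rewrite /= !dcomp_idl.
Qed.

Lemma psi_phi_move : move (@app_pre Y f h) x.
Proof.
apply: (@Move _ _ (@app_pre Y f h) x pp_s (lto (uctx (ap_G0 x))) pp_gs).
- rewrite /= PK' /app_f sp1_comp fccomp_idr dcomp_idr.
  by [].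
- move=> j /=; rewrite !QK' !sp1_comp fccomp_idl.
  have [e _] := proj2_sig (step_pair (pp_eq j)).
  rewrite sp1_ctx e sp1_comp dcomp_idr /pp_gs.
  by [].
have e : fccomp (osum_hom (finite_finType _) (finite_finType _) (in_class_id c _) (lf (Y := Y)))
     (usum_hom (fh_in pp_s) (lto (uctx (ap_G0 x))) pp_gs) =
   osum_hom (finite_finType _) (finite_finType _) (in_class_omap (fh_in pp_s)) pp_mid.
  apply: (@osum_hom_comp A c V _ _ _ _ (finite_finType _) (finite_finType _)) => -[j|].
    exact: (esym (lfrom_lto_cut _)).
  exact: (esym (lfromK c K (uctx (ap_G0 x)))). 
rewrite hsum_psi [LHS](esym (fccomp_idr _)) -[in LHS]usum_args_rho -e /om.
by rewrite !fccompA.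
Qed.
End PsiPhi.
End Psi.

Definition app_to D a (x : F0 (den_app P Q) D a) : sp0 (app_sp F G) (uctx D) a := app_gen (qrep x).

Lemma app_toE D a (x : apre D a) : app_to (qcls (@arel A c n P Q D a) x) = app_gen x.
Proof.
have := qcls_inv (qrepK (qcls (@arel A c n P Q D a) x)).
by move=> /(@clos_inv _ _ _ (@app_gen D a)); apply; apply: arel_iff_move; apply: app_gen_move.
Qed.

Definition app_from D a : sp0 (app_sp F G) (uctx D) a -> F0 (den_app P Q) D a :=
  sub_lift (F := unlam_sp F) (Q := R) (fun Y f h => qcls (@arel A c n P Q D a) (app_pre f h)).

Lemma app_fromE D a Y f h : @app_from D a (gen (X := Y) f h) = qcls (@arel A c n P Q D a) (app_pre f h).
Proof.
by rewrite /app_from sub_liftE // => *; apply: qcls_eq; apply: move_arel; apply: psi_move.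
Qed.

Lemma represents_app_of : represents b (den_app P Q) (app_sp F G).
Proof.
exists app_to, app_from; split=> [D a x|D a y|D D' a a' d g x].
- rewrite -(qrepK x) app_toE /app_gen app_fromE; apply: qcls_eq; apply: move_arel.
  exact: psi_phi_move.
- by elim/gen_ind: y => Y f h; rewrite app_fromE app_toE phi_psi_gen.
rewrite [F1 d g x]/(F1 _ _ _) /= /qmap app_toE /app_to.
move: (qrep x) => {}x; rewrite /app_gen; apply/esym/(etrans (CompE _ _ _ _)).
congr gen.
  rewrite /= /unlam1 /app_f PN !sp1_comp uhom_id !fccomp_idl.
  have -> : HArr (inC_id c (size (ap_as x))) (fun i => did (lnth (ap_as x) i)) g =
    mkArr (fid (fl (ap_as x))) g by apply: HArr_eq.
  rewrite /arrX !mkArr_comp dcomp_idl dcomp_idr; congr (sp1 _ (mkArr _ _) _).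
  rewrite fcomp_idr; refine (etrans (f_equal (fun t => fcomp (fcomp _ t) _) (fcomp_idl _)) _).
  by rewrite of_lstK fcomp_idl.
rewrite -fccompA; apply: (f_equal (fun t => fccomp t _)).
by rewrite /hsum /= uhom_comp fccompA.
Qed.
End AppTransfer.

Lemma represents_app (A : category) (c : fclass) n (V : finType) (b : V -> 'I_n) (b' : 'I_n -> V)
    (K : cancel b b') (K' : cancel b' b) (P Q : psh A c n) (F G : species A c V) :
  represents b P F -> represents b Q G -> represents b (den_app P Q) (app_sp F G).
Proof.
move=> [phiP [psiP [PK PK' PN]]] [phiQ [psiQ [QK QK' QN]]].
exact: (represents_app_of K K' PK PK' PN QK QK' QN).
Qed.

(** * Invariance under beta *)

Lemma den_represents (A : category) (c : fclass) (t : term) n (V : finType) (b : V -> 'I_n)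
    (b' : 'I_n -> V) (env : nat -> option 'I_n) (env' : nat -> option V) :
  cancel b b' -> cancel b' b -> (forall k, env k = omap b (env' k)) ->
  represents b (den A c t env) (den_sp A c t env').
Proof.
elim: t n V b b' env env' => [k|t IH|t1 IH1 t2 IH2] n V b b' env env' K K' E /=.
- rewrite E; case: (env' k) => [v|] /=; last exact: represents_none.
  exact: (represents_var A c K K').
- apply: represents_lam; apply: (IH n.+1 (option V) _ (bunlift b')).
  + exact: bliftK.
  + exact: bunliftK.
  + by case=> [|k] //=; rewrite E; case: (env' k).
- exact: (represents_app K K' (IH1 _ _ _ _ _ _ K K' E) (IH2 _ _ _ _ _ _ K K' E)).
Qed.

Lemma represents_nat_iso (A : category) (c : fclass) n (V : finType) (b : V -> 'I_n)
    (P Q : psh A c n) (F G : species A c V) :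
  represents b P F -> represents b Q G -> sp_iso F G -> nat_iso P Q.
Proof.
move=> [p [p' [K K' N]]] [q [q' [L L' M]]] [r [r' [H H' O]]].
have M' D D' a a' (d : chom c D' D) (g : dhom c a a') x :
    q' D' a' (sp1 (uhom b d) g x) = F1 d g (q' D a x).
  by rewrite -{1}(L' _ _ x) -M L.
exists (fun D a x => q' D a (r _ a (p D a x))), (fun D a y => p' D a (r' _ a (q D a y))).
split; [|split] => [D a x|D a y|D D' a a' d g x].
- by rewrite L' H K.
- by rewrite K' H' L.
- by rewrite N O M'.
Qed.

Theorem theorem4 (A : category) (c : fclass) (M N : term) (xs : seq nat) :
  beta M N ->
  uniq xs ->
  (forall k, fv M k -> k \in xs) ->
  (forall k, fv N k -> k \in xs) ->
  nat_iso (den A c M (env_of xs)) (den A c N (env_of xs)).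
Proof.
move=> MN _ _ _.
(* The species are taken over the variables ['I_(size xs)] themselves, related to the contexts by
   the identity bijection. *)
have E k : env_of xs k = omap id (env_of xs k) by case: (env_of xs k).
have K : cancel id (@id 'I_(size xs)) by [].
apply: represents_nat_iso (den_beta A c MN (env_of xs));
  exact: (den_represents A c _ K K E).
Qed.
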